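(* The Offensive Alliance problem on circle graphs is NP-complete.
   Context: All graphs are finite, simple and undirected. For $S\subseteq V(G)$, $N(S)$ is the open neighbourhood of $S$, $S^c=V(G)\setminus S$, and $d_S(v)$ is the number of neighbours of $v$ in $S$. A non-empty set $S\subseteq V(G)$ is an offensive alliance if $d_S(v)\ge d_{S^c}(v)+1$ for every $v\in N(S)$. Offensive Alliance: given a graph $G$ and integer $r\ge 1$, is there an offensive alliance $S$ with $1\le |S|\le r$? A circle graph is a graph whose vertices can be associated with chords of a circle such that two vertices are adjacent if and only if the corresponding chords cross. *)

(* Defs.v *)
From Stdlib Require Import Reals NArith.
From mathcomp Require Import all_boot all_algebra.

Set Implicit Arguments.
Unset Strict Implicit.
Unset Printing Implicit Defensive.

(** * Multi-tape Turing machines *)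

Inductive move := MoveL | MoveN | MoveR.

(* [tm_sym] lists the work symbols other than the bits and the blank.  The
   machine has at least three tapes: tape 0 holds the input, tape 1 the second
   input (the certificate, if any) and the last tape receives the output. *)
Record tm := TM {
  tm_work  : nat;
  tm_state : finType;
  tm_sym   : finType;
  tm_start : tm_state;
  tm_halt  : pred tm_state;
  tm_delta : tm_state -> {ffun 'I_tm_work.+3 -> option (bool + tm_sym)} ->
             tm_state * {ffun 'I_tm_work.+3 -> option (bool + tm_sym) * move}
}.

Section Semantics.

Variable M : tm.

Definition cell : Type := option (bool + tm_sym M).
Definition blank : cell := None.
Definition bit (b : bool) : cell := Some (inl b).

(* Two-way infinite tape: [tleft] lists the cells left of the head, nearest
   first; [tright] lists the scanned cell and the cells to its right.  All the
   cells beyond these two lists are blank. *)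
Record tape := Tape { tleft : seq cell; tright : seq cell }.

Definition scan (t : tape) : cell := head blank (tright t).

Definition tape_write (c : cell) (t : tape) : tape :=
  Tape (tleft t) (c :: behead (tright t)).

Definition tape_move (m : move) (t : tape) : tape :=
  match m with
  | MoveL => Tape (behead (tleft t)) (head blank (tleft t) :: tright t)
  | MoveN => t
  | MoveR => Tape (scan t :: tleft t) (behead (tright t))
  end.

Record config := Config {
  cstate : tm_state M;
  ctapes : {ffun 'I_(tm_work M).+3 -> tape}
}.

Definition step (c : config) : config :=
  if tm_halt (cstate c) then c else
  let: (q, act) := tm_delta (cstate c) [ffun i => scan (ctapes c i)] in
  Config q [ffun i => tape_move (act i).2 (tape_write (act i).1 (ctapes c i))].

Definition init (x y : seq bool) : config :=
  Config (tm_start M)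
    [ffun i : 'I_(tm_work M).+3 =>
       Tape [::] (map bit (match val i with 0 => x | 1 => y | _ => [::] end))].

Fixpoint leading_bits (s : seq cell) : seq bool :=
  if s is Some (inl b) :: s' then b :: leading_bits s' else [::].

(* The output word starts at the head of the last tape and extends to the
   first cell that is not a bit. *)
Definition output (c : config) : seq bool :=
  leading_bits (tright (ctapes c ord_max)).

Definition computes_within (T : nat) (x y w : seq bool) : Prop :=
  let c := iter T step (init x y) in tm_halt (cstate c) /\ output c = w.

End Semantics.

(** * NP-completeness of languages over the binary alphabet *)

Definition language := seq bool -> Prop.

Definition polytime_function (f : seq bool -> seq bool) : Prop :=
  exists (M : tm) (p : {poly nat}),
    forall x, computes_within M (p.[size x])%R x [::] (f x).

Definition polytime_relation (V : seq bool -> seq bool -> bool) : Prop :=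
  exists (M : tm) (p : {poly nat}),
    forall x y, computes_within M (p.[(size x + size y)%N])%R x y [:: V x y].

Definition in_NP (L : language) : Prop :=
  exists (V : seq bool -> seq bool -> bool) (p : {poly nat}),
    polytime_relation V /\
    forall x, L x <-> exists y, size y <= (p.[size x])%R /\ V x y.

Definition poly_reducible (L1 L2 : language) : Prop :=
  exists f : seq bool -> seq bool,
    polytime_function f /\ forall x, L1 x <-> L2 (f x).

Definition NP_hard (L : language) : Prop :=
  forall L' : language, in_NP L' -> poly_reducible L' L.

Definition NP_complete (L : language) : Prop := in_NP L /\ NP_hard L.

(** * Graphs and offensive alliances *)

Record sgraph (n : nat) := SGraph {
  adj :> rel 'I_n;
  adj_sym : symmetric adj;
  adj_irrefl : irreflexive adj
}.

Section Alliances.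

Variables (n : nat) (G : sgraph n).

Definition deg_in (S : {set 'I_n}) (v : 'I_n) : nat := #|[set u in S | G v u]|.

(* Open neighbourhood of a set, in the convention N(S) = N[S] \ S. *)
Definition open_nbhd (S : {set 'I_n}) : {set 'I_n} :=
  [set v | [exists u in S, G u v]] :\: S.

Definition offensive_alliance (S : {set 'I_n}) : Prop :=
  S != set0 /\
  forall v, v \in open_nbhd S -> deg_in S v >= deg_in (~: S) v + 1.

End Alliances.

(** * Circle graphs *)

Section Chords.

Local Open Scope R_scope.

Definition point : Type := (R * R)%type.

Definition on_circle (p : point) : Prop := (p.1 * p.1 + p.2 * p.2 = 1).

Definition on_segment (p q z : point) : Prop :=
  exists t : R, (0 <= t <= 1) /\
    z = (((1 - t) * p.1 + t * q.1), ((1 - t) * p.2 + t * q.2)).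

Definition segments_meet (p q p' q' : point) : Prop :=
  exists z, on_segment p q z /\ on_segment p' q' z.

End Chords.

(* Vertex [v] is mapped to the chord with ends [ends (v, false)] and
   [ends (v, true)].  As all the ends are distinct, two chords that meet do so
   in the interior of both, i.e. they cross. *)
Definition circle_graph (n : nat) (G : sgraph n) : Prop :=
  exists ends : 'I_n * bool -> point,
    [/\ forall e, on_circle (ends e),
        injective ends &
        forall u v : 'I_n, u != v ->
          (G u v <-> segments_meet (ends (u, false)) (ends (u, true))
                                   (ends (v, false)) (ends (v, true)))].

(** * The decision problem as a language *)

(* Binary notation, least significant bit first; 0 is the empty word. *)
Fixpoint bits_of_pos (p : positive) : seq bool :=
  match p with
  | xH => [:: true]
  | xO p' => false :: bits_of_pos p'
  | xI p' => true :: bits_of_pos p'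
  end.

Definition bits_of_nat (r : nat) : seq bool :=
  if N.of_nat r is Npos p then bits_of_pos p else [::].

(* The order in unary, a separator, the adjacency matrix row by row, and then
   the bound in binary. *)
Definition encode (n : nat) (G : sgraph n) (r : nat) : seq bool :=
  nseq n true ++ false ::
  [seq G i j | i <- enum 'I_n, j <- enum 'I_n] ++ bits_of_nat r.

(* Words that encode no instance, or an instance whose graph is not a circle
   graph, are outside the language. *)
Definition OffensiveAllianceCircle : language := fun w =>
  exists (n : nat) (G : sgraph n) (r : nat),
    [/\ w = encode G r,
        circle_graph G,
        1 <= r &
        exists S : {set 'I_n}, offensive_alliance G S /\ 1 <= #|S| <= r].

(* Main.v *)
(* Membership.  Up to crossings, a chord diagram is given by the order of the ends
   of its chords along the circle, so that these positions and the alliance form a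
   certificate.

   Hardness is proved from Turing machines.  The run of a verifier is a tableau of
   cells with values in a fixed finite set, in which certain triples of values are
   forbidden: every cell has some value (positive clauses) and no forbidden triple
   occurs (negative clauses).  For every variable and every clause there are two
   chords, one for each literal, and the budget allows exactly one chord of each pair.
   Short chords around two consecutive left ends, which have to be crossed by a chosen
   chord, force the value of a variable to be monotone in the clause; this is enough,
   since the positive clauses come first.  Short chords around the right ends of the
   literals of a clause express the clause.

   To turn this hitting problem into offensive alliances, a necklace of chords runs
   around the circle.  Their degree is so large that a small alliance contains all of
   them as soon as it touches one, and so it contains them all and touches all other
   chords.  Cliques that exceed the budget cannot be met by the alliance; attached to the
   chords that have to be hit, they keep these out of the alliance and turn the majority
   condition into the presence of one chosen neighbour.

   The reduction and the verifier run in polynomial time because they are defined by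
   primitive recursions with polynomially bounded values, which compile to machines
   whose tapes serve as unary counters. *)

From Stdlib Require Import Reals Lra NArith FunctionalExtensionality ClassicalEpsilon.
From mathcomp Require Import all_boot ssralg poly zify.
Require Import Defs.

Set Implicit Arguments.
Unset Strict Implicit.
Unset Printing Implicit Defensive.

(** * Structured programs over counter tapes *)

(** A chord outside the alliance with at least twice [budget] neighbours cannot be touched: a
    majority would put more than [budget] of them inside. So membership spreads along heavy chords,
    and no clique of more than [budget] heavy chords can be touched. A red chord can only express a
    disjunction, namely that some blue chord crossing it is chosen. For the two literals of one
    variable and clause the tight budget sharpens this to exactly one; between consecutive clauses
    nothing does, so a variable that is true at a clause stays true afterwards, but may turn from
    false to true. All values are therefore read at clause [N], after the positive clauses, whose
    chosen literals have persisted until then, and before the negative ones, whose chosen literals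
    show that their variable was still false. Since a triple may repeat a cell, forbidden triples
    cover unary and binary constraints as well; three cells are needed because the record of a row
    decides which cell of that row determines a cell of the next. *)

Notation csym := (option (bool + unit)).
Definition marker : csym := Some (inr tt).

Inductive prog :=
| Skip
| Right of nat
| Left of nat
| Out of bool
| Seq of prog & prog
| While of nat & pred csym & prog
| If of nat & pred csym & prog.

Definition upd (h : nat -> nat) (j v : nat) : nat -> nat :=
  fun i => if i == j then v else h i.

(* Tapes 0 and 1 hold the inputs.  Any other tape carries a marker at its
   origin and nothing else, so that its head position is a counter. *)
Definition tape_content (x y : seq bool) (j p : nat) : csym :=
  match j with
  | 0 => nth None (map (fun b => Some (inl b)) x) p
  | 1 => nth None (map (fun b => Some (inl b)) y) p
  | _ => if p == 0 then marker else None
  end.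

Section Execution.

Variables x y : seq bool.
Notation content := (tape_content x y).

(* A store consists of the head positions and of the output word; the last
   argument counts Turing machine steps. *)
Inductive exec : prog -> (nat -> nat) * seq bool -> (nat -> nat) * seq bool ->
    nat -> Prop :=
| ExecSkip s : exec Skip s s 0
| ExecRight j h w : exec (Right j) (h, w) (upd h j (h j).+1, w) 1
| ExecLeft j h w : 0 < h j -> exec (Left j) (h, w) (upd h j (h j).-1, w) 1
| ExecOut b h w : exec (Out b) (h, w) (h, b :: w) 2
| ExecSeq p q s1 s2 s3 t1 t2 : exec p s1 s2 t1 -> exec q s2 s3 t2 ->
    exec (Seq p q) s1 s3 (t1 + t2)
| ExecWhileF j (P : pred csym) p s : ~~ P (content j (s.1 j)) -> exec (While j P p) s s 1
| ExecWhileT j (P : pred csym) p s1 s2 s3 t1 t2 : P (content j (s1.1 j)) ->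
    exec p s1 s2 t1 -> exec (While j P p) s2 s3 t2 ->
    exec (While j P p) s1 s3 (t1.+2 + t2)
| ExecIfF j (P : pred csym) p s : ~~ P (content j (s.1 j)) -> exec (If j P p) s s 1
| ExecIfT j (P : pred csym) p s1 s2 t : P (content j (s1.1 j)) -> exec p s1 s2 t ->
    exec (If j P p) s1 s2 t.+1.

End Execution.

Fixpoint used (p : prog) : nat :=
  match p with
  | Skip | Out _ => 0
  | Right j | Left j => j.+1
  | Seq p q => maxn (used p) (used q)
  | While j _ p | If j _ p => maxn j.+1 (used p)
  end.

Inductive instr :=
| IInit
| IAct of nat & move & option csym
| ITest of nat & pred csym & nat
| IGoto of nat.

(** * Compilation of programs to machine code *)

Section Compilation.

Variable R : nat.

(** Jump targets are absolute, hence the address [o] of the first instruction. [Out] moves left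
    before it writes, so that the head of the output tape stays on the first letter of the word,
    where [output] starts reading. *)
Fixpoint code (p : prog) (o : nat) : seq instr :=
  match p with
  | Skip => [::]
  | Right j => [:: IAct j MoveR None]
  | Left j => [:: IAct j MoveL None]
  | Out b => [:: IAct R.+2 MoveL None; IAct R.+2 MoveN (Some (Some (inl b)))]
  | Seq p q => let c := code p o in c ++ code q (o + size c)
  | While j P p => let c := code p o.+1 in
      ITest j P (o + size c).+2 :: rcons c (IGoto o)
  | If j P p => let c := code p o.+1 in ITest j P (o + size c).+1 :: c
  end.

Definition machine_delta (c : seq instr) (q : 'I_(size c).+1)
    (sc : {ffun 'I_R.+3 -> csym}) :
    'I_(size c).+1 * {ffun 'I_R.+3 -> csym * move} :=
  let stay := [ffun i => (sc i, MoveN)] in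
  match nth IInit c q with
  | IInit => (inord q.+1,
      [ffun i : 'I_R.+3 => (if 1 < i < R.+2 then marker else sc i, MoveN)])
  | IAct j m w => (inord q.+1, [ffun i : 'I_R.+3 =>
      if i == j :> nat then (odflt (sc i) w, m) else (sc i, MoveN)])
  | ITest j P l => ((if P (sc (inord j)) then inord q.+1 else inord l), stay)
  | IGoto l => (inord l, stay)
  end.

Definition machine (c : seq instr) : tm :=
  @TM R 'I_(size c).+1 unit (@inord (size c) 0) (fun q => q == size c :> nat)
     (@machine_delta c).

End Compilation.

(** * Simulation of programs by the compiled machine *)

Section Simulation.

Variables (R : nat) (x y : seq bool).
Notation content := (tape_content x y).

Section FixCode.

Variable c : seq instr.
Notation M := (machine R c).
Notation tape := (tape M).
Notation blank := (@blank M).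

(** Reading with default [blank] ignores how many trailing blanks the lists contain. Nothing is said
    about cells to the left of the origin, which the head never visits. *)
Definition tape_at (t : tape) (f : nat -> csym) (h : nat) : Prop :=
  (forall j, j < h -> nth blank (tleft t) j = f (h - j.+1)) /\
  (forall j, nth blank (tright t) j = f (h + j)).

Definition out_tape (t : tape) (w : seq bool) : Prop :=
  (forall j, nth blank (tleft t) j = None) /\
  (forall j, nth blank (tright t) j = nth None (map (fun b => Some (inl b)) w) j).

Definition represents (ts : {ffun 'I_R.+3 -> tape})
    (s : (nat -> nat) * seq bool) : Prop :=
  (forall i : 'I_R.+3, i < R.+2 -> tape_at (ts i) (content i) (s.1 i)) /\
  out_tape (ts ord_max) s.2.

Lemma scan_nth (t : tape) : scan t = nth blank (tright t) 0.
Proof. by rewrite /scan nth0. Qed.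

Lemma nth_write (t : tape) a j :
  nth blank (tright (tape_write a t)) j =
  if j == 0 then a else nth blank (tright t) j.
Proof. by case: j => [|j] //=; rewrite nth_behead. Qed.

(** An instruction writes on every tape, so an idle tape gets its scanned symbol back. On an
    exhausted list this adds an explicit blank: the contents are preserved, the lists are not. *)
Lemma nth_rewrite (t : tape) j :
  nth blank (tright (tape_write (scan t) t)) j = nth blank (tright t) j.
Proof. by rewrite nth_write; case: j => //=; rewrite scan_nth. Qed.

Lemma tape_at_keep t f h : tape_at t f h -> tape_at (tape_write (scan t) t) f h.
Proof. by case=> hl hr; split=> j; [exact: hl | rewrite nth_rewrite]. Qed.

Lemma tape_at_right t f h : tape_at t f h ->
  tape_at (tape_move MoveR (tape_write (scan t) t)) f h.+1.
Proof.
case=> hl hr; split=> j /=.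
  case: j => [|j] jh /=; first by rewrite /scan /= -nth0 hr; congr f; lia.
  by rewrite hl //; congr f; lia.
by rewrite nth_behead hr; congr f; lia.
Qed.

Lemma tape_at_left t f h : 0 < h -> tape_at t f h ->
  tape_at (tape_move MoveL (tape_write (scan t) t)) f h.-1.
Proof.
move=> h0 [hl hr]; split=> j /=.
  by move=> jh; rewrite nth_behead hl; [congr f|]; lia.
case: j => [|j] /=; first by rewrite -nth0 hl //; congr f; lia.
have -> : scan t :: behead (tright t) = tright (tape_write (scan t) t) by [].
by rewrite nth_rewrite hr; congr f; lia.
Qed.

Lemma represents_keep ts s : represents ts s ->
  represents [ffun i => tape_write (scan (ts i)) (ts i)] s.
Proof.
case=> h1 [h2 h3]; split=> [i iR|]; first by rewrite ffunE; apply/tape_at_keep/h1.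
by rewrite ffunE; split=> j //=; rewrite -h3 nth_rewrite.
Qed.

Definition code_at (o : nat) (d : seq instr) : Prop :=
  exists c1 c2, c = c1 ++ d ++ c2 /\ size c1 = o.

Lemma code_at_nth o a d : code_at o (a :: d) -> nth IInit c o = a /\ o < size c.
Proof.
by case=> c1 [c2 [-> <-]]; rewrite nth_cat ltnn subnn !size_cat /=; split=> //; lia.
Qed.

Lemma code_at_cat o d1 d2 : code_at o (d1 ++ d2) ->
  code_at o d1 /\ code_at (o + size d1) d2.
Proof.
case=> c1 [c2 [ec <-]]; split; first by exists c1, (d2 ++ c2); rewrite ec !catA.
by exists (c1 ++ d1), c2; rewrite ec !catA size_cat.
Qed.

Definition at_pc (o : nat) ts : config M := @Config M (inord o) ts.

Lemma step_init ts : nth IInit c 0 = IInit -> 0 < size c ->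
  step (at_pc 0 ts) = at_pc 1 [ffun i : 'I_R.+3 =>
    @tape_write M (if 1 < i < R.+2 then marker else scan (ts i)) (ts i)].
Proof.
move=> c0 sc; rewrite /step /= inordK //; rewrite ltn_eqF //.
rewrite /machine_delta inordK // c0; congr Config; apply/ffunP=> i.
by rewrite !ffunE /=.
Qed.

Lemma step_test o ts j P l : nth IInit c o = ITest j P l -> o < size c ->
  step (at_pc o ts) = at_pc (if P (scan (ts (inord j))) then o.+1 else l)
    [ffun i => tape_write (scan (ts i)) (ts i)].
Proof.
move=> co os; rewrite /step /= inordK ?leqW // ltn_eqF //.
rewrite /machine_delta inordK ?leqW // co ffunE; congr Config.
  by case: ifP.
by apply/ffunP=> i; rewrite !ffunE /=.
Qed.

Lemma step_goto o ts l : nth IInit c o = IGoto l -> o < size c ->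
  step (at_pc o ts) = at_pc l [ffun i => tape_write (scan (ts i)) (ts i)].
Proof.
move=> co os; rewrite /step /= inordK ?leqW // ltn_eqF //.
rewrite /machine_delta inordK ?leqW // co; congr Config.
by apply/ffunP=> i; rewrite !ffunE /=.
Qed.

Lemma step_act o ts j m w : nth IInit c o = IAct j m w -> o < size c ->
  step (at_pc o ts) = at_pc o.+1 [ffun i : 'I_R.+3 =>
    if i == j :> nat then tape_move m (tape_write (odflt (scan (ts i)) w) (ts i))
    else tape_write (scan (ts i)) (ts i)].
Proof.
move=> co os; rewrite /step /= inordK ?leqW // ltn_eqF //.
rewrite /machine_delta inordK ?leqW // co; congr Config.
by apply/ffunP=> i; rewrite !ffunE; case: ifP.
Qed.

Lemma represents_act ts h w j m h' : j < R.+2 ->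
  represents ts (h, w) ->
  (forall i : 'I_R.+3, i = j :> nat ->
     tape_at (tape_move m (tape_write (scan (ts i)) (ts i))) (content i) h') ->
  represents [ffun i : 'I_R.+3 =>
    if i == j :> nat then tape_move m (tape_write (odflt (scan (ts i)) None) (ts i))
    else tape_write (scan (ts i)) (ts i)] (upd h j h', w).
Proof.
move=> jR /represents_keep [h1 h2] h3; split=> [i iR|] /=.
  rewrite ffunE /upd; case: eqP => [/h3 //|_].
  by have := h1 i iR; rewrite ffunE.
rewrite ffunE ifF; last by apply/eqP=> /= ij; move: jR; rewrite -ij ltnn.
by move: h2; rewrite ffunE.
Qed.

Lemma scan_represents ts s j : j < R.+2 -> represents ts s ->
  scan (ts (inord j)) = content j (s.1 j).
Proof.
move=> jR [h _]; have := h (inord j); rewrite (inordK (leqW jR)) => /(_ jR) [_ hr].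
by rewrite scan_nth hr addn0.
Qed.

Lemma iter_step_trans t1 t2 (a b d : config M) :
  iter t1 (@step M) a = b -> iter t2 (@step M) b = d ->
  iter (t1 + t2) (@step M) a = d.
Proof. by rewrite addnC iterD => ->. Qed.

(** Induction on the execution and not on the program, because a loop continues with itself. *)
Lemma exec_simulation p s s' t : exec x y p s s' t ->
  forall o ts, used p <= R.+2 -> code_at o (code R p o) -> represents ts s ->
  exists2 ts', iter t (@step M) (at_pc o ts) = at_pc (o + size (code R p o)) ts'
             & represents ts' s'.
Proof.
elim=> {p s s' t}.
- by move=> s o ts _ _ rep; exists ts; rewrite // addn0.
- move=> j h w o ts /= jR /code_at_nth [co os] rep.
  rewrite (step_act ts co os) addn1; eexists; first by [].
  apply: represents_act => // i ij; apply: tape_at_right.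
  by rewrite -ij; apply: rep.1; rewrite ij.
- move=> j h w h0 o ts /= jR /code_at_nth [co os] rep.
  rewrite (step_act ts co os) addn1; eexists; first by [].
  apply: represents_act => // i ij; apply: tape_at_left => //.
  by rewrite -ij; apply: rep.1; rewrite ij.
- move=> b h w o ts /= _ co [h1 h2].
  have [/code_at_nth [c1 o1]] := @code_at_cat o [:: _] [:: _] co.
  rewrite addn1 => /code_at_nth [c2 o2]; rewrite (step_act ts c1 o1).
  rewrite (step_act _ c2 o2) addn2; eexists; first by [].
  split=> [i iR|] /=.
    rewrite !ffunE ltn_eqF //; do 2 apply: tape_at_keep; exact: h1.
  rewrite !ffunE eqxx; case: h2 => hl hr; split=> j /=.
    by rewrite nth_behead hl.
  case: j => [|j] //=; rewrite -[_ :: _]/(tright (tape_write (scan (ts ord_max)) (ts ord_max))).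
  by rewrite nth_rewrite hr.
- move=> p q s1 s2 s3 t1 t2 _ IH1 _ IH2 o ts /=; rewrite geq_max => /andP[up uq].
  case/code_at_cat=> cp cq rep; have [ts1 it1 rep1] := IH1 o ts up cp rep.
  have [ts2 it2 rep2] := IH2 _ ts1 uq cq rep1; exists ts2 => //.
  by rewrite size_cat addnA; exact: iter_step_trans it1 it2.
- move=> j P p s nP o ts /=; rewrite geq_max => /andP[jR _] /code_at_nth [co os] rep.
  rewrite (step_test ts co os) (scan_represents jR rep) (negbTE nP) size_rcons.
  by rewrite !addnS; eexists; [by [] | exact: represents_keep].
- move=> j P p s1 s2 s3 t1 t2 Ps _ IH1 _ IH2 o ts uW cW rep.
  (* One step for the test, [t1] for the body, one for the jump back, and [t2] for the remaining
     rounds. *)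
  have -> : t1.+2 + t2 = 1 + (t1 + (1 + t2)) by lia.
  move: (uW) (cW); rewrite {1}/used -/used geq_max => /andP[jR up] cW'.
  have [co os] := code_at_nth cW'.
  have [_] := @code_at_cat o [:: _] (rcons (code R p o.+1) (IGoto o)) cW'.
  rewrite addn1 -cats1 => /code_at_cat [cp /code_at_nth [cg og]].
  have [ts1 it1 rep1] := IH1 o.+1 _ up cp (represents_keep rep).
  have [ts2 it2 rep2] := IH2 o _ uW cW (represents_keep rep1).
  exists ts2 => //.
  apply: iter_step_trans; first by rewrite /= (step_test ts co os) (scan_represents jR rep) Ps.
  apply: iter_step_trans; first exact: it1.
  apply: iter_step_trans it2; exact: step_goto cg og.
- move=> j P p s nP o ts /=; rewrite geq_max => /andP[jR _] /code_at_nth [co os] rep.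
  rewrite (step_test ts co os) (scan_represents jR rep) (negbTE nP).
  by rewrite !addnS; eexists; [by [] | exact: represents_keep].
- move=> j P p s1 s2 t Ps _ IH o ts; rewrite {1}/used -/used geq_max => /andP[jR up] cW rep.
  have [co os] := code_at_nth cW.
  have [_] := @code_at_cat o [:: _] (code R p o.+1) cW; rewrite addn1 => cp.
  have [ts1 it1 rep1] := IH o.+1 _ up cp (represents_keep rep).
  exists ts1 => //; rewrite -[t.+1]add1n [size _]/= addnS -addSn; apply: iter_step_trans it1.
  by rewrite /= (step_test ts co os) (scan_represents jR rep) Ps.
Qed.

End FixCode.

End Simulation.

Lemma leading_bits_nth M (s : seq (cell M)) (w : seq bool) :
  (forall j, nth None s j = nth None (map (fun b => Some (inl b)) w) j) ->
  leading_bits s = w.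
Proof.
elim: w s => [|b w IH] [|a s] H //; have := H 0 => //= e0.
- by rewrite e0.
- by rewrite e0 IH // => j; exact: (H j.+1).
Qed.

Lemma iter_step_halted M t (c : config M) : tm_halt (cstate c) -> iter t (@step M) c = c.
Proof. by move=> hc; elim: t => //= t ->; rewrite /step hc. Qed.

Lemma computes_within_le M T T' x y w : T <= T' ->
  @computes_within M T x y w -> computes_within M T' x y w.
Proof.
move=> /subnK <- [h1 h2]; rewrite /computes_within iterD.
by rewrite iter_step_halted.
Qed.

Definition prog_tm (p : prog) : tm := machine (used p) (IInit :: code (used p) p 1).

(** The additional step is [IInit], which sets the markers of the counter tapes. *)
Lemma prog_tm_computes (p : prog) (x y w : seq bool) h t :
  exec x y p (fun=> 0, [::]) (h, w) t -> computes_within (prog_tm p) t.+1 x y w.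
Proof.
rewrite /prog_tm; set R := used p; set c := IInit :: _; move=> ex_p; rewrite /computes_within -addn1 iterD.
set s1 := iter 1 _ _.
have s1E : s1 = at_pc 1 [ffun i : 'I_R.+3 =>
    @tape_write (machine R c) (if 1 < i < R.+2 then marker else
      scan (ctapes (@init (machine R c) x y) i)) (ctapes (@init (machine R c) x y) i)].
  by rewrite /s1 -step_init.
have rep1 : represents x y (ctapes s1) (fun=> 0, [::]).
  rewrite s1E /=; split=> [i iR|]; rewrite !ffunE.
    split=> [//|j]; rewrite /= add0n.
    case: i iR => [[|[|i]] /= iR'] iR; rewrite ?iR /=.
    - exact: (@nth_rewrite R c (Tape [::] (map (@bit _) x))).
    - exact: (@nth_rewrite R c (Tape [::] (map (@bit _) y))).
    - by case: j => [|j] //=; rewrite nth_nil.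
  rewrite /= ltnn; split=> j /=; rewrite ?nth_nil //.
  by case: j => [|j] //=; rewrite nth_nil.
have cp : code_at c 1 (code R p 1) by exists [:: IInit], [::]; rewrite cats0.
have uR : used p <= R.+2 by rewrite /R; lia.
have [ts' it' [_ [_ rep']]] := exec_simulation ex_p uR cp rep1.
move: it'; rewrite [in at_pc 1 _]s1E /= -s1E => ->.
split; first by rewrite /= inordK // add1n.
exact: leading_bits_nth.
Qed.

(** * Execution with a bound on the running time *)

Ltac upd_tac :=
  apply: functional_extensionality => ?; rewrite /upd /=;
  repeat (match goal with |- context [?a == ?b] =>
    let e := fresh "e" in case: (eqVneq a b) => e; try (exfalso; lia) end);
  subst; rewrite ?eqxx /=; lia.

Section Hoare.

Variables x y : seq bool.
Notation content := (tape_content x y).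

Definition runs p s s' T := exists2 t, t <= T & exec x y p s s' t.

Lemma runs_le p s s' T T' : T <= T' -> runs p s s' T -> runs p s s' T'.
Proof. by move=> le [t tT ?]; exists t => //; apply: leq_trans le. Qed.

Lemma runs_skip s : runs Skip s s 0.
Proof. by exists 0 => //; constructor. Qed.

Lemma runs_right j h w h' : h' = upd h j (h j).+1 -> runs (Right j) (h, w) (h', w) 1.
Proof. by move=> ->; exists 1 => //; constructor. Qed.

Lemma runs_left j h w h' : 0 < h j -> h' = upd h j (h j).-1 ->
  runs (Left j) (h, w) (h', w) 1.
Proof. by move=> ? ->; exists 1 => //; constructor. Qed.

Lemma runs_out b h w : runs (Out b) (h, w) (h, b :: w) 2.
Proof. by exists 2 => //; constructor. Qed.

Lemma runs_seq p q s1 s2 s3 T1 T2 : runs p s1 s2 T1 -> runs q s2 s3 T2 ->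
  runs (Seq p q) s1 s3 (T1 + T2).
Proof.
move=> [t1 l1 e1] [t2 l2 e2]; exists (t1 + t2); first exact: leq_add.
exact: ExecSeq e1 e2.
Qed.

Lemma runs_if j (P : pred csym) p s s' T :
  (P (content j (s.1 j)) -> runs p s s' T) ->
  (~~ P (content j (s.1 j)) -> s = s') -> runs (If j P p) s s' T.+1.
Proof.
case: (boolP (P _)) => Ps H1 H2; last by rewrite -(H2 isT); exists 1 => //; apply: ExecIfF.
by have [t tT e] := H1 isT; exists t.+1 => //; apply: ExecIfT.
Qed.

(** [s i] is the store before round [i]; the body bound [T] is increased by the test and the jump
    back. *)
Lemma runs_while j (P : pred csym) p (s : nat -> _) c T :
  (forall i, i < c -> P (content j ((s i).1 j)) /\ runs p (s i) (s i.+1) T) ->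
  ~~ P (content j ((s c).1 j)) ->
  runs (While j P p) (s 0) (s c) (c * T.+2).+1.
Proof.
elim: c s => [|c IH] s Hs Hc; first by exists 1 => //; apply: ExecWhileF.
have [P0 [t0 l0 e0]] := Hs 0 isT.
have [t1 l1 e1] : runs (While j P p) (s 1) (s c.+1) (c * T.+2).+1.
  by apply: (IH (fun i => s i.+1)) => // i ic; exact: (Hs i.+1).
exists (t0.+2 + t1); first by rewrite mulSn; lia.
exact: ExecWhileT e0 e1.
Qed.

Definition nonzero (a : csym) : bool := a != marker.

Lemma nonzero_content j h : 1 < j -> nonzero (content j h) = (h != 0).
Proof. by case: j => [|[|j]] // _ /=; case: h. Qed.

Definition Repeat j p := While j nonzero (Seq (Left j) p).

Lemma runs_repeat j p (s : nat -> (nat -> nat) * seq bool) T c : 1 < j ->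
  (forall i, i <= c -> (s i).1 j = c - i) ->
  (forall i, i < c -> runs p (upd (s i).1 j (c - i.+1), (s i).2) (s i.+1) T) ->
  runs (Repeat j p) (s 0) (s c) (c * T.+3).+1.
Proof.
move=> j1 sj Hs; apply: (@runs_while j nonzero _ s c T.+1) => [i ic|].
  have si := sj i (ltnW ic); rewrite nonzero_content // si; split; first by lia.
  rewrite -[T.+1]add1n; apply: runs_seq; last exact: Hs.
  rewrite [s i]surjective_pairing /=; apply: runs_left; rewrite si; first lia.
  by congr upd; lia.
by rewrite nonzero_content // sj // subnn.
Qed.

Definition Clear j := Repeat j Skip.
Definition Move j d := Repeat j (Right d).

Lemma upd_same h j v : upd h j v j = v.
Proof. by rewrite /upd eqxx. Qed.

Lemma upd_other h j v i : i != j -> upd h j v i = h i.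
Proof. by rewrite /upd => /negbTE ->. Qed.

Lemma runs_clear j h w h' : 1 < j -> h' = upd h j 0 ->
  runs (Clear j) (h, w) (h', w) (h j * 3).+1.
Proof.
move=> j1 ->; pose s i := (upd h j (h j - i), w).
have -> : (h, w) = s 0.
  by congr pair; apply: functional_extensionality => i; rewrite /upd; case: eqP => [->|] //; lia.
have -> : (upd h j 0, w) = s (h j) by rewrite /s subnn.
apply: runs_repeat => // i ic; rewrite /= ?upd_same //.
exists 0 => //; rewrite /s.
have -> : upd (upd h j (h j - i)) j (h j - i.+1) = upd h j (h j - i.+1).
  by apply: functional_extensionality => z; rewrite /upd; case: eqP.
by constructor.
Qed.

Lemma runs_move j d h w h' : 1 < j -> d != j ->
  h' = upd (upd h j 0) d (h d + h j) ->
  runs (Move j d) (h, w) (h', w) (h j * 4).+1.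
Proof.
move=> j1 dj ->; pose s i := (upd (upd h j (h j - i)) d (h d + i), w).
have -> : (h, w) = s 0.
  congr pair; apply: functional_extensionality => i; rewrite /upd.
  by do 2 (case: eqP => [->|_]; first by lia).
have -> : (upd (upd h j 0) d (h d + h j), w) = s (h j) by rewrite /s subnn.
apply: runs_repeat => // i ic; first by rewrite /= upd_other 1?eq_sym // upd_same.
by apply: runs_right; rewrite /s; upd_tac.
Qed.

(** A counter is read by counting it down, so its value is also collected in the scratch register
    [z], from which it is restored. *)
Definition Copy j d z := Seq (Repeat j (Seq (Right d) (Right z))) (Move z j).

Lemma runs_copy j d z h w h' : 1 < j -> 1 < z -> d != j -> z != j -> z != d ->
  h z = 0 -> h' = upd h d (h d + h j) ->
  runs (Copy j d z) (h, w) (h', w) (h j * 9).+2.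
Proof.
move=> j1 z1 dj zj zd hz ->.
pose s i := (upd (upd (upd h j (h j - i)) d (h d + i)) z i, w).
apply: (@runs_le _ _ _ ((h j * 5).+1 + (h j * 4).+1)); first by lia.
apply: (@runs_seq _ _ _ (s (h j))).
  have -> : (h, w) = s 0.
    congr pair; apply: functional_extensionality => i; rewrite /upd.
    by do 3 (case: eqP => [->|_]; first by lia).
  apply: runs_repeat => // i ic.
    by rewrite /= upd_other 1?eq_sym // upd_other 1?eq_sym // upd_same.
  rewrite -[2]/(1 + 1); apply: runs_seq; first by apply: runs_right.
  by apply: runs_right; rewrite /s; upd_tac.
have e : (s (h j)).1 z = h j by rewrite /= upd_same.
have := @runs_move z j (s (h j)).1 w (upd h d (h d + h j)) z1; rewrite e.
apply; first by rewrite eq_sym.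
by rewrite /s; upd_tac.
Qed.

End Hoare.

(** * A class of polynomial-time functions *)

Fixpoint ctx (n : nat) : Type :=
  if n is n'.+1 then (ctx n' * nat)%type else (seq bool * seq bool)%type.

Fixpoint inputs (n : nat) : ctx n -> seq bool * seq bool :=
  match n with 0 => id | n'.+1 => fun g => inputs g.1 end.

Fixpoint vals (n : nat) : ctx n -> seq nat :=
  match n with 0 => fun=> [::] | n'.+1 => fun g => g.2 :: vals g.1 end.

Definition csize n (g : ctx n) : nat :=
  size (inputs g).1 + size (inputs g).2 + sumn (vals g).

Definition input (b : bool) (p : seq bool * seq bool) : seq bool :=
  if b then p.2 else p.1.

(* Bounded primitive recursion over the two input words: the intermediate
   values must stay polynomial in the sizes of the words and in the values of
   the variables, as they are stored in unary. *)
Inductive pt : forall n, (ctx n -> nat) -> Prop :=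
| PtExt n (f g : ctx n -> nat) : f =1 g -> pt f -> pt g
| PtWeak n (f : ctx n -> nat) : pt f -> @pt n.+1 (fun g => f g.1)
| PtVar n : @pt n.+1 (fun g => g.2)
| PtZero n : @pt n (fun=> 0)
| PtSucc n (f : ctx n -> nat) : pt f -> pt (fun g => (f g).+1)
| PtBit n b (f : ctx n -> nat) : pt f ->
    pt (fun g : ctx n => nat_of_bool (nth false (input b (inputs g)) (f g)))
| PtSize n b : pt (fun g : ctx n => size (input b (inputs g)))
| PtPrec n (k e : ctx n -> nat) (f : ctx n.+2 -> nat) d : pt k -> pt e -> pt f ->
    (forall g i, i <= k g ->
       iteri i (fun i v => f (g, i, v)) (e g) <= (csize g + 2) ^ d) ->
    pt (fun g => iteri (k g) (fun i v => f (g, i, v)) (e g)).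

Lemma leq_exp_base d m n : m <= n -> m ^ d <= n ^ d.
Proof. by case: d => // d; rewrite leq_exp2r. Qed.

(** The base is at least 2, so sums and products of such bounds are absorbed by a larger
    exponent. *)
Definition polybounded n (f : ctx n -> nat) : Prop :=
  exists d, forall g, f g <= (csize g + 2) ^ d.

Section Polybounded.
Variable n : nat.
Implicit Types f g : ctx n -> nat.

Lemma polybounded_le f g : (forall c, f c <= g c) -> polybounded g -> polybounded f.
Proof. by move=> le [d h]; exists d => c; apply: leq_trans (h c). Qed.

Lemma polybounded_const c : polybounded (fun _ : ctx n => c).
Proof.
exists c => g; apply: leq_trans (ltnW (ltn_expl c (isT : 1 < 2))) _.
by rewrite leq_exp_base // leq_addl.
Qed.

Lemma polybounded_add f g :
  polybounded f -> polybounded g -> polybounded (fun c => f c + g c).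
Proof.
move=> [d hd] [e he]; exists (d + e).+1 => c; move: (hd c) (he c).
set a := csize c + 2; have a2 : 1 < a by rewrite /a addn2.
have h1 : a ^ d <= a ^ (d + e) by rewrite leq_exp2l ?leq_addr.
have h2 : a ^ e <= a ^ (d + e) by rewrite leq_exp2l ?leq_addl.
rewrite expnS => f1 g1; apply: (@leq_trans (2 * a ^ (d + e))); first by lia.
by rewrite leq_mul2r a2 orbT.
Qed.

Lemma polybounded_mul f g :
  polybounded f -> polybounded g -> polybounded (fun c => f c * g c).
Proof.
by move=> [d hd] [e he]; exists (d + e) => c; rewrite expnD leq_mul.
Qed.

Lemma polybounded_exp f d : polybounded f -> polybounded (fun c => f c ^ d).
Proof.
move=> pf; elim: d => [|d IH]; first exact: polybounded_const.
apply: polybounded_le (polybounded_mul pf IH) => c; by rewrite expnS.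
Qed.

Lemma polybounded_csize : polybounded (@csize n).
Proof. by exists 1 => c; rewrite expn1 leq_addr. Qed.

End Polybounded.

Lemma csize_weak n (g : ctx n.+1) : csize g.1 <= csize g.
Proof. by rewrite /csize /= leq_add2l leq_addl. Qed.

Lemma polybounded_weak n (f : ctx n -> nat) :
  polybounded f -> @polybounded n.+1 (fun g => f g.1).
Proof.
move=> [d h]; exists d => g; apply: leq_trans (h _) _.
by rewrite leq_exp_base // leq_add2r csize_weak.
Qed.

Lemma pt_polybounded n (f : ctx n -> nat) : pt f -> polybounded f.
Proof.
elim=> {n f}.
- by move=> n f g e _; apply: polybounded_le => c; rewrite e.
- by move=> n f _; exact: polybounded_weak.
- by move=> n; exists 1 => g; rewrite /csize /= expn1; lia.
- by move=> n; exact: polybounded_const.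
- move=> n f _ pf; apply: polybounded_le (polybounded_add pf (polybounded_const n 1)).
  by move=> c; rewrite addn1.
- by move=> n b f _ _; apply: polybounded_le (polybounded_const n 1) => c; case: nth.
- by move=> n b; exists 1 => g; rewrite /csize expn1; case: b => /=; lia.
- by move=> n k e f d _ _ _ _ _ _ h; exists d => g; exact: h.
Qed.

(* The state expected by the program evaluating a function of [g]: the
   registers [env] hold the variables, and those from [base] on are free. *)
Definition ready n (env : seq nat) (base dst : nat) (g : ctx n) (h : nat -> nat) :=
  [/\ map h env = vals g, all (fun e => [&& 1 < e, e < base & e != dst]) env,
      1 < dst < base, (forall z, base <= z -> h z = 0) & forall z, z < 2 -> h z = 0].

(** The value is added to [dst], whatever it contains; all other registers, the scratch ones and the
    input heads included, are back in place at the end. *)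
Definition evaluates n (f : ctx n -> nat) (p : seq nat -> nat -> nat -> prog)
    (T : ctx n -> nat) :=
  forall env base dst g h w, ready env base dst g h ->
    runs (inputs g).1 (inputs g).2 (p env base dst)
      (h, w) (upd h dst (h dst + f g), w) (T g).

Lemma ready_scratch n env base dst (g : ctx n) h base' dst' h' :
  ready env base dst g h -> base <= dst' < base' ->
  (forall z, z < base -> h' z = h z) -> (forall z, base' <= z -> h' z = 0) ->
  ready env base' dst' g h'.
Proof.
case=> h1 h2 h3 h4 h5 h6 h7 h8; split=> //.
- rewrite -h1; apply/eq_in_map => e eE; apply: h7.
  by have /and3P[] := allP h2 e eE.
- by apply/allP=> e /(allP h2); lia.
- by lia.
- by move=> z z2; rewrite h7 ?h5 //; lia.
Qed.

Lemma tape_content_input x y (b : bool) p :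
  tape_content x y b p = nth None (map (fun b => Some (inl b)) (input b (x, y))) p.
Proof. by case: b. Qed.

Definition is_one (c : csym) : bool := if c is Some (inl b) then b else false.
Definition nonblank (c : csym) : bool := c != None.

Lemma is_one_nth (s : seq bool) p :
  is_one (nth None (map (fun b => Some (inl b)) s) p) = nth false s p.
Proof. by elim: s p => [|b s IH] [|p] //=. Qed.

Lemma nonblank_nth (s : seq bool) p :
  nonblank (nth None (map (fun b => Some (inl b)) s) p) = (p < size s).
Proof. by elim: s p => [|b s IH] [|p] //=. Qed.

Definition PrecBody (pf : seq nat -> nat -> nat -> prog) env base :=
  Seq (pf [:: base.+2, base.+1 & env] base.+4 base.+3)
    (Seq (Clear base.+2) (Seq (Move base.+3 base.+2) (Right base.+1))).

Lemma pt_evaluates n (f : ctx n -> nat) : pt f ->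
  exists p T, polybounded T /\ evaluates f p T.
Proof.
elim=> {n f}.
- move=> n f g e _ [p [T [pT h]]]; exists p, T; split=> // env base dst c h' w ok.
  by rewrite -e; exact: h.
- move=> n f _ [p [T [pT h]]]; exists (fun env => p (behead env)), (fun g => T g.1).
  split; first exact: polybounded_weak.
  move=> [|e env] base dst g h' w [] //= [_ h1] /andP[_ h2] h3 h4 h5.
  exact: h.
- move=> n; exists (fun env base dst => Copy (head 0 env) dst base).
  exists (fun g => (g.2 * 9).+2); split.
    apply: polybounded_le (polybounded_add (polybounded_mul (polybounded_csize _)
             (polybounded_const _ 9)) (polybounded_const _ 2)) => g.
    by rewrite /csize /=; lia.
  move=> [|e env] base dst g h' w [] //= [<- h1] /andP[h2 _] h3 h4 h5.
  by apply: runs_copy => //; try lia; apply: h4.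
- move=> n; exists (fun _ _ _ => Skip), (fun=> 0); split; first exact: polybounded_const.
  move=> env base dst g h w _; have -> : upd h dst (h dst + 0) = h by upd_tac.
  exact: runs_skip.
- move=> n f _ [p [T [pT h]]]; exists (fun env base dst => Seq (p env base dst) (Right dst)).
  exists (fun g => T g + 1); split; first exact: polybounded_add (polybounded_const _ _).
  move=> env base dst g h' w ok; apply: runs_seq; first exact: h ok.
  by apply: runs_right; upd_tac.
- move=> n b f ptf [p [T [pT h]]].
  (* An input tape has no marker at its origin, so the cells passed by its head are counted in
     [base.+1], and the head is brought back by that count. *)
  exists (fun env base dst => Seq (p env base.+2 base)
    (Seq (Repeat base (Seq (Right b) (Right base.+1)))
      (Seq (If b is_one (Right dst)) (Repeat base.+1 (Left b))))).
  exists (fun g => T g + ((f g * 5).+1 + (2 + (f g * 4).+1))); split.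
    apply: polybounded_add => //.
    apply: polybounded_le (polybounded_add (polybounded_mul (pt_polybounded ptf)
             (polybounded_const n 9)) (polybounded_const n 4)) => g; lia.
  move=> env base dst g h' w ok; have [h1 h2 h3 h4 h5] := ok.
  have b2 : b < 2 by case: (b).
  apply: runs_seq; first by apply: h; apply: ready_scratch ok _ _ _ => [|//|z zb]; [lia | apply: h4; lia].
  rewrite h4 // add0n; set v := f g.
  pose s i := (upd (upd (upd h' base (v - i)) b i) base.+1 i, w).
  apply: (@runs_seq _ _ _ _ _ (s v)).
    have -> : (upd h' base v, w) = s 0.
      congr pair; have e1 := h4 base.+1 (leqnSn _); have e2 := h5 b b2.
      by rewrite subn0; upd_tac.
    apply: runs_repeat => // [|i iv|i iv]; first by lia.
      by rewrite /= /upd; do 2 (rewrite ifF; last by lia); rewrite eqxx.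
    rewrite -[2]/(1 + 1); apply: runs_seq; first exact: runs_right.
    by apply: runs_right; rewrite /s; upd_tac.
  pose s' i := (upd (upd (upd h' dst (h' dst + nth false (input b (inputs g)) v)) b (v - i)) base.+1 (v - i), w).
  apply: (@runs_seq _ _ _ _ _ (s' 0)).
    have sb : (s v).1 b = v by rewrite /= /upd ifF ?eqxx //; lia.
    have h4b := h4 base (leqnn _).
    apply: runs_if; rewrite sb tape_content_input is_one_nth -surjective_pairing => nb.
      by apply: runs_right; rewrite nb /s; upd_tac.
    by congr pair; rewrite (negbTE nb); upd_tac.
  set s2 := (upd h' _ _, w).
  have -> : s2 = s' v.
    congr pair; rewrite subnn; have e1 := h4 base.+1 (leqnSn _); have e2 := h5 b b2.
    by upd_tac.
  apply: runs_repeat => [|i iv|i iv]; [by lia | by rewrite /= /upd eqxx |].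
  by apply: runs_left; rewrite /s' /=; [rewrite /upd; do 2 (rewrite ifF; last by lia); rewrite eqxx; lia | upd_tac].
- move=> n b; exists (fun env base dst => Seq (While b nonblank (Seq (Right b) (Right base)))
    (Repeat base (Seq (Left b) (Right dst)))).
  exists (fun g => (size (input b (inputs g)) * 4).+1 + (size (input b (inputs g)) * 5).+1).
  split.
    apply: polybounded_le (polybounded_add (polybounded_mul (polybounded_csize n)
             (polybounded_const n 9)) (polybounded_const n 2)) => g.
    by rewrite /csize; case: b => /=; lia.
  move=> env base dst g h w [h1 h2 h3 h4 h5]; have b2 : b < 2 by case: (b).
  set v := size _; pose s i := (upd (upd h b i) base i, w).
  have h4b := h4 base (leqnn _); have h5b := h5 b b2.
  apply: (@runs_seq _ _ _ _ _ (s v)).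
    have -> : (h, w) = s 0 by congr pair; upd_tac.
    apply: runs_while => [i iv|]; rewrite /= {1}/upd ifF ?eqxx; try lia;
      rewrite /upd eqxx tape_content_input nonblank_nth -surjective_pairing -/v.
      split=> //; rewrite -[2]/(1 + 1); apply: runs_seq; first exact: runs_right.
      by apply: runs_right; rewrite /s; upd_tac.
    by rewrite ltnn.
  pose s' i := (upd (upd (upd h b (v - i)) base (v - i)) dst (h dst + i), w).
  have -> : s v = s' 0 by congr pair; upd_tac.
  have -> : (upd h dst (h dst + v), w) = s' v by congr pair; rewrite subnn; upd_tac.
  apply: runs_repeat => // [|i iv|i iv]; first by lia.
    by rewrite /= /upd ifF ?eqxx /=; lia.
  rewrite -[2]/(1 + 1); apply: runs_seq.
    apply: runs_left; last by [].
    by rewrite /= /upd; do 3 (rewrite ifF; last by lia); rewrite eqxx; lia.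
  by apply: runs_right; rewrite /s'; upd_tac.
- move=> n k e f d ptk [pk [Tk [pTk hk]]] pte [pe [Te [pTe he]]] ptf [pf [Tf [[df hTf] hf]]] bound.
  (* [base] counts the rounds that are left and [base.+1] those done; [base.+2] holds the current
     value and [base.+3] receives the next one. *)
  exists (fun env base dst => Seq (pk env base.+4 base) (Seq (pe env base.+4 base.+2)
    (Seq (Repeat base (PrecBody pf env base)) (Seq (Clear base.+1) (Move base.+2 dst))))).
  pose bd (g : ctx n) := (csize g + 2) ^ d.
  (* The body runs in contexts extended by the round, at most [k g], and the current value, at most
     [bd g]; this bounds its time uniformly over the rounds. *)
  pose Tb g := (csize g + k g + bd g + 2) ^ df + ((bd g * 3).+1 + ((bd g * 4).+1 + 1)).
  exists (fun g => Tk g + (Te g + ((k g * (Tb g).+3).+1 + ((k g * 3).+1 + (bd g * 4).+1)))).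
  have pbd : polybounded bd by exists d.
  have pbk := pt_polybounded ptk; have pc := polybounded_const n.
  split.
    have pb1 : polybounded (fun g => csize g + k g + bd g + 2).
      apply: polybounded_add (pc 2); apply: polybounded_add => //.
      exact: polybounded_add (polybounded_csize n) _.
    have pbT : polybounded Tb.
      apply: polybounded_add; first exact: polybounded_exp.
      apply: polybounded_le (polybounded_add (polybounded_mul pbd (pc 7)) (pc 3)) => g; lia.
    do 2 apply: polybounded_add => //.
    apply: polybounded_le (polybounded_add (polybounded_mul pbk (polybounded_add pbT (pc 6)))
      (polybounded_add (polybounded_mul pbd (pc 4)) (pc 3))) => g; nia.
  move=> env base dst g h w ok; have [h1 h2 h3 h4 h5] := ok.
  apply: runs_seq; first by apply: hk; apply: ready_scratch ok _ _ _ => [|//|z zb]; [lia | apply: h4; lia].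
  rewrite h4 // add0n; set c := k g.
  apply: runs_seq.
    apply: he; apply: ready_scratch ok _ _ _ => [|z zb|z zb]; first by lia.
      by rewrite /upd ifF //; lia.
    by rewrite /upd ifF; [apply: h4|]; lia.
  pose v i := iteri i (fun i v => f (g, i, v)) (e g).
  pose s i := (upd (upd (upd h base (c - i)) base.+1 i) base.+2 (v i), w).
  have hz1 := h4 base.+1 (leqnSn _); have hz2 : h base.+2 = 0 by apply: h4; lia.
  have hz0 := h4 base (leqnn _); have hz3 : h base.+3 = 0 by apply: h4; lia.
  set s0 := (upd (upd h base c) _ _, w).
  have -> : s0 = s 0.
    congr pair; have -> : upd h base c base.+2 = 0 by rewrite /upd ifF //; lia.
    by rewrite /v /= subn0; upd_tac.
  apply: (@runs_seq _ _ _ _ _ (s c)).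
    apply: runs_repeat => // [|i ic|i ic]; first by lia.
      by rewrite /= /upd; do 2 (rewrite ifF; last by lia); rewrite eqxx.
    have vi := bound g i (ltnW ic); have vi1 := bound g i.+1 ic.
    apply: (@runs_seq _ _ _ _ _ (upd (upd (s i).1 base (c - i.+1)) base.+3 (v i.+1), w)).
      have le : Tf (g, i, v i) <= (csize g + c + bd g + 2) ^ df.
        apply: leq_trans (hTf _) _; apply: leq_exp_base.
        by rewrite leq_add2r; move: vi; rewrite -/(bd g) -/(v i) /csize /=; lia.
      apply: runs_le le _; set h0 := upd (s i).1 _ _.
      have -> : upd h0 base.+3 (v i.+1) = upd h0 base.+3 (h0 base.+3 + f (g, i, v i)).
        have -> : h0 base.+3 = 0 by rewrite /h0 /s /= /upd; do 4 (rewrite ifF; last by lia).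
        by [].
      apply: (hf _ _ _ (g, i, v i)); split=> /=.
      + rewrite /h0 /s /= -h1; congr [:: _, _ & _]; try by rewrite /upd /= !eqxx !ifF //; lia.
        apply/eq_in_map => z /(allP h2) zE; rewrite /upd.
        by do 4 (rewrite ifF; last by lia).
      + by apply/and3P; split; [lia | lia |]; apply/allP=> z /(allP h2); lia.
      + by lia.
      + by move=> z zb; rewrite /h0 /s /= /upd; do 4 (rewrite ifF; last by lia); apply: h4; lia.
      + by move=> z zb; rewrite /h0 /s /= /upd; do 4 (rewrite ifF; last by lia); apply: h5; lia.
    set h0 := upd _ base.+3 _.
    have e2 : h0 base.+2 = v i by rewrite /h0 /= /upd; do 2 (rewrite ifF; last by lia); rewrite eqxx.
    have e3 : h0 base.+3 = v i.+1 by rewrite /h0 /upd eqxx.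
    apply: (@runs_seq _ _ _ _ _ (upd h0 base.+2 0, w)).
      apply: (@runs_le _ _ _ _ _ (h0 base.+2 * 3).+1); first by rewrite e2 ltnS leq_mul2r vi orbT.
      by apply: runs_clear => //; lia.
    apply: (@runs_seq _ _ _ _ _ (upd (upd h0 base.+3 0) base.+2 (v i.+1), w)).
      apply: (@runs_le _ _ _ _ _ ((upd h0 base.+2 0) base.+3 * 4).+1).
        by rewrite /upd ifF ?e3 ?ltnS ?leq_mul2r ?vi1 ?orbT //; lia.
      apply: runs_move => //; try lia.
      rewrite upd_same (@upd_other _ base.+2) ?e3; last by lia.
      by upd_tac.
    by apply: runs_right; rewrite /h0 /s; upd_tac.
  apply: (@runs_seq _ _ _ _ _ (upd (upd h base.+1 0) base.+2 (v c), w)).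
    apply: (@runs_le _ _ _ _ _ ((s c).1 base.+1 * 3).+1).
      by rewrite /= /upd ifF ?eqxx //; lia.
    apply: runs_clear; first by lia.
    by rewrite /s /= subnn; upd_tac.
  set h0 := upd _ base.+2 _.
  have e2 : h0 base.+2 = v c by rewrite /h0 upd_same.
  have e3 : h0 dst = h dst by rewrite /h0 /upd; do 2 (rewrite ifF; last by lia).
  apply: (@runs_le _ _ _ _ _ (h0 base.+2 * 4).+1); first by rewrite e2 ltnS leq_mul2r bound ?orbT.
  apply: runs_move => //; try lia.
  rewrite e2 e3 /h0 -/(v c); by upd_tac.
Qed.

Lemma iota_rcons_front L i : i < L -> iota (L - i.+1) i.+1 = (L - i.+1) :: iota (L - i) i.
Proof. by move=> iL /=; congr (_ :: iota _ _); lia. Qed.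

Definition is_zero (a : csym) : bool := a == marker.

Lemma is_zero_content x y j h : 1 < j -> is_zero (tape_content x y j h) = (h == 0).
Proof. by case: j => [|[|j]] // _ /=; case: h. Qed.

(* The word is written from right to left, so that the head of the output tape
   ends on its first letter. *)
Definition word_prog (pl pb : seq nat -> nat -> nat -> prog) :=
  Seq (pl [::] 3 2) (Repeat 2 (Seq (pb [:: 2] 4 3)
    (Seq (If 3 is_zero (Out false)) (Seq (If 3 nonzero (Out true)) (Clear 3))))).

Lemma horner_exp_add2 d m : ((('X + 2%:P) ^+ d : {poly nat}).[m])%R = (m + 2) ^ d.
Proof.
rewrite horner_exp hornerD hornerX hornerC.
by elim: d => // d IH; rewrite GRing.exprS IH expnS.
Qed.

Theorem pt_computable (len : ctx 0 -> nat) (b : ctx 1 -> nat) : pt len -> pt b ->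
  exists (M : tm) (p : {poly nat}), forall x y,
    computes_within M (p.[(size x + size y)%N])%R x y
      (mkseq (fun i => b (x, y, i) != 0) (len (x, y))).
Proof.
move=> ptl ptb; have [pl [Tl [pTl hl]]] := pt_evaluates ptl.
have [pb [Tb [[db hTb] hb]]] := pt_evaluates ptb.
have [vb hvb] := pt_polybounded ptb.
pose A (g : ctx 0) := csize g + len g + 2.
pose T g := Tl g + (len g * (A g ^ db + (3 + (3 + (A g ^ vb * 3).+1))).+3).+1 + 1.
have pT : polybounded T.
  have pc := polybounded_const 0.
  have pA : polybounded A.
    apply: polybounded_add (pc 2); exact: polybounded_add (polybounded_csize 0) (pt_polybounded ptl).
  apply: polybounded_add (pc 1); apply: polybounded_add => //.
  apply: polybounded_le (polybounded_add (polybounded_mul (pt_polybounded ptl)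
    (polybounded_add (polybounded_add (polybounded_exp db pA)
       (polybounded_mul (polybounded_exp vb pA) (pc 3))) (pc 10))) (pc 1)) => g; nia.
have [d hd] := pT; exists (prog_tm (word_prog pl pb)), (('X + 2%:P) ^+ d)%R => x y.
have -> : ((('X + 2%:P) ^+ d : {poly nat}).[(size x + size y)%N])%R
          = (csize ((x, y) : ctx 0) + 2) ^ d.
  by rewrite horner_exp_add2 /csize /= addn0.
apply: computes_within_le (hd (x, y)) _; rewrite /T.
set g : ctx 0 := (x, y); set L := len g; set h0 : nat -> nat := fun=> 0.
pose bt i := b (x, y, i) != 0.
pose s i := (upd h0 2 (L - i), map bt (iota (L - i) i)).
suff [t tT ex_p] : runs x y (word_prog pl pb) (h0, [::]) (s L)
    (Tl g + (L * (A g ^ db + (3 + (3 + (A g ^ vb * 3).+1))).+3).+1).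
  have := prog_tm_computes ex_p; rewrite /s /= subnn => h.
  by apply: computes_within_le h; rewrite addn1 ltnS.
apply: (@runs_seq _ _ _ _ _ (s 0)).
  have := hl [::] 3 2 g h0 [::]; rewrite /s subn0; apply.
  by split=> // z; lia.
apply: runs_repeat => // i iL.
pose v := b (x, y, L - i.+1); set h1 := upd _ _ _; rewrite [(s i).2]/=.
set w := map _ _.
have h1E z : h1 z = if z == 2 then L - i.+1 else 0.
  by rewrite /h1 /= /upd; case: eqP.
have cle : csize ((x, y, L - i.+1) : ctx 1) + 2 <= A g by rewrite /A /csize /= -/L; lia.
apply: (@runs_seq _ _ _ _ _ (upd h1 3 v, w)).
  apply: (@runs_le _ _ _ _ _ (Tb (x, y, L - i.+1))).
    by apply: leq_trans (hTb _) _; apply: leq_exp_base.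
  have := hb [:: 2] 4 3 (x, y, L - i.+1) h1 w; rewrite (h1E 3) /= add0n; apply.
  split=> //=.
    by move=> z z4; rewrite h1E ifF //; lia.
  by move=> z z2; rewrite h1E ifF //; lia.
pose w0 := if v == 0 then false :: w else w.
apply: (@runs_seq _ _ _ _ _ (upd h1 3 v, w0)).
  apply: runs_if; rewrite is_zero_content //= /w0; last by move/negbTE ->.
  by move=> ->; exact: runs_out.
apply: (@runs_seq _ _ _ _ _ (upd h1 3 v, bt (L - i.+1) :: w)).
  rewrite /bt -/v; apply: runs_if; rewrite nonzero_content //= /w0; last first.
    by rewrite upd_same => /negbNE/eqP ->.
  by rewrite upd_same => vn; rewrite (negbTE vn); exact: runs_out.
have vle : v <= A g ^ vb by apply: leq_trans (hvb _) _; apply: leq_exp_base.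
apply: (@runs_le _ _ _ _ _ ((upd h1 3 v) 3 * 3).+1).
  by rewrite upd_same ltnS leq_mul2r vle.
rewrite /s iota_rcons_front //; apply: runs_clear => //.
by rewrite /h1 /s /h0; upd_tac.
Qed.

(** * Closure properties *)

Section Closure.

Variable n : nat.
Implicit Types f g : ctx n -> nat.
Implicit Types P Q : ctx n -> bool.

Lemma pt_prec k e (f : ctx n -> nat -> nat -> nat) B :
  pt k -> pt e -> @pt n.+2 (fun c => f c.1.1 c.1.2 c.2) -> polybounded B ->
  (forall c i, i <= k c -> iteri i (f c) (e c) <= B c) ->
  pt (fun c => iteri (k c) (f c) (e c)).
Proof.
move=> pk pe pf [d hd] hB.
apply: (@PtPrec n k e (fun c => f c.1.1 c.1.2 c.2) d) => // c i ic.
exact: leq_trans (hB c i ic) (hd c).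
Qed.

Lemma pt_const a : pt (fun _ : ctx n => a).
Proof. by elim: a => [|a IH]; [exact: PtZero | exact: PtSucc]. Qed.

Lemma pt_add f g : pt f -> pt g -> pt (fun c => f c + g c).
Proof.
move=> pf pg; have e k m : iteri k (fun _ v => v.+1) m = m + k.
  by elim: k => [|k IH] /=; rewrite ?addn0 // IH addnS.
apply: (@PtExt _ (fun c => iteri (g c) (fun _ v => v.+1) (f c))) => [c|]; first exact: e.
apply: (@pt_prec g f (fun _ _ v => v.+1) (fun c => f c + g c)) => //.
- exact/PtSucc/PtVar.
- by apply: polybounded_add; exact: pt_polybounded.
- by move=> c i ic; rewrite e leq_add2l.
Qed.

(** The recursion forgets its value and returns the last index it has seen. *)
Lemma pt_pred f : pt f -> pt (fun c => (f c).-1).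
Proof.
move=> pf; have e k : iteri k (fun i _ => i) 0 = k.-1 by case: k.
apply: (@PtExt _ (fun c => iteri (f c) (fun i _ => i) 0)) => [c|]; first exact: e.
apply: (@pt_prec f _ (fun _ i _ => i) f) => //.
- exact: PtZero.
- exact/(@PtWeak n.+1 (fun c => c.2))/PtVar.
- exact: pt_polybounded.
- by move=> c i ic; rewrite e; lia.
Qed.

End Closure.

Lemma pt_sub n (f g : ctx n -> nat) : pt f -> pt g -> pt (fun c => f c - g c).
Proof.
move=> pf pg; have e k m : iteri k (fun _ v => v.-1) m = m - k.
  by elim: k => [|k IH] /=; rewrite ?subn0 // IH subnS.
apply: (@PtExt _ (fun c => iteri (g c) (fun _ v => v.-1) (f c))) => [c|]; first exact: e.
apply: (@pt_prec _ g f (fun _ _ v => v.-1) f) => //.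
- exact/pt_pred/PtVar.
- exact: pt_polybounded.
- by move=> c i ic; rewrite e leq_subr.
Qed.

Section Closure2.

Variable n : nat.
Implicit Types f g : ctx n -> nat.
Implicit Types P Q : ctx n -> bool.

Lemma pt_sum k (f : ctx n -> nat -> nat) : pt k -> @pt n.+1 (fun c => f c.1 c.2) ->
  pt (fun c => \sum_(i < k c) f c i).
Proof.
move=> pk pf; have e c m : iteri m (fun i v => v + f c i) 0 = \sum_(i < m) f c i.
  by elim: m => [|m IH] /=; rewrite ?big_ord0 // big_ord_recr /= IH.
apply: (@PtExt _ (fun c => iteri (k c) (fun i v => v + f c i) 0)) => [c|]; first exact: e.
have [d hd] := pt_polybounded pf; have pbk := pt_polybounded pk.
apply: (@pt_prec _ k _ (fun c i v => v + f c i) (fun c => k c * (csize c + k c + 2) ^ d)) => //.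
- exact: PtZero.
- by apply: pt_add; [exact: PtVar | exact: (@PtWeak n.+1 (fun c => f c.1 c.2) pf)].
- apply: polybounded_mul => //; apply/polybounded_exp/polybounded_add/polybounded_const.
  exact: polybounded_add (polybounded_csize _) _.
- move=> c i ic; rewrite e; apply: (@leq_trans (i * (csize c + k c + 2) ^ d)).
    rewrite -[X in _ <= X * _](card_ord i) -sum_nat_const; apply: leq_sum => j _.
    apply: leq_trans (hd (c, val j)) _; apply: leq_exp_base; rewrite /csize /=.
    by have := ltn_ord j; lia.
  by rewrite leq_mul2r ic orbT.
Qed.

Lemma pt_mul f g : pt f -> pt g -> pt (fun c => f c * g c).
Proof.
move=> pf pg; apply: (@PtExt _ (fun c => \sum_(i < f c) g c)) => [c|].
  by rewrite sum_nat_const card_ord.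
exact: (pt_sum (f := fun c _ => g c) pf (PtWeak pg)).
Qed.

Lemma pt_neg P : pt P -> pt (fun c => ~~ P c).
Proof.
by move=> pP; apply: PtExt (pt_sub (pt_const n 1) pP) => c; case: (P c).
Qed.

Lemma pt_and P Q : pt P -> pt Q -> pt (fun c => P c && Q c).
Proof. by move=> pP pQ; apply: PtExt (pt_mul pP pQ) => c; case: (P c); case: (Q c). Qed.

Lemma pt_or P Q : pt P -> pt Q -> pt (fun c => P c || Q c).
Proof.
move=> pP pQ; apply: PtExt (pt_neg (pt_and (pt_neg pP) (pt_neg pQ))) => c.
by case: (P c); case: (Q c).
Qed.

Lemma pt_imply P Q : pt P -> pt Q -> pt (fun c => P c ==> Q c).
Proof.
move=> pP pQ; apply: PtExt (pt_or (pt_neg pP) pQ) => c.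
by case: (P c); case: (Q c).
Qed.

Lemma pt_xor P Q : pt P -> pt Q -> pt (fun c => P c (+) Q c).
Proof.
move=> pP pQ; apply: PtExt (pt_or (pt_and pP (pt_neg pQ)) (pt_and pQ (pt_neg pP))) => c.
by case: (P c); case: (Q c).
Qed.

Lemma pt_leq f g : pt f -> pt g -> pt (fun c => f c <= g c).
Proof.
move=> pf pg; apply: PtExt (pt_sub (pt_const n 1) (pt_sub pf pg)) => c.
by rewrite leqNgt -subn_gt0; case: (f c - g c).
Qed.

Lemma pt_eqn f g : pt f -> pt g -> pt (fun c => f c == g c).
Proof.
move=> pf pg; apply: PtExt (pt_and (pt_leq pf pg) (pt_leq pg pf)) => c.
by rewrite eqn_leq.
Qed.

Lemma pt_if P f g : pt P -> pt f -> pt g -> pt (fun c => if P c then f c else g c).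
Proof.
move=> pP pf pg; apply: PtExt (pt_add (pt_mul pP pf) (pt_mul (pt_neg pP) pg)) => c.
by case: (P c) => /=; rewrite ?mul1n ?mul0n ?addn0.
Qed.

Lemma pt_ifb P Q Q' : pt P -> pt Q -> pt Q' ->
  pt (fun c => nat_of_bool (if P c then Q c else Q' c)).
Proof.
by move=> pP pf pg; apply: PtExt (pt_if pP pf pg) => c; case: (P c).
Qed.

Lemma pt_has k (P : ctx n -> nat -> bool) : pt k -> @pt n.+1 (fun c => P c.1 c.2) ->
  pt (fun c => has (P c) (iota 0 (k c))).
Proof.
move=> pk pP.
apply: PtExt (pt_leq (pt_const n 1) (pt_sum (f := fun c i => P c i) pk pP)) => c.
congr nat_of_bool; rewrite -[k c in RHS]subn0 -/(index_iota 0 (k c)).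
rewrite -(big_mkord xpredT (fun i => nat_of_bool (P c i))) has_count -sum1_count.
by rewrite [in RHS]big_mkcond /=; congr (0 < _); apply: eq_bigr => i _; case: (P c i).
Qed.

End Closure2.

Lemma pt_all n (k : ctx n -> nat) (P : ctx n -> nat -> bool) : pt k -> @pt n.+1 (fun c => P c.1 c.2) ->
  pt (fun c => all (P c) (iota 0 (k c))).
Proof.
move=> pk pP; apply: PtExt (pt_neg (pt_has (P := fun c i => ~~ P c i) pk _)) => [c|].
  by rewrite -all_predC; congr nat_of_bool; apply: eq_all => i /=; rewrite negbK.
exact: pt_neg.
Qed.

Lemma sum_ltn m q : \sum_(i < m) (i < q) = minn m q.
Proof.
elim: m => [|m IH]; first by rewrite big_ord0 min0n.
by rewrite big_ord_recr /= IH; case: ltnP; lia.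
Qed.

Lemma pt_sumn n (k : ctx n -> nat) (f : ctx n -> nat -> nat) : pt k ->
  @pt n.+1 (fun c => f c.1 c.2) -> pt (fun c => \sum_(0 <= i < k c) f c i).
Proof. by move=> pk pf; apply: PtExt (pt_sum pk pf) => c; rewrite big_mkord. Qed.

(** A hook for [pt_step], extended after each further group of closure properties. *)
Ltac pt_extra := fail.

(* Drops the last variable of a context when the function ignores it. *)
Ltac pt_weaken :=
  match goal with |- @pt (S ?n) ?F =>
    let G := constr:(fun (c : ctx n) (i : nat) => F (c, i)) in
    let G' := eval cbn beta iota delta [fst snd] in G in
    lazymatch G' with (fun c i => @?H c) =>
      let H' := eval cbn beta in H in
      apply: (@PtWeak n H')
    end
  end.

Ltac pt_step :=
  first
  [ exact: PtVar
  | assumption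
  | pt_weaken
  | lazymatch goal with
    | |- pt (fun c => nat_of_bool (@?f c && @?g c)) => apply: (@pt_and _ f g)
    | |- pt (fun c => nat_of_bool (@?f c || @?g c)) => apply: (@pt_or _ f g)
    | |- pt (fun c => nat_of_bool (@?f c ==> @?g c)) => apply: (@pt_imply _ f g)
    | |- pt (fun c => nat_of_bool (@?f c (+) @?g c)) => apply: (@pt_xor _ f g)
    | |- pt (fun c => nat_of_bool (~~ @?f c)) => apply: (@pt_neg _ f)
    | |- pt (fun c => nat_of_bool (@?f c <= @?g c)) => apply: (@pt_leq _ f g)
    | |- pt (fun c => nat_of_bool (@?f c == @?g c)) => apply: (@pt_eqn _ f g)
    | |- pt (fun c => nat_of_bool (if _ then _ else _)) => apply: pt_ifb
    | |- pt (fun c => nat_of_bool (has (@?P c) (iota 0 (@?k c)))) => apply: (@pt_has _ k P)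
    | |- pt (fun c => nat_of_bool (all (@?P c) (iota 0 (@?k c)))) => apply: (@pt_all _ k P)
    | |- pt (fun c => if _ then _ else _) => apply: pt_if
    | |- pt (fun c => addn (@?f c) (@?g c)) => apply: (@pt_add _ f g)
    | |- pt (fun c => subn (@?f c) (@?g c)) => apply: (@pt_sub _ f g)
    | |- pt (fun c => muln (@?f c) (@?g c)) => apply: (@pt_mul _ f g)
    | |- pt (fun c => (@?f c).+1) => apply: (@PtSucc _ f)
    | |- pt (fun c => (@?f c).-1) => apply: (@pt_pred _ f)
    | |- pt (fun c => bigop _ _ _) => apply: pt_sumn
    | _ => first [ exact: pt_const | pt_extra ]
    end ].

Ltac pt_tac := repeat (cbn beta; pt_step).

(** The quotient counts the positive multiples of the divisor up to the dividend; the test [0 < g c]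
    matches division by 0 being 0. *)
Lemma pt_div n (f g : ctx n -> nat) : pt f -> pt g -> pt (fun c => f c %/ g c).
Proof.
move=> pf pg.
apply: (@PtExt _ (fun c => \sum_(0 <= i < f c) ((0 < g c) && (i.+1 * g c <= f c)))) => [c|].
  case: (posnP (g c)) => [->|g0]; first by rewrite divn0 big1.
  rewrite big_mkord.
  rewrite (eq_bigr (fun i => nat_of_bool (val i < f c %/ g c))) => [|i _].
    by rewrite sum_ltn; apply/minn_idPr; exact: leq_div.
  by rewrite leq_divRL.
by pt_tac.
Qed.

Lemma pt_mod n (f g : ctx n -> nat) : pt f -> pt g -> pt (fun c => f c %% g c).
Proof.
move=> pf pg; apply: (@PtExt _ (fun c => f c - f c %/ g c * g c)) => [c|].
  by rewrite {1}(divn_eq (f c) (g c)) addKn.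
apply: pt_sub => //; apply: pt_mul => //; exact: pt_div.
Qed.

Lemma pt_minn n (f g : ctx n -> nat) : pt f -> pt g -> pt (fun c => minn (f c) (g c)).
Proof.
move=> pf pg; apply: (@PtExt _ (fun c => if f c <= g c then f c else g c)) => [c|].
  by case: leqP; lia.
by pt_tac.
Qed.

Lemma pt_odd n (f : ctx n -> nat) : pt f -> pt (fun c => odd (f c)).
Proof.
move=> pf; apply: PtExt (pt_mod pf (pt_const n 2)) => c; exact: modn2.
Qed.

Lemma pt_input_x n (f : ctx n -> nat) : pt f ->
  pt (fun c => nat_of_bool (nth false (inputs c).1 (f c))).
Proof. by move=> pf; exact: (PtBit false pf). Qed.

Lemma pt_input_y n (f : ctx n -> nat) : pt f ->
  pt (fun c => nat_of_bool (nth false (inputs c).2 (f c))).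
Proof. by move=> pf; exact: (PtBit true pf). Qed.

Lemma pt_size_x n : pt (fun c : ctx n => size (inputs c).1).
Proof. exact: (PtSize n false). Qed.

(* Finite tables are available because any function may be hard-wired on a
   bounded range. *)
Lemma pt_table n (F : nat -> nat) b (f : ctx n -> nat) : pt f ->
  pt (fun c => if f c < b then F (f c) else 0).
Proof.
move=> pf; elim: b => [|b IH]; first by apply: PtExt (pt_const n 0).
apply: (@PtExt _ (fun c => if f c == b then F b else if f c < b then F (f c) else 0)).
  by move=> c; rewrite ltnS (leq_eqVlt (f c)); case: eqP => [->|_].
by pt_tac.
Qed.

Lemma pt_table2 n (F : nat -> nat -> nat) a b (f g : ctx n -> nat) : pt f -> pt g ->
  pt (fun c => if (f c < a) && (g c < b) then F (f c) (g c) else 0).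
Proof.
move=> pf pg; elim: a => [|a IH]; first by apply: PtExt (pt_const n 0).
apply: (@PtExt _ (fun c => if f c == a then if g c < b then F a (g c) else 0 else
   if (f c < a) && (g c < b) then F (f c) (g c) else 0)).
  by move=> c; rewrite ltnS (leq_eqVlt (f c)); case: eqP => [->|_].
by apply: pt_if => //; [pt_tac | exact: pt_table].
Qed.

Lemma pt_horner n (p : {poly nat}) (f : ctx n -> nat) : pt f -> pt (fun c => (p.[f c])%R).
Proof.
move=> pf; rewrite /horner; elim: (polyseq p) => [|a s IH] /=; first exact: pt_const.
by apply: (@pt_add _ (fun c => horner_rec s (f c) * f c) (fun=> a)); pt_tac.
Qed.

(** The full power is not polynomially bounded, so it is cut off where its exact value no longer
    matters. *)
Definition pow2_trunc (i m : nat) : nat := minn (2 ^ i) m.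

Lemma pt_pow2_trunc n (f g : ctx n -> nat) : pt f -> pt g ->
  pt (fun c => pow2_trunc (f c) (g c)).
Proof.
move=> pf pg; have e i m : iteri i (fun _ v => minn (v * 2) m) (minn 1 m) = pow2_trunc i m.
  by elim: i => // i IH /=; rewrite IH /pow2_trunc expnS; lia.
apply: (@PtExt _ (fun c => iteri (f c) (fun _ v => minn (v * 2) (g c)) (minn 1 (g c)))).
  by move=> c; exact: e.
apply: (@pt_prec _ f _ (fun c _ v => minn (v * 2) (g c)) g) => //.
- by apply: pt_minn => //; exact: pt_const.
- by apply: pt_minn; pt_tac.
- exact: pt_polybounded.
- by move=> c i _; rewrite e /pow2_trunc; lia.
Qed.

Ltac pt_extra1 := lazymatch goal with
    | |- pt (fun c => divn (@?f c) (@?g c)) => apply: (@pt_div _ f g)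
    | |- pt (fun c => modn (@?f c) (@?g c)) => apply: (@pt_mod _ f g)
    | |- pt (fun c => minn (@?f c) (@?g c)) => apply: (@pt_minn _ f g)
    | |- pt (fun c => pow2_trunc (@?f c) (@?g c)) => apply: (@pt_pow2_trunc _ f g)
    | |- pt (fun c => nat_of_bool (odd (@?f c))) => apply: (@pt_odd _ f)
    | |- pt (fun c => horner ?p (@?f c)) => apply: (@pt_horner _ p f)
    | |- pt (fun c => nat_of_bool (nth false _ (@?f c))) =>
        first [apply: (@pt_input_x _ f) | apply: (@pt_input_y _ f)]
    | |- pt (fun c => size _) => exact: pt_size_x
    end.
Ltac pt_extra ::= pt_extra1.

(** * Chord diagrams *)

(* For distinct ends, the chords [ab] and [cd] cross iff exactly one of [c] and
   [d] lies between [a] and [b]. *)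
Definition crossing (a b c d : nat) : bool :=
  (a < c) (+) (b < c) (+) ((a < d) (+) (b < d)).

(** * Circular order of the ends and intersection of chords *)

Section Circle.

Local Open Scope R_scope.

(* The point of angle [2 arcsin v], for [-1 < v <= 1]. *)
Definition circle_point (v : R) : point :=
  (1 - 2 * (v * v), 2 * (sqrt (1 - v * v) * v)).

(** For [v = sin a] and [w = sin b] this is [sin (b - a)], the sine of half the angle from the point
    of [v] to that of [w]. *)
Definition half_sine (v w : R) : R := sqrt (1 - v * v) * w - sqrt (1 - w * w) * v.

(** Twice the signed area of the triangle [p q r]. *)
Definition orient (p q r : point) : R :=
  (q.1 - p.1) * (r.2 - p.2) - (q.2 - p.2) * (r.1 - p.1).

Lemma cosine_spec v : -1 < v <= 1 ->
  0 <= sqrt (1 - v * v) /\ sqrt (1 - v * v) * sqrt (1 - v * v) = 1 - v * v.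
Proof.
move=> hv; have h : 0 <= 1 - v * v by nra.
split; [exact: sqrt_pos | exact: sqrt_sqrt].
Qed.

Lemma circle_point_on v : -1 < v <= 1 -> on_circle (circle_point v).
Proof.
move=> hv; have [_ h] := cosine_spec hv; rewrite /on_circle /=.
have -> : 2 * (sqrt (1 - v * v) * v) * (2 * (sqrt (1 - v * v) * v)) =
  4 * (v * v) * (sqrt (1 - v * v) * sqrt (1 - v * v)) by ring.
by rewrite h; ring.
Qed.

Lemma circle_point_surj p : on_circle p ->
  exists2 v, -1 < v <= 1 & p = circle_point v.
Proof.
case: p => a b; rewrite /on_circle /= => h.
have a1 : -1 <= a <= 1 by nra.
have s0 := sqrt_pos ((1 - a) / 2).
have s2 : sqrt ((1 - a) / 2) * sqrt ((1 - a) / 2) = (1 - a) / 2 by apply: sqrt_sqrt; lra.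
set s := sqrt ((1 - a) / 2) in s0 s2.
have c0 := sqrt_pos (1 - s * s).
have c2 : sqrt (1 - s * s) * sqrt (1 - s * s) = 1 - s * s by apply: sqrt_sqrt; nra.
case: (Rle_or_lt 0 b) => hb.
  exists s; first by nra.
  rewrite /circle_point; congr pair; first by lra.
  set c := sqrt (1 - s * s) in c0 c2 *.
  have : b * b = (2 * (c * s)) * (2 * (c * s)) by nra.
  have : 0 <= c * s by nra.
  by move=> h1 h2; nra.
exists (- s).
  have : s * s < 1 by nra.
  by move=> h1; nra.
rewrite /circle_point; have -> : - s * - s = s * s by ring.
congr pair; first by lra.
set c := sqrt (1 - s * s) in c0 c2 *.
have : b * b = (2 * (c * s)) * (2 * (c * s)) by nra.
have : 0 <= c * s by nra.
by move=> h1 h2; nra.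
Qed.

Lemma circle_point_inj v w : -1 < v <= 1 -> -1 < w <= 1 ->
  circle_point v = circle_point w -> v = w.
Proof.
move=> hv hw [e1 e2]; have e3 : v * v = w * w by lra.
have [c0 c2] := cosine_spec hv; move: c0 c2 e2; rewrite -e3.
set c := sqrt (1 - v * v) => c0 c2 e2.
have : (v - w) * (v + w) = 0 by lra.
case/Rmult_integral=> e4; first by lra.
have : c * v = 0 by nra.
by case/Rmult_integral=> e5; nra.
Qed.

(** The squares of the two terms differ by [w * w - v * v], which settles the cases where [v] and
    [w] lie on the same side of 0; otherwise both terms contribute with the right sign. *)
Lemma half_sine_gt0 v w : -1 < v <= 1 -> -1 < w <= 1 -> v < w -> 0 < half_sine v w.
Proof.
move=> hv hw vw; have [c0 c2] := cosine_spec hv; have [d0 d2] := cosine_spec hw.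
rewrite /half_sine; move: c0 c2 d0 d2.
set c := sqrt (1 - v * v); set d := sqrt (1 - w * w) => c0 c2 d0 d2.
have e : (c * w) * (c * w) - (d * v) * (d * v) = w * w - v * v.
  have -> : (c * w) * (c * w) - (d * v) * (d * v) = (c * c) * (w * w) - (d * d) * (v * v) by ring.
  by rewrite c2 d2; ring.
case: (Rle_or_lt 0 v) => v0.
  have : 0 <= c * w by nra.
  have : w * w - v * v > 0 by nra.
  by move=> h1 h2; nra.
case: (Rle_or_lt w 0) => w0.
  have : 0 <= - (d * v) by nra.
  have : w * w - v * v < 0 by nra.
  by move=> h1 h2; nra.
have cp : 0 < c by nra.
by nra.
Qed.

Lemma half_sine_anti v w : half_sine v w = - half_sine w v.
Proof. by rewrite /half_sine; ring. Qed.

(** The area formula for a triangle inscribed in the unit circle, in terms of the sines of its half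
    central angles. *)
Lemma orient_half_sine v1 v2 v3 : -1 < v1 <= 1 -> -1 < v2 <= 1 -> -1 < v3 <= 1 ->
  orient (circle_point v1) (circle_point v2) (circle_point v3) =
  4 * (half_sine v1 v2 * (half_sine v2 v3 * half_sine v1 v3)).
Proof.
move=> h1 h2 h3; have [_ e1] := cosine_spec h1; have [_ e2] := cosine_spec h2.
have [_ e3] := cosine_spec h3; rewrite /orient /circle_point /half_sine /=.
move: e1 e2 e3; set u1 := sqrt (1 - v1 * v1); set u2 := sqrt (1 - v2 * v2).
set u3 := sqrt (1 - v3 * v3) => e1 e2 e3.
have f1 : 1 = u1 * u1 + v1 * v1 by lra.
have f2 : 1 = u2 * u2 + v2 * v2 by lra.
have f3 : 1 = u3 * u3 + v3 * v3 by lra.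
set x1 := 1 - 2 * (v1 * v1); set x2 := 1 - 2 * (v2 * v2); set x3 := 1 - 2 * (v3 * v3).
have g1 : x1 = u1 * u1 - v1 * v1 by rewrite /x1; lra.
have g2 : x2 = u2 * u2 - v2 * v2 by rewrite /x2; lra.
have g3 : x3 = u3 * u3 - v3 * v3 by rewrite /x3; lra.
(* Homogenized with the help of u^2 + v^2 = 1, this is a polynomial identity. *)
transitivity ((x1 * (2 * (u2 * v2)) - x2 * (2 * (u1 * v1))) * (u3 * u3 + v3 * v3)
  + (x2 * (2 * (u3 * v3)) - x3 * (2 * (u2 * v2))) * (u1 * u1 + v1 * v1)
  + (x3 * (2 * (u1 * v1)) - x1 * (2 * (u3 * v3))) * (u2 * u2 + v2 * v2)).
  by rewrite -f1 -f2 -f3; ring.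
by rewrite g1 g2 g3; ring.
Qed.

Lemma segments_meet_orient (a b c d : point) :
  orient a b c * orient a b d < 0 -> orient c d a * orient c d b < 0 ->
  segments_meet a b c d.
Proof.
move=> h1 h2.
(* An affine function with values [x] and [y] of opposite signs at the ends of a segment vanishes at
   the parameter [x / (x - y)]. *)
have ratio x y : x * y < 0 -> x - y <> 0 /\ 0 <= x / (x - y) <= 1.
  move=> xy; have n0 : x - y <> 0 by nra.
  split=> //; have e : x / (x - y) * (x - y) = x by field.
  by split; nra.
have [n1 r1] := ratio _ _ h1; have [n2 r2] := ratio _ _ h2.
set s := orient c d a / (orient c d a - orient c d b) in r2.
set t := orient a b c / (orient a b c - orient a b d) in r1.
exists ((1 - s) * a.1 + s * b.1, (1 - s) * a.2 + s * b.2).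
split; first by exists s.
exists t; split=> //; move: n1 n2; rewrite /s /t /orient => n1 n2.
by congr pair; field; split.
Qed.

(** The function [orient a b] is affine and vanishes on the line through [a] and [b], so it cannot
    have the same strict sign at [c] and [d]. *)
Lemma segments_meet_sides (a b c d : point) : segments_meet a b c d ->
  0 < orient a b c * orient a b d -> False.
Proof.
move=> [z [[s [_ zs]] [t [ht zt]]]] h.
have e : orient a b z = (1 - t) * orient a b c + t * orient a b d.
  by rewrite zt /orient /=; ring.
have : orient a b z = 0 by rewrite zs /orient /=; ring.
rewrite e; move: h; set p := orient a b c; set q := orient a b d => h e0.
case: (Rle_or_lt p 0) => hp; [have hq : q < 0 by nra | have hq : 0 < q by nra];
  by case: (Rle_or_lt t (1 / 2)) => t2; nra.
Qed.

Definition has_sign (s : bool) (x : R) : Prop := if s then 0 < x else x < 0.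

Lemma has_sign_mul s t x y : has_sign s x -> has_sign t y ->
  has_sign (~~ (s (+) t)) (x * y).
Proof. by case: s; case: t => /=; nra. Qed.

Lemma half_sine_sign v w (a b : nat) : -1 < v <= 1 -> -1 < w <= 1 ->
  ((a < b)%N -> v < w) -> ((b < a)%N -> w < v) -> a <> b ->
  has_sign (a < b)%N (half_sine v w).
Proof.
move=> hv hw h1 h2 ab; case: (ltnP a b) => h /=.
  exact/half_sine_gt0/h1.
rewrite half_sine_anti; have : 0 < half_sine w v by apply/half_sine_gt0/h2 => //; lia.
lra.
Qed.

(** Both orientation products are positive multiples of the same product [X] of four half sines,
    whose signs are the four comparisons in [crossing]. So one parity decides both separation
    conditions. *)
Lemma segments_meet_crossing (T : Type) (v : T -> R) (p : T -> nat) a b c d :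
  (forall e, -1 < v e <= 1) ->
  (forall e e', (p e < p e')%N -> v e < v e') ->
  p a <> p b -> p c <> p d ->
  p a <> p c -> p b <> p c -> p a <> p d -> p b <> p d ->
  segments_meet (circle_point (v a)) (circle_point (v b))
                (circle_point (v c)) (circle_point (v d)) <->
  crossing (p a) (p b) (p c) (p d).
Proof.
move=> hv mono ab cd ac bc ad bd.
have sg e e' : p e <> p e' -> has_sign (p e < p e')%N (half_sine (v e) (v e')).
  by move=> ne; apply: half_sine_sign => //; exact: mono.
set X := half_sine (v a) (v c) * half_sine (v b) (v c) *
  (half_sine (v a) (v d) * half_sine (v b) (v d)).
have sX : has_sign (~~ crossing (p a) (p b) (p c) (p d)) X.
  have := has_sign_mul (has_sign_mul (sg _ _ ac) (sg _ _ bc))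
                       (has_sign_mul (sg _ _ ad) (sg _ _ bd)).
  rewrite /crossing; case: (_ < _)%N; case: (_ < _)%N; case: (_ < _)%N; case: (_ < _)%N => //.
have nz e e' : p e <> p e' -> 0 < half_sine (v e) (v e') * half_sine (v e) (v e').
  by move=> ne; have := sg _ _ ne; case: (_ < _)%N => /= h; nra.
have o1 : orient (circle_point (v a)) (circle_point (v b)) (circle_point (v c)) *
  orient (circle_point (v a)) (circle_point (v b)) (circle_point (v d)) =
  16 * (half_sine (v a) (v b) * half_sine (v a) (v b)) * X.
  by rewrite !orient_half_sine // /X; ring.
have o2 : orient (circle_point (v c)) (circle_point (v d)) (circle_point (v a)) *
  orient (circle_point (v c)) (circle_point (v d)) (circle_point (v b)) =
  16 * (half_sine (v c) (v d) * half_sine (v c) (v d)) * X.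
  rewrite !orient_half_sine // /X (half_sine_anti (v d) (v a)) (half_sine_anti (v c) (v a)).
  by rewrite (half_sine_anti (v d) (v b)) (half_sine_anti (v c) (v b)); ring.
have p1 := nz _ _ ab; have p2 := nz _ _ cd.
move: sX; case: (crossing _ _ _ _) => /= sX; split=> // h.
  by apply: segments_meet_orient; rewrite ?o1 ?o2; nra.
by exfalso; apply: (segments_meet_sides h); rewrite o1; nra.
Qed.

Lemma inverse_lt (i j : nat) : (i < j)%N -> 1 - / (INR i + 1) < 1 - / (INR j + 1).
Proof.
move=> ij; have h : INR i < INR j by apply: lt_INR; lia.
have i0 := pos_INR i; suff : / (INR j + 1) < / (INR i + 1) by lra.
by apply: Rinv_lt_contravar; nra.
Qed.

Theorem circle_graph_of_positions n (G : sgraph n) (pos : nat -> bool -> nat) :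
  (forall u u' b b', (u < n)%N -> (u' < n)%N -> pos u b = pos u' b' -> u = u' /\ b = b') ->
  (forall u v : 'I_n, u != v ->
     G u v = crossing (pos u false) (pos u true) (pos v false) (pos v true)) ->
  circle_graph G.
Proof.
move=> inj adjE; pose p (e : 'I_n * bool) := pos e.1 e.2.
(* An increasing map of the positions into the interval from 0 to 1, within the range of the
   parametrization. *)
pose v e := (1 - / (INR (p e) + 1)).
have hv e : (-1 < v e <= 1).
  have h : (0 <= INR (p e)) by exact: pos_INR.
  have h1 : (0 < / (INR (p e) + 1)) by apply: Rinv_0_lt_compat; lra.
  have h2 : (/ (INR (p e) + 1) <= / 1) by apply: Rinv_le_contravar; lra.
  by rewrite /v Rinv_1 in h2 *; lra.
have mono e e' : (p e < p e')%N -> (v e < v e') by exact: inverse_lt.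
have pinj e e' : p e = p e' -> e = e'.
  case: e e' => [u b] [u' b'] /(inj _ _ _ _ (ltn_ord u) (ltn_ord u')) [/= e1 ->].
  by congr pair; exact: val_inj.
exists (fun e => circle_point (v e)); split.
- by move=> e; exact: circle_point_on.
- move=> e e' h; apply: pinj; case: (ltngtP (p e) (p e')) => // /mono lt; exfalso.
    by have := circle_point_inj (hv e) (hv e') h; lra.
  by have := circle_point_inj (hv e) (hv e') h; lra.
- move=> u u' uu'; rewrite adjE //.
  have ne b b' : p (u, b) <> p (u', b') by move/pinj=> [e]; case/eqP: uu'.
  have nb w : p (w, false) <> p (w, true) by move/pinj.
  by apply: iff_sym; apply: (segments_meet_crossing (p := p) hv mono).
Qed.

(** Only the order of the parameters matters, so an end is placed at its rank among all the ends;
    this also bounds the positions by [n + n]. *)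
Theorem positions_of_circle_graph n (G : sgraph n) : circle_graph G ->
  exists pos : nat -> bool -> nat,
  [/\ forall u b, (u < n)%N -> (pos u b < n + n)%N,
      forall u u' b b', (u < n)%N -> (u' < n)%N -> pos u b = pos u' b' -> u = u' /\ b = b' &
      forall u v : 'I_n, u != v ->
        G u v = crossing (pos u false) (pos u true) (pos v false) (pos v true)].
Proof.
case=> ends [on inj adjE].
have par e : exists v, -1 < v <= 1 /\ ends e = circle_point v.
  by have [v] := circle_point_surj (on e); exists v.
have [v hv] : exists v : 'I_n * bool -> R,
    forall e, -1 < v e <= 1 /\ ends e = circle_point (v e).
  exists (fun e => proj1_sig (constructive_indefinite_description _ (par e))) => e.
  exact: (proj2_sig (constructive_indefinite_description _ (par e))).
pose lt e e' : bool := if Rlt_dec (v e) (v e') then true else false.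
have ltP e e' : lt e e' <-> v e < v e'.
  by rewrite /lt; case: Rlt_dec.
pose p (e : 'I_n * bool) := #|[set e' | lt e' e]|.
have mono' e e' : v e < v e' -> (p e < p e')%N.
  move=> h; apply: proper_card; apply/properP; split.
    by apply/subsetP=> z; rewrite !inE => /ltP hz; apply/ltP; lra.
  exists e; rewrite inE; first exact/ltP.
  by apply/negP => /ltP; lra.
have vinj e e' : v e = v e' -> e = e'.
  by move=> h; apply: inj; rewrite (hv e).2 (hv e').2 h.
have mono e e' : (p e < p e')%N -> v e < v e'.
  move=> h; case: (Rtotal_order (v e) (v e')) => // [[|]].
    by move/vinj => e1; move: h; rewrite e1 ltnn.
  by move/mono'; lia.
have pinj e e' : p e = p e' -> e = e'.
  move=> h; apply: vinj; case: (Rtotal_order (v e) (v e')) => [|[//|]] /mono'; lia.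
have plt e : (p e < n + n)%N.
  have -> : (n + n = #|[set: 'I_n * bool]|)%N by rewrite cardsT card_prod card_ord card_bool; lia.
  apply: proper_card; apply/properP; split; first by apply/subsetP.
  by exists e; rewrite ?inE //; apply/negP => /ltP; lra.
exists (fun u b => if insub u is Some i then p (i, b) else 0%N); split.
- by move=> u b un; rewrite insubT.
- move=> u u' b b' un un'; rewrite !insubT => /pinj [e1 ->]; split=> //.
- move=> u w uw; rewrite !valK.
  have ne b b' : p (u, b) <> p (w, b') by move/pinj=> [e]; case/eqP: uw.
  have nb z : p (z, false) <> p (z, true) by move/pinj.
  have E := segments_meet_crossing (p := p) (fun e => (hv e).1) mono
     (@nb u) (@nb w) (@ne _ _) (@ne _ _) (@ne _ _) (@ne _ _).
  have := adjE u w uw; rewrite !(hv _).2 => A.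
  by apply/idP/idP => h; [apply/E/A | apply/A/E].
Qed.

End Circle.

(** * From hitting problems on chord diagrams to offensive alliances *)

Lemma lex_ltn W a b j k : a < W -> b < W ->
  (j * W + a < k * W + b) = (j < k) || (j == k) && (a < b).
Proof. by move=> aW bW; case: (ltngtP j k) => jk /=; nia. Qed.

Lemma sum_nat_prod m k (F : nat -> nat) :
  \sum_(0 <= i < m * k) F i = \sum_(0 <= a < m) \sum_(0 <= b < k) F (a * k + b).
Proof.
elim: m => [|m IH]; first by rewrite !big_geq.
rewrite big_nat_recr //= -IH mulSn addnC (@big_cat_nat _ _ _ (m * k)) //= ?leq_addr //.
by congr (_ + _); rewrite -{1}[m * k]add0n big_addn addKn; apply: eq_bigr => i _; rewrite addnC.
Qed.

Lemma sum_nat_if m k (P : pred nat) : k < m -> P k ->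
  \sum_(0 <= i < m) ((i == k) && P i) = 1.
Proof.
move=> km Pk; rewrite (bigD1_seq k) ?mem_index_iota ?iota_uniq //= eqxx Pk.
by rewrite big1 // => i /negbTE ->.
Qed.

Lemma sum_bool_gt0 m (P : pred nat) :
  (0 < \sum_(0 <= i < m) P i) <-> exists2 i, i < m & P i.
Proof.
split=> [|[i im Pi]].
  elim: m => [|m IH]; first by rewrite big_geq.
  rewrite big_nat_recr //=; case: (boolP (P m)) => [Pm _|_]; first by exists m.
  by rewrite addn0 => /IH [i im Pi]; exists i => //; exact: ltnW.
by rewrite (bigD1_seq i) ?mem_index_iota ?iota_uniq //= Pi.
Qed.

Lemma sum2_eq m k (F F' : nat -> nat -> nat) :
  (forall i j, i < m -> j < k -> F i j = F' i j) ->
  \sum_(0 <= i < m) \sum_(0 <= j < k) F i j = \sum_(0 <= i < m) \sum_(0 <= j < k) F' i j.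
Proof.
move=> h; apply: eq_big_nat => i /andP[_ im]; apply: eq_big_nat => j /andP[_ jk].
exact: h.
Qed.

Lemma sum2_eq0 m k (F : nat -> nat -> nat) :
  (forall i j, i < m -> j < k -> F i j = 0) ->
  \sum_(0 <= i < m) \sum_(0 <= j < k) F i j = 0.
Proof. by move=> /sum2_eq ->; rewrite big1 // => i _; rewrite big1. Qed.

Lemma sum2_true m k (P : nat -> nat -> bool) :
  (forall i j, i < m -> j < k -> P i j) ->
  \sum_(0 <= i < m) \sum_(0 <= j < k) P i j = m * k.
Proof.
move=> h; rewrite (@sum2_eq _ _ _ (fun _ _ => 1)) => [|i j im jk]; last by rewrite h.
by rewrite !sum_nat_const_nat !subn0 muln1.
Qed.

Lemma pair_index_lt m k a b : a < m -> b < k -> a * k + b < m * k.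
Proof. by move=> am bk; nia. Qed.

Lemma divmod_pair k a b : b < k -> ((a * k + b) %/ k = a) * ((a * k + b) %% k = b).
Proof.
move=> bk; rewrite modnMDl modn_small //; split=> //.
by rewrite divnMDl ?divn_small ?addn0 //; lia.
Qed.

Lemma sum_shift m k (F : nat -> nat) :
  \sum_(m <= i < m + k) F i = \sum_(0 <= i < k) F (m + i).
Proof.
by rewrite -{1}[m]add0n big_addn addKn; apply: eq_bigr => i _; rewrite addnC.
Qed.

Lemma sum_nat_const0 m (c : nat) : \sum_(0 <= i < m) c = m * c.
Proof. by rewrite sum_nat_const_nat subn0. Qed.

Lemma sum_andC m (s P : pred nat) :
  \sum_(0 <= i < m) (s i && P i) + \sum_(0 <= i < m) (~~ s i && P i) =
  \sum_(0 <= i < m) P i.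
Proof. by rewrite -big_split /=; apply: eq_bigr => i _; case: (s i); case: (P i). Qed.

Lemma crossing_sym a b c d : a <> c -> a <> d -> b <> c -> b <> d ->
  crossing a b c d = crossing c d a b.
Proof.
move=> ac ad bc bd; rewrite /crossing.
have n x y : x <> y -> (x < y) = ~~ (y < x) by lia.
rewrite (n _ _ ac) (n _ _ ad) (n _ _ bc) (n _ _ bd).
by case: (c < a); case: (c < b); case: (d < a); case: (d < b).
Qed.

Lemma card_pred n (s : pred nat) : #|[set i : 'I_n | s i]| = \sum_(0 <= u < n) s u.
Proof.
rewrite -sum1_card big_mkcond big_mkord; apply: eq_bigr => i _.
by rewrite inE; case: (s i).
Qed.

Lemma set_pred n (S : {set 'I_n}) : exists s : pred nat, S = [set i : 'I_n | s i].
Proof.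
exists (fun u => if insub u is Some i then i \in S else false).
by apply/setP=> i; rewrite inE valK.
Qed.

(** Passes from finite sets to predicates on numbers, the form in which both the reduction and the
    verifier count neighbours. *)
Lemma offensive_alliance_nat n (G : sgraph n) (g : nat -> nat -> bool) (s : pred nat) :
  (forall i j : 'I_n, G i j = g i j) ->
  offensive_alliance G [set i : 'I_n | s i] <->
  (exists2 v, v < n & s v) /\
  forall v, v < n -> ~~ s v -> (exists2 u, u < n & s u && g v u) ->
    \sum_(0 <= u < n) (~~ s u && g v u) < \sum_(0 <= u < n) (s u && g v u).
Proof.
move=> GE; have degE (t : pred nat) (v : 'I_n) :
    deg_in G [set i : 'I_n | t i] v = \sum_(0 <= u < n) (t u && g v u).
  rewrite -(card_pred _ (fun u => t u && g v u)).
  by apply: eq_card => u; rewrite !inE GE.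
have cS : ~: [set i : 'I_n | s i] = [set i : 'I_n | ~~ s i].
  by apply/setP=> i; rewrite !inE.
split=> [[/set0Pn [x]]|[[v vn sv] h]].
  rewrite inE => sx h; split; first by exists x.
  move=> v vn nsv [u un /andP[su vu]].
  have /h : Ordinal vn \in open_nbhd G [set i : 'I_n | s i].
    rewrite !inE nsv /=; apply/existsP; exists (Ordinal un).
    by rewrite !inE /= su adj_sym GE.
  by rewrite cS (degE s) (degE (predC s)) addn1.
split; first by apply/set0Pn; exists (Ordinal vn); rewrite inE.
move=> w; rewrite !inE => /andP[nw /existsP [u]]; rewrite inE => /andP[su uw].
rewrite cS (degE s) (degE (predC s)) addn1; apply: h => //; exists u => //.
by rewrite su -GE adj_sym.
Qed.

(** * The chord diagram built from a hitting problem *)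

Section Construction.

(* Light vertices [v < l] are chords with ends in the slots [al v] and [be v]
   among [L] slots.  The red ones have to be hit by [T]. *)
Variables (l L r' : nat) (al be : nat -> nat) (red : pred nat).

Definition light_adj (v u : nat) : bool :=
  (u != v) && crossing (al v) (be v) (al u) (be u).

Definition light_deg (v : nat) : nat := \sum_(0 <= u < l) light_adj v u.

Definition hitting_set (T : pred nat) : Prop :=
  [/\ forall v, v < l -> T v -> ~~ red v, \sum_(0 <= v < l) T v <= r' &
      forall v, v < l -> red v -> exists2 u, u < l & T u && light_adj v u].

(** All the [L * l] forced chords, and [r'] light ones. *)
Definition budget := L * l + r'.
Definition n_abs := 2 * budget.
(** A poison chord has [n_poi.-1] neighbours in its own clique, which makes it heavy. The 2 makes
    room for [n_cross], which can reach [2 * l + 1]. *)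
Definition n_poi := (2 * budget).+2.

(* The number of poison chords that cross [v].  A red [v] has [2 * l] forced
   neighbours, [light_deg v] light ones and this many poison ones, so that it needs
   one light neighbour in the alliance to get a majority. *)
Definition n_cross (v : nat) : nat := if red v then (2 * l).+1 - light_deg v else 0.

Definition base1 := l.
Definition base2 := base1 + L * l.
Definition base3 := base2 + L * n_abs.
Definition order := base3 + l * n_poi.

(* Slot [j] is stretched to a block, the light chords ending at the offset
   [base_off] or a bit later.  The forced chords [forced j b] join the blocks [j]
   and [j + 1], so that they cross exactly the light chords with an end in slot [j]
   and the forced ones next to them.  The absorbers give them a large degree.  The
   poison chords of [v] form a clique that is larger than the budget. *)
Definition forced j b := base1 + (j * l + b).
Definition absorber j c := base2 + (j * n_abs + c).
Definition poison v q := base3 + (v * n_poi + q).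

(** Order within block [j]: left ends of the absorbers, of the forced chords from [j], right ends of
    the absorbers, of the forced chords from [j - 1], and from here on the light end and the poison
    ends. The absorbers are nested, so they do not cross each other. *)
Definition base_off := 2 * n_abs + 2 * l.
Definition width := base_off + 3 * n_poi + 1.

Definition block (v : nat) (e : bool) : nat :=
  if v < base1 then if e then be v else al v
  else if v < base2 then (v - base1) %/ l + e
  else if v < base3 then (v - base2) %/ n_abs
  else al ((v - base3) %/ n_poi).

(** The left ends of poison chords have odd distances from [base_off] and light ends even ones. The
    left end of a light [v] lies after the first [n_cross v] poison left ends and before all poison
    right ends, so [v] crosses just these poison chords. *)
Definition offset (v : nat) (e : bool) : nat :=
  if v < base1 then if e then base_off else base_off + 2 * n_cross v
  else if v < base2 then
    if e then 2 * n_abs + l + (v - base1) %% l else n_abs + (v - base1) %% l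
  else if v < base3 then
    if e then n_abs + l + (n_abs.-1 - (v - base2) %% n_abs) else (v - base2) %% n_abs
  else if e then base_off + 2 * n_poi + 1 + (v - base3) %% n_poi
  else base_off + 1 + 2 * ((v - base3) %% n_poi).

Definition chord_end (v : nat) (e : bool) : nat := block v e * width + offset v e.

Definition chord_adj (u v : nat) : bool :=
  (u != v) && crossing (chord_end u false) (chord_end u true)
                       (chord_end v false) (chord_end v true).

Hypothesis l_gt0 : 0 < l.
Hypothesis L_gt1 : 1 < L.
Hypothesis al_be : forall v, v < l -> al v < be v.
Hypothesis be_L : forall v, v < l -> be v < L.
Hypothesis al_inj : forall u v, u < l -> v < l -> al u = al v -> u = v.
Hypothesis be_inj : forall u v, u < l -> v < l -> be u = be v -> u = v.
Hypothesis al_neq_be : forall u v, u < l -> v < l -> al u <> be v.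

Lemma light_deg_le v : light_deg v <= l.
Proof.
rewrite -[X in _ <= X]subn0 -[l - 0]muln1 -sum_nat_const_nat; apply: leq_sum => u _.
by case: light_adj.
Qed.

Lemma budget_ge : l <= budget.
Proof. by rewrite /budget; nia. Qed.

Lemma n_cross_le v : n_cross v < n_poi.
Proof. by have := budget_ge; rewrite /n_cross /n_poi; case: ifP; lia. Qed.

Inductive vertex_spec : nat -> Prop :=
| VLight v of v < l : vertex_spec v
| VForced j b of j < L & b < l : vertex_spec (forced j b)
| VAbsorber j c of j < L & c < n_abs : vertex_spec (absorber j c)
| VPoison v q of v < l & q < n_poi : vertex_spec (poison v q).

Lemma vertexP v : v < order -> vertex_spec v.
Proof.
move=> vn; case: (ltnP v base1) => [|h1]; first exact: VLight.
have A0 : 0 < n_abs by have := budget_ge; rewrite /n_abs; lia.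
case: (ltnP v base2) => h2.
  rewrite -(subnKC h1) (divn_eq (v - base1) l); apply: VForced; last by rewrite ltn_mod.
  by rewrite ltn_divLR //; move: h2; rewrite /base2; lia.
case: (ltnP v base3) => h3.
  rewrite -(subnKC h2) (divn_eq (v - base2) n_abs); apply: VAbsorber; last by rewrite ltn_mod.
  by rewrite ltn_divLR //; move: h3; rewrite /base3; lia.
rewrite -(subnKC h3) (divn_eq (v - base3) n_poi); apply: VPoison; last by rewrite ltn_mod.
by rewrite ltn_divLR //; move: vn; rewrite /order; lia.
Qed.

Lemma endL v e : v < l -> (block v e = if e then be v else al v) *
  (offset v e = if e then base_off else base_off + 2 * n_cross v).
Proof. by move=> vl; rewrite /block /offset /base1 vl. Qed.

Lemma endF j b e : j < L -> b < l -> (block (forced j b) e = j + e) *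
  (offset (forced j b) e = if e then 2 * n_abs + l + b else n_abs + b).
Proof.
move=> jL bl; rewrite /block /offset /forced.
rewrite ltnNge leq_addr /= /base2 ltn_add2l pair_index_lt // addKn.
by rewrite !divmod_pair.
Qed.

Lemma endA j c e : j < L -> c < n_abs -> (block (absorber j c) e = j) *
  (offset (absorber j c) e = if e then n_abs + l + (n_abs.-1 - c) else c).
Proof.
move=> jL ca; rewrite /block /offset /absorber.
have -> : (base2 + (j * n_abs + c) < base1) = false by rewrite /base2; lia.
rewrite [_ < base2]ltnNge leq_addr /= /base3 ltn_add2l pair_index_lt // addKn.
by rewrite !divmod_pair.
Qed.

Lemma endP v q e : v < l -> q < n_poi -> (block (poison v q) e = al v) *
  (offset (poison v q) e =
     if e then base_off + 2 * n_poi + 1 + q else base_off + 1 + 2 * q).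
Proof.
move=> vl qk; rewrite /block /offset /poison.
have -> : (base3 + (v * n_poi + q) < base1) = false by rewrite /base3 /base2; lia.
have -> : (base3 + (v * n_poi + q) < base2) = false by rewrite /base3; lia.
rewrite [_ < base3]ltnNge leq_addr /= addKn.
by rewrite !divmod_pair.
Qed.

Ltac ends_tac := repeat first
  [ rewrite endF; [|assumption|assumption] | rewrite endA; [|assumption|assumption]
  | rewrite endP; [|assumption|assumption] | rewrite endL; [|assumption] ].

Lemma offset_lt v e : v < order -> offset v e < width.
Proof.
rewrite /width; case/vertexP=> {v}.
- by move=> v vl; rewrite endL //; have := n_cross_le v; case: e; lia.
- by move=> j b jL bl; rewrite endF // /base_off; case: e; lia.
- by move=> j c jL cA; rewrite endA // /base_off; case: e; lia.
- by move=> v q vl qk; rewrite endP //; case: e; lia.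
Qed.

Lemma chord_end_lt u v e f : u < order -> v < order ->
  (chord_end u e < chord_end v f) =
  (block u e < block v f) || (block u e == block v f) && (offset u e < offset v f).
Proof. by move=> un vn; rewrite /chord_end lex_ltn // offset_lt. Qed.

Lemma chord_end_inj u v e f : u < order -> v < order ->
  chord_end u e = chord_end v f -> u = v /\ e = f.
Proof.
move=> un vn h; have := chord_end_lt e f un vn; have := chord_end_lt f e vn un.
rewrite h ltnn => h1 h2.
have {h h1 h2} [hb ho] : block u e = block v f /\ offset u e = offset v f by lia.
move: hb ho.
case/vertexP: un => {u} [u ul|j b jL bl|j c jL cA|u q ul qk];
case/vertexP: vn => {v} [v vl|j' b' jL' bl'|j' c' jL' cA'|v q' vl qk'].
all: ends_tac.
all: try have nu := n_cross_le u.
all: try have nv := n_cross_le v.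
all: rewrite /base_off; case: e; case: f; try lia.
- by move=> /be_inj ->.
- by move=> h; case: (al_neq_be vl ul); rewrite h.
- by move=> h; case: (al_neq_be ul vl).
- by move=> /al_inj ->.
- by move=> h1 h2; have [-> ->] : j = j' /\ b = b' by lia.
- by move=> h1 h2; have [-> ->] : j = j' /\ b = b' by lia.
- by move=> h1 h2; have [-> ->] : j = j' /\ c = c' by lia.
- by move=> h1 h2; have [-> ->] : j = j' /\ c = c' by lia.
- by move=> /al_inj -> // h; have -> : q = q' by lia.
- by move=> /al_inj -> // h; have -> : q = q' by lia.
Qed.

Lemma chord_adj_sym u v : u < order -> v < order -> chord_adj u v = chord_adj v u.
Proof.
move=> un vn; rewrite /chord_adj eq_sym; case: (eqVneq v u) => //= vu.
by apply: crossing_sym => /(chord_end_inj un vn) [e _]; move: vu; rewrite e eqxx.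
Qed.

Lemma forced_lt j b : j < L -> b < l -> forced j b < order.
Proof. by move=> jL bl; have := pair_index_lt jL bl; rewrite /forced /order /base3 /base2; lia. Qed.

Lemma absorber_lt j c : j < L -> c < n_abs -> absorber j c < order.
Proof. by move=> jL cA; have := pair_index_lt jL cA; rewrite /absorber /order /base3; lia. Qed.

Lemma poison_lt v q : v < l -> q < n_poi -> poison v q < order.
Proof. by move=> vl qk; have := pair_index_lt vl qk; rewrite /poison /order; lia. Qed.

Lemma light_lt v : v < l -> v < order.
Proof. by rewrite /order /base3 /base2 /base1; lia. Qed.

Ltac cross_tac :=
  rewrite /chord_adj /crossing !chord_end_lt;
  try first [exact: forced_lt | exact: absorber_lt | exact: poison_lt | exact: light_lt];
  ends_tac; rewrite /= /base_off.

Lemma adjLL v u : v < l -> u < l -> chord_adj v u = light_adj v u.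
Proof.
move=> vl ul; rewrite /light_adj /chord_adj eq_sym; case: (eqVneq u v) => //= uv.
rewrite /crossing !chord_end_lt ?light_lt // !endL //.
have ne1 : al v <> al u by move/(al_inj vl ul) => e; move: uv; rewrite e eqxx.
have ne2 : be v <> be u by move/(be_inj vl ul) => e; move: uv; rewrite e eqxx.
have ne3 := al_neq_be vl ul; have ne4 := al_neq_be ul vl.
have lex x y o1 o2 : x <> y -> (x < y) || (x == y) && (o1 < o2) = (x < y) by move=> ne; lia.
by rewrite !lex //; move=> e; case: ne4.
Qed.

Lemma adjLF v j b : v < l -> j < L -> b < l ->
  chord_adj v (forced j b) = (j == al v) || (j == be v).
Proof.
move=> vl jL bl; have nv := n_cross_le v; have ab := al_be vl.
have ne : v != forced j b by rewrite /forced /base1; lia.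
cross_tac; rewrite ne /=.
by case: (ltngtP j (al v)) => h1; case: (ltngtP j (be v)) => h2; lia.
Qed.

Lemma adjLA v j c : v < l -> j < L -> c < n_abs -> chord_adj v (absorber j c) = false.
Proof.
move=> vl jL cA; have nv := n_cross_le v; have ab := al_be vl.
cross_tac; case: (v != _) => //=; lia.
Qed.

Lemma adjLP v u q : v < l -> u < l -> q < n_poi ->
  chord_adj v (poison u q) = (u == v) && (q < n_cross v).
Proof.
move=> vl ul qk; have nv := n_cross_le v; have ab := al_be vl; have ab' := al_be ul.
have ne : v != poison u q by rewrite /poison /base3 /base2 /base1; lia.
have ne3 := al_neq_be ul vl.
cross_tac; rewrite ne /=; case: (eqVneq u v) => [->|uv] /=; first by lia.
have ne1 : al v <> al u by move/(al_inj vl ul) => e; move: uv; rewrite e eqxx.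
by lia.
Qed.

Lemma adjFF j b j' b' : j < L -> b < l -> j' < L -> b' < l -> j <= j' <= j.+1 ->
  forced j b != forced j' b' -> chord_adj (forced j b) (forced j' b').
Proof.
move=> jL bl jL' bl' jj ne; cross_tac; rewrite ne /=.
have : j' = j /\ b <> b' \/ j' = j.+1.
  by case: (eqVneq j j') ne => [<- ne|]; [left; split=> // e; rewrite e eqxx in ne | lia].
by move=> [[-> bb]|->]; lia.
Qed.

Lemma adjFA j b j' c : j < L -> b < l -> j' < L -> c < n_abs ->
  chord_adj (forced j b) (absorber j' c) = (j == j').
Proof.
move=> jL bl jL' cA.
have ne : forced j b != absorber j' c.
  by have := pair_index_lt jL bl; rewrite /absorber /forced /base2; lia.
by cross_tac; rewrite ne /=; case: (ltngtP j j') => [h|h|->]; lia.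
Qed.

Lemma adjFP j b v q : j < L -> b < l -> v < l -> q < n_poi ->
  chord_adj (forced j b) (poison v q) = false.
Proof. by move=> jL bl vl qk; cross_tac; case: (_ != _) => //=; lia. Qed.

Lemma adjAA j c j' c' : j < L -> c < n_abs -> j' < L -> c' < n_abs ->
  chord_adj (absorber j c) (absorber j' c') = false.
Proof.
move=> jL cA jL' cA'; cross_tac; case: eqVneq => //= ne.
have : j <> j' \/ c <> c'.
  by case: (eqVneq j j') ne => [<- ne|]; [right=> e; rewrite e eqxx in ne | lia].
by lia.
Qed.

Lemma adjAP j c v q : j < L -> c < n_abs -> v < l -> q < n_poi ->
  chord_adj (absorber j c) (poison v q) = false.
Proof. by move=> jL cA vl qk; cross_tac; case: (_ != _) => //=; lia. Qed.

Lemma adjPP v q q' : v < l -> q < n_poi -> q' < n_poi -> q != q' ->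
  chord_adj (poison v q) (poison v q').
Proof.
move=> vl qk qk' ne; have ne' : poison v q != poison v q' by rewrite /poison; lia.
by cross_tac; rewrite ne' /=; lia.
Qed.

(** * Counting neighbours *)

Definition chord_deg (s : pred nat) (v : nat) : nat :=
  \sum_(0 <= u < order) (s u && chord_adj v u).

Lemma sum_order (F : nat -> nat) : \sum_(0 <= u < order) F u =
  \sum_(0 <= v < l) F v
  + \sum_(0 <= j < L) \sum_(0 <= b < l) F (forced j b)
  + \sum_(0 <= j < L) \sum_(0 <= c < n_abs) F (absorber j c)
  + \sum_(0 <= v < l) \sum_(0 <= q < n_poi) F (poison v q).
Proof.
rewrite /order (@big_cat_nat _ _ _ base3) ?leq_addr //= (sum_shift base3) sum_nat_prod.
rewrite {1}/base3 (@big_cat_nat _ _ _ base2 0) ?leq_addr //= (sum_shift base2) sum_nat_prod.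
by rewrite {1}/base2 (@big_cat_nat _ _ _ base1 0) ?leq_addr //= (sum_shift base1) sum_nat_prod.
Qed.

Lemma chord_degC s v : chord_deg s v + chord_deg (predC s) v =
  \sum_(0 <= u < order) chord_adj v u.
Proof. exact: sum_andC. Qed.

Lemma chord_deg_le s v : chord_deg s v <= \sum_(0 <= u < order) s u.
Proof. by apply: leq_sum => u _; case: (s u); case: chord_adj. Qed.

Lemma sum_slots v : v < l ->
  \sum_(0 <= j < L) \sum_(0 <= b < l) ((j == al v) || (j == be v)) = 2 * l.
Proof.
move=> vl; have ab := al_be vl; have bL := be_L vl.
rewrite (eq_bigr (fun j => (j == al v) * l + (j == be v) * l)) => [|j _].
  rewrite big_split /= -!big_distrl /=.
  have one k : k < L -> \sum_(0 <= j < L) (j == k) = 1.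
    move=> kL; rewrite -(@sum_nat_if L k xpredT kL isT).
    by apply: eq_bigr => j _; rewrite andbT.
  by rewrite !one ?(ltn_trans ab) //; lia.
rewrite sum_nat_const0 -mulnDl mulnC; congr (_ * _).
by case: (eqVneq j (al v)) => [->|] //=; rewrite ltn_eqF.
Qed.

Lemma sum_poison v m : v < l -> m < n_poi ->
  \sum_(0 <= u < l) \sum_(0 <= q < n_poi) ((u == v) && (q < m)) = m.
Proof.
move=> vl mk; rewrite (eq_bigr (fun u => (u == v) && true * m)) => [|u _].
  rewrite -big_distrl /= (eq_bigr (fun u => nat_of_bool ((u == v) && xpredT u))) => [|u _].
    by rewrite sum_nat_if // mul1n.
  by rewrite andbT.
rewrite andbT; case: (u == v); last by rewrite big1.
rewrite mul1n /= -[RHS](minn_idPr (ltnW mk)).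
elim: n_poi {mk} => [|k IH]; first by rewrite big_geq // min0n.
by rewrite big_nat_recr //= IH; case: ltnP; lia.
Qed.

(** Each of the two slots of [v] contributes the [l] forced chords that start there. Only the forced
    and the poison part of [s] are prescribed, so that both directions of the equivalence can use
    it. *)
Lemma light_counts (s : pred nat) v : v < l ->
  (forall j b, j < L -> b < l -> s (forced j b)) ->
  (forall u q, u < l -> q < n_poi -> ~~ s (poison u q)) ->
  chord_deg s v = \sum_(0 <= u < l) (s u && light_adj v u) + 2 * l /\
  chord_deg (predC s) v =
    \sum_(0 <= u < l) (~~ s u && light_adj v u) + n_cross v.
Proof.
move=> vl sF sP; rewrite -(sum_slots vl) -(sum_poison vl (n_cross_le v)).
rewrite /chord_deg; split; rewrite sum_order.
  rewrite [X in _ + _ + _ + X]sum2_eq0 => [|u q ul qk]; last by rewrite (negbTE (sP _ _ ul qk)).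
  rewrite addn0 [X in _ + _ + X]sum2_eq0 => [|j c jL cA]; last by rewrite adjLA // andbF.
  rewrite addn0; congr (_ + _).
    by apply: eq_big_nat => u /andP[_ ul]; rewrite adjLL.
  by apply: sum2_eq => j b jL bl; rewrite sF // adjLF.
rewrite [X in _ + X + _ + _]sum2_eq0 => [|j b jL bl]; last by rewrite /= sF.
rewrite [X in _ + _ + X + _]sum2_eq0 => [|j c jL cA]; last by rewrite adjLA // andbF.
rewrite !addn0; congr (_ + _).
  by apply: eq_big_nat => u /andP[_ ul]; rewrite adjLL.
by apply: sum2_eq => u q ul qk; rewrite /= sP // adjLP.
Qed.

(** * From small alliances to hitting sets *)

Section Alliance.

Variable s : pred nat.
Hypothesis s_size : \sum_(0 <= u < order) s u <= budget.
Hypothesis s_alliance : forall v, v < order -> ~~ s v ->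
  (exists2 u, u < order & s u && chord_adj v u) ->
  chord_deg (predC s) v < chord_deg s v.

(** Otherwise [v] is touched from outside [s], and a strict majority of at least [2 * budget]
    neighbours would exceed the size of [s]. *)
Lemma heavy_mem v u : v < order -> u < order -> s u -> chord_adj v u ->
  2 * budget <= \sum_(0 <= w < order) chord_adj v w -> s v.
Proof.
move=> vn un su vu hv; apply/negPn/negP => nsv.
have := s_alliance vn nsv; rewrite -(chord_degC s) in hv.
have := chord_deg_le s v => le /(_ _) lt; have {}lt := lt (ex_intro2 _ _ u un _).
by rewrite su vu in lt; have := lt isT; lia.
Qed.

Lemma forced_heavy j b : j < L -> b < l ->
  2 * budget <= \sum_(0 <= w < order) chord_adj (forced j b) w.
Proof.
move=> jL bl; rewrite sum_order; set x := (X in _ + X + _); suff : x = n_abs by rewrite /n_abs; lia.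
rewrite /x (bigD1_seq j) ?mem_index_iota ?iota_uniq //= big_nat (eq_bigr (fun=> 1)) => [|c /andP[_ cA]].
  rewrite -big_nat sum_nat_const0 muln1 big_nat_cond big1 ?addn0 // => i /andP[/andP[_ iL] ij].
  by rewrite big_nat big1 // => c /andP[_ cA]; rewrite adjFA // eq_sym (negbTE ij).
by rewrite adjFA // eqxx.
Qed.

Lemma poison_heavy v q : v < l -> q < n_poi ->
  2 * budget <= \sum_(0 <= w < order) chord_adj (poison v q) w.
Proof.
move=> vl qk; rewrite sum_order; set x := (X in _ <= _ + X); suff : n_poi.-1 <= x by rewrite /n_poi; lia.
rewrite /x (bigD1_seq v) ?mem_index_iota ?iota_uniq //=; apply: leq_trans (leq_addr _ _).
rewrite (bigD1_seq q) ?mem_index_iota ?iota_uniq //=; apply: leq_trans (leq_addl _ _).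
have E : \sum_(0 <= i < n_poi | i != q) 1 = n_poi.-1.
  have := sum_nat_const0 n_poi 1.
  rewrite muln1 (bigD1_seq q) ?mem_index_iota ?iota_uniq // => h.
  by rewrite -[LHS](addKn 1) h subn1.
apply: (@leq_trans (\sum_(0 <= i < n_poi | i != q) 1)); first by rewrite E.
rewrite big_nat_cond [X in _ <= X]big_nat_cond; apply: leq_sum => q' /andP[/andP[_ qk'] ne].
by rewrite adjPP // eq_sym.
Qed.

(** One member touches the rest of its clique, which is heavy, so the whole clique would belong to
    [s]; it has more than [budget] chords. *)
Lemma poison_notin v q : v < l -> q < n_poi -> ~~ s (poison v q).
Proof.
move=> vl qk; apply/negP => sq; have all_in q' : q' < n_poi -> s (poison v q').
  move=> qk'; case: (eqVneq q' q) => [->|ne] //.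
  by apply: (heavy_mem _ _ sq) => //; rewrite ?poison_lt ?adjPP ?poison_heavy.
move: s_size; rewrite sum_order; set x := (X in _ + X); suff : n_poi <= x by rewrite /n_poi; lia.
rewrite /x (bigD1_seq v) ?mem_index_iota ?iota_uniq //=; apply: leq_trans (leq_addr _ _).
rewrite -[X in X <= _]muln1 -sum_nat_const0 big_nat [X in _ <= X]big_nat; apply: leq_sum => q' /andP[_ qk'].
by rewrite all_in.
Qed.

(** Since [light_deg v <= l], the number [n_cross v] is positive, so a red member would touch its
    poison chord 0. *)
Lemma red_notin v : v < l -> red v -> ~~ s v.
Proof.
move=> vl rv; apply/negP => sv; have q0 : 0 < n_poi by [].
case/negP: (poison_notin vl q0); apply: (heavy_mem _ _ sv); rewrite ?poison_lt ?light_lt ?poison_heavy //.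
rewrite chord_adj_sym ?poison_lt ?light_lt // adjLP // eqxx /n_cross rv.
by have := light_deg_le v; lia.
Qed.

Lemma forced_step j b j' b' : j < L -> b < l -> j' < L -> b' < l ->
  (j <= j' <= j.+1) || (j' <= j <= j'.+1) -> s (forced j b) -> s (forced j' b').
Proof.
move=> jL bl jL' bl' jj sj; case: (eqVneq (forced j' b') (forced j b)) => [->|ne] //.
apply: (heavy_mem _ _ sj); rewrite ?forced_lt ?forced_heavy //.
case/orP: jj => jj; last exact: adjFF.
by rewrite chord_adj_sym ?forced_lt ?adjFF // eq_sym.
Qed.

Lemma forced_all j b : j < L -> b < l -> s (forced j b) ->
  forall j' b', j' < L -> b' < l -> s (forced j' b').
Proof.
move=> jL bl sj.
have s0 : s (forced 0 b).
  elim: j jL sj => // j IH jL /(forced_step jL bl (ltnW jL) bl); rewrite leqnn leqnSn orbT => /(_ isT).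
  by apply: IH; exact: ltnW.
elim=> [|j' IH] b' jL' bl'; first by apply: (forced_step _ bl _ bl' _ s0); rewrite ?leqnn ?leqnSn; lia.
by apply: (forced_step (ltnW jL') bl jL' bl' _ (IH b (ltnW jL') bl)); rewrite leqnSn leqnn.
Qed.

(** Any chord except a poison one is a forced chord or crosses one. *)
Lemma forced_mem : (exists2 v, v < order & s v) ->
  forall j b, j < L -> b < l -> s (forced j b).
Proof.
case=> v0 vn; case/vertexP: vn => {v0} [v vl|j b jL bl|j c jL cA|v q vl qk] sv.
- have aL : al v < L by apply: ltn_trans (al_be vl) (be_L vl).
  apply: (forced_all aL l_gt0); apply: (heavy_mem _ _ sv); rewrite ?forced_lt ?light_lt ?forced_heavy //.
  by rewrite chord_adj_sym ?forced_lt ?light_lt // adjLF // eqxx.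
- exact: forced_all sv.
- apply: (forced_all jL l_gt0); apply: (heavy_mem _ _ sv); rewrite ?forced_lt ?absorber_lt ?forced_heavy //.
  by rewrite adjFA // eqxx.
- by case/negP: (poison_notin vl qk).
Qed.

Lemma alliance_hitting : (exists2 v, v < order & s v) -> hitting_set s.
Proof.
move=> /forced_mem sF; split=> [v vl sv| |v vl rv].
- by apply/negP => /(red_notin vl); rewrite sv.
- move: s_size; rewrite sum_order /budget.
  by rewrite (sum2_true sF); lia.
have aL : al v < L by apply: ltn_trans (al_be vl) (be_L vl).
have touched : exists2 u, u < order & s u && chord_adj v u.
  by exists (forced (al v) 0); rewrite ?forced_lt ?sF ?adjLF ?eqxx.
have := s_alliance (light_lt vl) (red_notin vl rv) touched.
have [-> ->] := light_counts vl sF poison_notin.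
(* With [h] light neighbours in [s] there are [h + 2 * l] neighbours inside and [2 * l + 1 - h]
   outside, so the majority means that [h] is positive. *)
have := sum_andC l s (light_adj v); rewrite -/(light_deg v) /n_cross rv.
have := light_deg_le v => dl e lt; apply/sum_bool_gt0; lia.
Qed.

End Alliance.

(** * From hitting sets to small alliances *)

Definition alliance_of (T : pred nat) : pred nat :=
  fun u => (u < l) && T u || (base1 <= u < base2).

(** An unchosen light chord that is not red has [2 * l] forced neighbours against at most [l]
    others; a red one wins by its chosen neighbour. All neighbours of absorbers are forced chords.
    Poison chords are not touched, as they meet only their clique and a red chord. *)
Lemma hitting_alliance T (s := alliance_of T) : hitting_set T ->
  [/\ \sum_(0 <= u < order) s u <= budget, exists2 v, v < order & s v &
     forall v, v < order -> ~~ s v -> (exists2 u, u < order & s u && chord_adj v u) ->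
       chord_deg (predC s) v < chord_deg s v].
Proof.
move=> [Tb Tr Th].
have sL v : v < l -> s v = T v by move=> vl; rewrite /s /alliance_of vl /base1 leqNgt vl orbF.
have sF j b : j < L -> b < l -> s (forced j b).
  by move=> jL bl; have := pair_index_lt jL bl; rewrite /s /alliance_of /forced /base2; lia.
have sA j c : j < L -> c < n_abs -> s (absorber j c) = false.
  by move=> jL cA; rewrite /s /alliance_of /absorber /base2 /base1; lia.
have sP v q : v < l -> q < n_poi -> s (poison v q) = false.
  by move=> vl qk; rewrite /s /alliance_of /poison /base3 /base2 /base1; lia.
have sP' v q : v < l -> q < n_poi -> ~~ s (poison v q) by move=> *; rewrite sP.
split.
- rewrite sum_order /budget.
  have -> : \sum_(0 <= v < l) s v = \sum_(0 <= v < l) T v.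
    by apply: eq_big_nat => v /andP[_ vl]; rewrite sL.
  rewrite (sum2_true sF) [X in _ + X + _]sum2_eq0 => [|j c jL cA]; last by rewrite sA.
  by rewrite sum2_eq0 => [|v q vl qk]; [lia | rewrite sP].
- have L0 : 0 < L by lia.
  by exists (forced 0 0); rewrite ?forced_lt ?sF.
move=> v0 vn; case/vertexP: vn => {v0} [v vl|j b jL bl|j c jL cA|v q vl qk].
- rewrite sL // => nT _; have [-> ->] := light_counts vl sF sP'.
  have := sum_andC l s (light_adj v); rewrite -/(light_deg v) /n_cross.
  have := light_deg_le v => dl e; case: ifP => rv; last by lia.
  have : 0 < \sum_(0 <= u < l) (s u && light_adj v u); last by lia.
  by apply/sum_bool_gt0; have [u ul h] := Th v vl rv; exists u => //; rewrite sL.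
- by rewrite sF.
- move=> _ _; apply: (@leq_ltn_trans 0).
    rewrite /chord_deg big_nat big1 // => u /andP[_ un].
    case/vertexP: un => {u} [u ul|j' b jL' bl|j' c' jL' cA'|u q ul qk] /=.
    + by rewrite chord_adj_sym ?absorber_lt ?light_lt // adjLA // andbF.
    + by rewrite sF.
    + by rewrite adjAA // andbF.
    + by rewrite adjAP // andbF.
  apply/sum_bool_gt0; exists (forced j 0); rewrite ?forced_lt ?sF //=.
  by rewrite chord_adj_sym ?absorber_lt ?forced_lt // adjFA // eqxx.
- move=> _ [u un /andP[su]]; rewrite chord_adj_sym ?poison_lt //.
  move: su; case/vertexP: un => {u} [u ul|j b jL bl|j c jL cA|u q' ul qk'].
  + rewrite sL // adjLP // => Tu /andP[/eqP vu]; rewrite /n_cross -vu.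
    by rewrite vu (negbTE (Tb u ul Tu)).
  + by rewrite adjFP.
  + by rewrite sA.
  + by rewrite sP.
Qed.

Lemma chord_adj_symmetric : symmetric (fun i j : 'I_order => chord_adj i j).
Proof. by move=> i j; exact: chord_adj_sym. Qed.

Lemma chord_adj_irreflexive : irreflexive (fun i j : 'I_order => chord_adj i j).
Proof. by move=> i; rewrite /chord_adj eqxx. Qed.

Definition chord_graph : sgraph order := SGraph chord_adj_symmetric chord_adj_irreflexive.

Lemma chord_graph_circle : circle_graph chord_graph.
Proof.
apply: (@circle_graph_of_positions _ _ chord_end) => [u u' b b' un un' /chord_end_inj|u v uv].
  by apply.
by rewrite /= /chord_adj [u != v :> nat]uv.
Qed.

Lemma offensive_alliance_chord (s : pred nat) :
  offensive_alliance chord_graph [set i : 'I_order | s i] <->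
  (exists2 v, v < order & s v) /\
  forall v, v < order -> ~~ s v -> (exists2 u, u < order & s u && chord_adj v u) ->
    chord_deg (predC s) v < chord_deg s v.
Proof. exact: offensive_alliance_nat. Qed.

Theorem offensive_alliance_hitting :
  (exists S, offensive_alliance chord_graph S /\ 1 <= #|S| <= budget) <->
  exists T, hitting_set T.
Proof.
split=> [[S [oS /andP[_ cS]]]|[T hT]].
  have [s SE] := set_pred S; move: oS cS; rewrite SE card_pred => /offensive_alliance_chord [h1 h2] h3.
  by exists s; exact: alliance_hitting.
have [h1 h2 h3] := hitting_alliance hT.
exists [set i : 'I_order | alliance_of T i]; split; first exact/offensive_alliance_chord.
rewrite card_pred h1 andbT; apply/sum_bool_gt0; exact: h2.
Qed.

End Construction.

(** * From constraint satisfaction to hitting problems *)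

Section Constraints.

(* There are [N] cells with values below [D]; the variable [i * D + a] states that
   cell [i] has value [a], and [forb] lists the triples of variables that may not
   hold together. *)
Variables (N D : nat) (forb : nat -> nat -> nat -> bool).

Definition satisfiable : Prop := exists val : nat -> nat,
  (forall i, i < N -> val i < D) /\
  forall i j k, i < N -> j < N -> k < N ->
    ~~ forb (i * D + val i) (j * D + val j) (k * D + val k).

Definition n_var := N * D.
Definition n_clause := N + n_var * n_var * n_var.
Definition n_copy := 2 * n_clause.

(* Clause [C] contains the positive ([s = false]) or negative literal of [X].  The
   first [N] clauses are positive and the others are negative or trivial. *)
Definition literal (C X : nat) (s : bool) : bool :=
  if C < N then ~~ s && (X %/ D == C)
  else
    let w := C - N in
    let X1 := w %/ (n_var * n_var) in
    let X2 := w %/ n_var %% n_var in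
    let X3 := w %% n_var in
    if forb X1 X2 X3 then s && ((X == X1) || (X == X2) || (X == X3)) else true.

(* For every variable [X] and clause [C] there are two blue chords, with [u =
   X * n_copy + 2 * C + s] for the literal [s].  The left ends of the blue chords of
   [X] form a path, whose edges are the chain reds; the right ends are grouped by
   clauses, with the literals that occur in the clause in the second group.
   The chords [3 u], [3 u + 1] and [3 u + 2] are a blue, chain red and clause red
   one. *)
Definition left_slot (u s : nat) : nat := u * 5 + s.
Definition right_slot (C g X : nat) (s : bool) : nat :=
  5 * (n_var * n_copy) + ((C * 4 + g) * (2 * n_var) + (2 * X + s)).

Definition n_light := n_var * n_copy * 3.
Definition n_slot := 5 * (n_var * n_copy) + n_clause * 4 * (2 * n_var).

Definition last_copy (u : nat) : bool := (u %% n_copy).+1 == n_copy.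
Definition clause_of (u : nat) : nat := u %% n_copy %/ 2.
Definition var_of (u : nat) : nat := u %/ n_copy.
Definition sign_of (u : nat) : bool := odd (u %% n_copy).

(** A chain red encloses the left ends, in slots 2, of the blue chords [u] and [u.+1]. The last copy
    of a variable has no successor; its chain red encloses the last pair once more, from the outer
    slots 0 and 4. *)
Definition light_al (v : nat) : nat :=
  let u := v %/ 3 in
  if v %% 3 == 0 then left_slot u 2
  else if v %% 3 == 1 then if last_copy u then left_slot u.-1 0 else left_slot u 1
  else right_slot (clause_of u) 0 (var_of u) (sign_of u).

(** A clause red runs from group 0 to group 2 of its clause and thus crosses the blue chords ending
    in group 1, but not those in group 3. One clause red per literal keeps the indexing uniform. *)
Definition light_be (v : nat) : nat :=
  let u := v %/ 3 in
  if v %% 3 == 0 then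
    right_slot (clause_of u) (if literal (clause_of u) (var_of u) (sign_of u) then 1 else 3)
      (var_of u) (sign_of u)
  else if v %% 3 == 1 then if last_copy u then left_slot u 4 else left_slot u.+1 3
  else right_slot (clause_of u) 2 (var_of u) (sign_of u).

Definition light_red (v : nat) : bool := v %% 3 != 0.

(** One literal for each variable and clause, that is, half of the blue chords. *)
Definition n_hit := n_var * n_clause.

(** * Ends and adjacencies of the literal chords *)

Hypothesis N_gt0 : 0 < N.
Hypothesis D_gt0 : 0 < D.

Lemma n_var_gt0 : 0 < n_var.
Proof. by rewrite /n_var muln_gt0 N_gt0. Qed.

Lemma n_clause_gt : N < n_clause.
Proof.
have : 0 < n_var * n_var * n_var by rewrite !muln_gt0 N_gt0 D_gt0.
by rewrite /n_clause; lia.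
Qed.

Lemma n_copy_gt0 : 0 < n_copy.
Proof. by have := n_clause_gt; rewrite /n_copy; lia. Qed.

Lemma copyE u : u = var_of u * n_copy + (2 * clause_of u + sign_of u).
Proof.
rewrite /var_of /clause_of /sign_of {1}(divn_eq u n_copy); congr (_ + _).
by rewrite {1}(divn_eq (u %% n_copy) 2) modn2 mulnC.
Qed.

Lemma copy_index X C (s : bool) : C < n_clause ->
  let u := X * n_copy + (2 * C + s) in
  [/\ var_of u = X, clause_of u = C & sign_of u = s].
Proof.
move=> Cm u; have h : 2 * C + s < n_copy by rewrite /n_copy; case: s {u} => /=; lia.
rewrite /var_of /clause_of /sign_of !(divmod_pair X h); split=> //.
  by case: (s) => /=; lia.
by rewrite oddD mul2n odd_double; case: (s).
Qed.

Lemma copy_lt u : u < n_var * n_copy -> var_of u < n_var /\ clause_of u < n_clause.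
Proof.
move=> un; split; first by rewrite /var_of ltn_divLR // n_copy_gt0.
have := ltn_pmod u n_copy_gt0; rewrite /clause_of /n_copy; lia.
Qed.

Lemma lightE u k : k < 3 -> ((3 * u + k) %/ 3 = u) * ((3 * u + k) %% 3 = k).
Proof. by move=> k3; rewrite mulnC; exact: divmod_pair. Qed.

Lemma light_split v : v < n_light ->
  exists u k, [/\ v = 3 * u + k, u < n_var * n_copy & k < 3].
Proof.
move=> vl; exists (v %/ 3), (v %% 3); split; last by rewrite ltn_mod.
  by rewrite mulnC -divn_eq.
by rewrite ltn_divLR.
Qed.

Lemma last_copy_gt0 u : last_copy u -> 0 < u.
Proof.
rewrite /last_copy; have := n_copy_gt0; have := n_clause_gt; rewrite {1}/n_copy.
by case: u => //; rewrite mod0n /n_copy; lia.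
Qed.

Lemma next_copy u : u < n_var * n_copy -> ~~ last_copy u -> u.+1 < n_var * n_copy.
Proof.
move=> un; rewrite /last_copy => nl; have := ltn_pmod u n_copy_gt0.
have [h _] := copy_lt un; move: un nl h; rewrite /var_of {1 4}(divn_eq u n_copy) => un nl h lt.
have : (u %/ n_copy).+1 * n_copy <= n_var * n_copy by rewrite leq_mul2r h orbT.
by rewrite mulSn; lia.
Qed.

Lemma right_slot_lt C g X s C' g' X' s' : X < n_var -> X' < n_var ->
  (right_slot C g X s < right_slot C' g' X' s') =
  (C * 4 + g < C' * 4 + g') || (C * 4 + g == C' * 4 + g') && (2 * X + s < 2 * X' + s').
Proof.
move=> Xn Xn'; rewrite /right_slot ltn_add2l lex_ltn //; first by case: s => /=; lia.
by case: s' => /=; lia.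
Qed.

Lemma left_right u s C g X e : u < n_var * n_copy -> s < 5 ->
  left_slot u s < right_slot C g X e.
Proof. by move=> un s5; rewrite /left_slot /right_slot; lia. Qed.

Lemma left_right_neq u s C g X e : u < n_var * n_copy -> s < 5 ->
  left_slot u s <> right_slot C g X e.
Proof. by move=> un s5 h; have := left_right C g X e un s5; rewrite h ltnn. Qed.

Lemma right_slot_bound C g X e : C < n_clause -> g < 4 -> X < n_var ->
  right_slot C g X e < n_slot.
Proof.
move=> Cm g4 Xn; rewrite /right_slot /n_slot ltn_add2l; apply: pair_index_lt; first by lia.
by case: e => /=; lia.
Qed.

Lemma left_slot_inj u s u' s' : s < 5 -> s' < 5 -> left_slot u s = left_slot u' s' ->
  u = u' /\ s = s'.
Proof. by rewrite /left_slot; lia. Qed.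

Lemma right_slot_inj C g X s C' g' X' s' : X < n_var -> X' < n_var -> g < 4 -> g' < 4 ->
  right_slot C g X s = right_slot C' g' X' s' -> [/\ C = C', g = g', X = X' & s = s'].
Proof.
move=> Xn Xn' g4 g4' e; have := right_slot_lt C g s C' g' s' Xn Xn'.
have := right_slot_lt C' g' s' C g s Xn' Xn; rewrite e ltnn => h1 h2.
by case: s s' {e} h1 h2 => [] [] /=; split; lia.
Qed.

Lemma alE u k : k < 3 -> light_al (3 * u + k) =
  if k == 0 then left_slot u 2
  else if k == 1 then if last_copy u then left_slot u.-1 0 else left_slot u 1
  else right_slot (clause_of u) 0 (var_of u) (sign_of u).
Proof. by move=> k3; rewrite /light_al !lightE. Qed.

Lemma beE u k : k < 3 -> light_be (3 * u + k) =
  if k == 0 then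
    right_slot (clause_of u) (if literal (clause_of u) (var_of u) (sign_of u) then 1 else 3)
      (var_of u) (sign_of u)
  else if k == 1 then if last_copy u then left_slot u 4 else left_slot u.+1 3
  else right_slot (clause_of u) 2 (var_of u) (sign_of u).
Proof. by move=> k3; rewrite /light_be !lightE. Qed.

Lemma light_al_be v : v < n_light -> light_al v < light_be v.
Proof.
case/light_split=> u [k [-> un k3]]; rewrite alE // beE //; have [Xn Cm] := copy_lt un.
case: k k3 => [|[|[|//]]] _ /=.
- exact: left_right.
- by case: ifP => [/last_copy_gt0|_]; rewrite /left_slot; lia.
- by rewrite right_slot_lt //; lia.
Qed.

Lemma light_be_bound v : v < n_light -> light_be v < n_slot.
Proof.
case/light_split=> u [k [-> un k3]]; rewrite beE //; have [Xn Cm] := copy_lt un.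
case: k k3 => [|[|[|//]]] _ /=.
- by apply: right_slot_bound => //; case: ifP.
- have le : n_var * n_copy * 5 <= n_slot by rewrite /n_slot; lia.
  case: ifP => [_|/negbT /(next_copy un)]; rewrite /left_slot; lia.
- exact: right_slot_bound.
Qed.

Lemma copy_inj u u' : clause_of u = clause_of u' -> var_of u = var_of u' ->
  sign_of u = sign_of u' -> u = u'.
Proof. by move=> e1 e2 e3; rewrite (copyE u) (copyE u') e1 e2 e3. Qed.

Lemma light_al_inj v v' : v < n_light -> v' < n_light -> light_al v = light_al v' -> v = v'.
Proof.
case/light_split=> u [k [-> un k3]]; case/light_split=> u' [k' [-> un' k3']].
have [Xn Cm] := copy_lt un; have [Xn' Cm'] := copy_lt un'.
have pu := leq_ltn_trans (leq_pred u) un; have pu' := leq_ltn_trans (leq_pred u') un'.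
rewrite !alE //; case: k k3 => [|[|[|//]]] _; case: k' k3' => [|[|[|//]]] _ /=.
- by case/left_slot_inj=> // ->.
- by case: ifP => _ /left_slot_inj [].
- by move/left_right_neq; case.
- by case: ifP => _ /left_slot_inj [].
- by case: ifP => [/last_copy_gt0 h1|_]; case: ifP => [/last_copy_gt0 h2|_] /left_slot_inj [] //; lia.
- by case: ifP => _ /left_right_neq [].
- by move/esym/left_right_neq; case.
- by case: ifP => _ /esym/left_right_neq [].
- by case/right_slot_inj=> // e1 _ e2 e3; rewrite (copy_inj e1 e2 e3).
Qed.

Lemma light_be_inj v v' : v < n_light -> v' < n_light -> light_be v = light_be v' -> v = v'.
Proof.
case/light_split=> u [k [-> un k3]]; case/light_split=> u' [k' [-> un' k3']].
have [Xn Cm] := copy_lt un; have [Xn' Cm'] := copy_lt un'.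
have nu := next_copy un; have nu' := next_copy un'.
rewrite !beE //; case: k k3 => [|[|[|//]]] _; case: k' k3' => [|[|[|//]]] _ /=.
- by case/right_slot_inj=> //; do ?case: ifP => // _; move=> // e1 _ e2 e3; rewrite (copy_inj e1 e2 e3).
- by case: (boolP (last_copy u')) => [_|/nu' h] /esym/left_right_neq [].
- by case/right_slot_inj=> //; case: ifP.
- by case: (boolP (last_copy u)) => [_|/nu h] /left_right_neq [].
- by case: ifP => [_|/negbT/nu h1]; case: ifP => [_|/negbT/nu' h2] /left_slot_inj [] //; lia.
- by case: (boolP (last_copy u)) => [_|/nu h] /left_right_neq [].
- by case/right_slot_inj=> //; case: ifP.
- by case: (boolP (last_copy u')) => [_|/nu' h] /esym/left_right_neq [].
- by case/right_slot_inj=> // e1 _ e2 e3; rewrite (copy_inj e1 e2 e3).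
Qed.

Lemma light_al_neq_be v v' : v < n_light -> v' < n_light -> light_al v <> light_be v'.
Proof.
case/light_split=> u [k [-> un k3]]; case/light_split=> u' [k' [-> un' k3']].
have [Xn Cm] := copy_lt un; have [Xn' Cm'] := copy_lt un'.
have pu := leq_ltn_trans (leq_pred u) un.
have nu' := next_copy un'.
rewrite alE ?beE //; case: k k3 => [|[|[|//]]] _; case: k' k3' => [|[|[|//]]] _ /=.
- by move/left_right_neq; case.
- by case: ifP => _ /left_slot_inj [].
- by move/left_right_neq; case.
- by case: ifP => _ /left_right_neq [].
- by case: ifP => _; case: ifP => _ /left_slot_inj [].
- by case: ifP => _ /left_right_neq [].
- by case/right_slot_inj=> //; case: ifP.
- by case: (boolP (last_copy u')) => [_|/nu' h] /esym/left_right_neq [].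
- by case/right_slot_inj.
Qed.

Lemma n_light_gt0 : 0 < n_light.
Proof. by have := n_copy_gt0; have := n_var_gt0; rewrite /n_light; nia. Qed.

Lemma n_slot_gt1 : 1 < n_slot.
Proof.
have h : 0 < n_var * n_copy by have := n_copy_gt0; have := n_var_gt0; nia.
by rewrite /n_slot; lia.
Qed.

Lemma chain_adj u u' : u < n_var * n_copy -> u' < n_var * n_copy ->
  light_adj light_al light_be (3 * u + 1) (3 * u' + 0) =
  if last_copy u then (u' == u.-1) || (u' == u) else (u' == u) || (u' == u.+1).
Proof.
move=> un un'; rewrite /light_adj /crossing !alE // !beE //=.
have -> : 3 * u' + 0 != 3 * u + 1 by lia.
set e := right_slot _ _ _ _.
have lt w s : w < n_var * n_copy -> s < 5 -> left_slot w s < e by move=> h1 h2; apply: left_right.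
have pu := leq_ltn_trans (leq_pred u) un.
case: ifP => [/last_copy_gt0 u0|/negbT /(next_copy un) nu].
  by rewrite (lt u.-1) // (lt u 4) // addbF /left_slot; lia.
by rewrite (lt u 1) // (lt u.+1) // addbF /left_slot; lia.
Qed.

Lemma clause_adj u u' : u < n_var * n_copy -> u' < n_var * n_copy ->
  light_adj light_al light_be (3 * u + 2) (3 * u' + 0) =
  (clause_of u' == clause_of u) && literal (clause_of u') (var_of u') (sign_of u').
Proof.
move=> un un'; rewrite /light_adj /crossing !alE // !beE //=.
have [Xn Cm] := copy_lt un; have [Xn' Cm'] := copy_lt un'.
have -> : 3 * u' + 0 != 3 * u + 2 by lia.
have nlt g : (right_slot (clause_of u) g (var_of u) (sign_of u) < left_slot u' 2) = false.
  by have := left_right (clause_of u) g (var_of u) (sign_of u) un' (isT : 2 < 5); lia.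
by rewrite !nlt /= !right_slot_lt //; case: literal; lia.
Qed.

Lemma sum_pairs m (F : nat -> nat) :
  \sum_(0 <= u < 2 * m) F u = \sum_(0 <= w < m) (F (2 * w) + F (2 * w).+1).
Proof.
rewrite mulnC sum_nat_prod; apply: eq_big_nat => w _.
by rewrite big_nat_recr //= big_nat1 addn0 addn1 mulnC.
Qed.

(** This makes the budget tight: every pair of literals needs a chosen chord, so none can afford
    two. *)
Lemma leq_sum_eq m (F : nat -> nat) : (forall i, i < m -> 0 < F i) ->
  \sum_(0 <= i < m) F i <= m -> forall i, i < m -> F i = 1.
Proof.
move=> F0; elim: m F0 => // m IH F0; rewrite big_nat_recr //= => le i.
have F0' j : j < m -> 0 < F j by move=> jm; apply: F0; exact: ltnW.
have ge : m <= \sum_(0 <= i < m) F i.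
  rewrite -[X in X <= _]subn0 -[m - 0]muln1 -sum_nat_const_nat.
  by rewrite big_nat [X in _ <= X]big_nat; apply: leq_sum => j /andP[_ /F0'].
have Fm := F0 m (leqnn _); rewrite ltnS leq_eqVlt => /orP[/eqP ->|im]; first by lia.
by apply: IH => //; lia.
Qed.

Lemma hit_sum (T : pred nat) : (forall v, v < n_light -> T v -> ~~ light_red v) ->
  \sum_(0 <= v < n_light) T v =
  \sum_(0 <= w < n_hit) (T (3 * (2 * w) + 0) + T (3 * (2 * w).+1 + 0)).
Proof.
move=> Tb; rewrite /n_light sum_nat_prod /n_copy mulnCA -/n_hit sum_pairs.
have three u : u < 2 * n_hit ->
    \sum_(0 <= k < 3) T (u * 3 + k) = T (3 * u + 0).
  move=> un; have h k : k < 3 -> 0 < k -> T (u * 3 + k) = false.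
    move=> k3 k0; have lt : u * 3 + k < n_light.
      by move: un; rewrite /n_light /n_copy /n_hit; lia.
    by apply/negP => /(Tb _ lt); rewrite /light_red mulnC lightE // -lt0n k0.
  by rewrite !big_nat_recr //= big_geq // (h 1) // (h 2) // mulnC !addn0.
by apply: eq_big_nat => w /andP[_ wh]; rewrite !three //; lia.
Qed.

Theorem hitting_satisfiable :
  (exists T, hitting_set n_light n_hit light_al light_be light_red T) <-> satisfiable.
Proof.
have nC := n_clause_gt; have n0 := n_var_gt0; have c0 := n_copy_gt0.
have idx X C (s : bool) : X < n_var -> C < n_clause ->
    X * n_copy + (2 * C + s) < n_var * n_copy.
  by move=> Xn Cm; apply: pair_index_lt => //; rewrite /n_copy; case: s => /=; lia.
split=> [[T [Tb Tr Th]]|[val [vD vF]]].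
  pose bl X C (s : bool) := T (3 * (X * n_copy + (2 * C + s)) + 0).
  have hit u k : u < n_var * n_copy -> k < 3 -> k != 0 -> exists2 u', u' < n_var * n_copy &
      T (3 * u' + 0) && light_adj light_al light_be (3 * u + k) (3 * u' + 0).
    move=> un k3 k0; have [||w wl /andP[Tw aw]] := Th (3 * u + k).
    - by rewrite /n_light; lia.
    - by rewrite /light_red lightE.
    have := Tb w wl Tw; case/light_split: wl Tw aw => u' [k' [-> un' k3']] Tw aw.
    rewrite /light_red lightE // negbK => /eqP k'0; rewrite k'0 in Tw aw.
    by exists u' => //; rewrite Tw.
  have chain u : u < n_var * n_copy -> ~~ last_copy u -> T (3 * u + 0) || T (3 * u.+1 + 0).
    move=> un nl; have [u' un' /andP[Tu]] := hit u 1 un isT isT.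
    by rewrite chain_adj // (negbTE nl) => /orP[] /eqP e; rewrite -e Tu ?orbT.
  have lastE X C (s : bool) : C < n_clause ->
      last_copy (X * n_copy + (2 * C + s)) = s && (C.+1 == n_clause).
    move=> Cm; have h : 2 * C + s < n_copy by rewrite /n_copy; case: s => /=; lia.
    by rewrite /last_copy (divmod_pair _ h) /n_copy; case: s {h} => /=; lia.
  (* The copies [2 * w] and [(2 * w).+1] are the two literals of one variable and clause. The chain
     red around them asks for one, and the budget excludes both. *)
  have pair w : w < n_hit -> T (3 * (2 * w) + 0) + T (3 * (2 * w).+1 + 0) = 1.
    apply: (@leq_sum_eq n_hit (fun w => T (3 * (2 * w) + 0) + T (3 * (2 * w).+1 + 0)))
      => [i ih|]; last by rewrite -hit_sum.
    have : T (3 * (2 * i) + 0) || T (3 * (2 * i).+1 + 0).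
      apply: chain; first by rewrite /n_copy; move: ih; rewrite /n_hit; lia.
      have Cm : i %% n_clause < n_clause by rewrite ltn_mod; lia.
      have -> : 2 * i = i %/ n_clause * n_copy + (2 * (i %% n_clause) + false).
        by rewrite {1}(divn_eq i n_clause) /n_copy /=; lia.
      by rewrite lastE.
    by case: (T _) => //; case: (T _).
  have excl X C : X < n_var -> C < n_clause -> bl X C true = ~~ bl X C false.
    move=> Xn Cm; have wh : X * n_clause + C < n_hit by exact: pair_index_lt.
    have := pair _ wh; rewrite /bl.
    have -> : X * n_copy + (2 * C + false) = 2 * (X * n_clause + C) by rewrite /n_copy /=; lia.
    have -> : X * n_copy + (2 * C + true) = (2 * (X * n_clause + C)).+1 by rewrite /n_copy /=; lia.
    by case: (T _); case: (T _).
  (* If [X] is true at a clause, its negative literal is not chosen there, so the chain red towards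
     the next clause forces the positive literal of that clause. *)
  have mono X C C' : X < n_var -> C <= C' -> C' < n_clause -> bl X C false -> bl X C' false.
    move=> Xn CC C'm bC; elim: C' CC C'm => [|C' IH]; first by rewrite leqn0 => /eqP <-.
    rewrite leq_eqVlt => /orP[/eqP <- //|]; rewrite ltnS => CC C'm.
    have bC' := IH CC (ltnW C'm).
    have := chain _ (idx X C' true Xn (ltnW C'm)); rewrite lastE ?(ltnW C'm) //= => /(_ _).
    rewrite [C'.+1 == _]ltn_eqF // => /(_ isT); rewrite -/(bl X C' true) excl ?(ltnW C'm) // bC' /=.
    by rewrite /bl; congr (T (3 * _ + 0)); rewrite /=; lia.
  have clause C : C < n_clause -> exists X (s : bool), [/\ X < n_var, literal C X s & bl X C s].
    move=> Cm; have [u' un' /andP[Tu]] := hit _ 2 (idx 0 C false n0 Cm) isT isT.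
    rewrite clause_adj ?idx //; have [_ -> _] := copy_index 0 false Cm.
    move=> /andP[/eqP <- lit]; have [Xn _] := copy_lt un'.
    by exists (var_of u'), (sign_of u'); rewrite /bl -copyE; split.
  (* The values are read at the first clause after the positive ones: a positive literal chosen
     earlier persists up to [N], and a negative one chosen later excludes that its variable is true
     at [N]. *)
  pose z X := bl X N false.
  have ex i : i < N -> exists2 a, a < D & z (i * D + a).
    move=> iN; have Cm : i < n_clause by lia.
    have [X [s [Xn]]] := clause i Cm; rewrite /literal iN => /andP[ns /eqP Xi] b.
    exists (X %% D); first by rewrite ltn_mod.
    rewrite -Xi -divn_eq; apply: (mono X i) => //; first exact: ltnW.
    by case: s ns b.
  (* Several values of a cell may be true; any of them satisfies the negative clauses, and the least
     is taken. *)
  pose val i := find (fun a => z (i * D + a)) (iota 0 D).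
  have hval i : i < N -> val i < D /\ z (i * D + val i).
    move=> iN; have [a aD za] := ex i iN.
    have h : has (fun a => z (i * D + a)) (iota 0 D) by apply/hasP; exists a; rewrite ?mem_iota.
    have := nth_find 0 h; rewrite -/(val i); move: h; rewrite has_find size_iota -/(val i) => h.
    by rewrite nth_iota.
  exists val; split=> [i /hval []//|i j k iN jN kN]; apply/negP.
  have [vi zi] := hval i iN; have [vj zj] := hval j jN; have [vk zk] := hval k kN.
  move: (pair_index_lt iN vi) (pair_index_lt jN vj) (pair_index_lt kN vk) zi zj zk.
  rewrite -/n_var; set X1 := i * D + _; set X2 := j * D + _; set X3 := k * D + _.
  move=> X1n X2n X3n z1 z2 z3 f.
  set w := X1 * (n_var * n_var) + (X2 * n_var + X3).
  have Cm : N + w < n_clause.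
    by rewrite /n_clause ltn_add2l -mulnA; do 2 apply: pair_index_lt => //.
  have [X [s [Xn]]] := clause _ Cm.
  rewrite /literal ltnNge leq_addr /= addKn.
  have X23 : X2 * n_var + X3 < n_var * n_var by exact: pair_index_lt.
  have e1 : w %/ (n_var * n_var) = X1 by rewrite /w divmod_pair.
  have e2 : w %/ n_var %% n_var = X2.
    have -> : w = (X1 * n_var + X2) * n_var + X3 by rewrite /w; lia.
    by rewrite !divmod_pair.
  have e3 : w %% n_var = X3.
    have -> : w = (X1 * n_var + X2) * n_var + X3 by rewrite /w; lia.
    by rewrite divmod_pair.
  rewrite e1 e2 e3 f => /andP[-> Xs]; rewrite excl // => nb.
  have zX : z X by move: Xs => /orP[/orP[]|] /eqP ->.
  by rewrite (mono X N) ?leq_addr in nb.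
pose z X := X %% D == val (X %/ D).
have val_of X : X < n_var -> z X -> X = (X %/ D) * D + val (X %/ D) /\ X %/ D < N.
  move=> Xn /eqP zX; rewrite -zX -divn_eq; split=> //.
  by rewrite ltn_divLR.
(* The true literal of each variable is chosen, for every clause alike. *)
pose b u := z (var_of u) (+) sign_of u.
pose T v := (v %% 3 == 0) && b (v %/ 3).
have TE u : T (3 * u + 0) = b u by rewrite /T !lightE.
have bE X C (s : bool) : C < n_clause -> b (X * n_copy + (2 * C + s)) = z X (+) s.
  by move=> Cm; rewrite /b; have [-> _ ->] := copy_index X s Cm.
have Tred v : v < n_light -> T v -> ~~ light_red v.
  by move=> _ /andP[h _]; rewrite /light_red h.
have bpair w : w < n_hit -> b (2 * w).+1 = ~~ b (2 * w).
  move=> wh; have Cm : w %% n_clause < n_clause by rewrite ltn_mod; lia.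
  have -> : 2 * w = w %/ n_clause * n_copy + (2 * (w %% n_clause) + false).
    by rewrite {1}(divn_eq w n_clause) /n_copy /=; lia.
  rewrite -addnS; have -> : (2 * (w %% n_clause) + false).+1 = 2 * (w %% n_clause) + true by rewrite /=; lia.
  by rewrite !bE // addbT addbF.
exists T; split=> //.
  rewrite hit_sum // -[X in _ <= X]subn0 -[n_hit - 0]muln1 -sum_nat_const_nat.
  rewrite big_nat [X in _ <= X]big_nat; apply: leq_sum => w /andP[_ wh].
  by rewrite !TE bpair //; case: (b _).
move=> v vl; case/light_split: (vl) => u [k [-> un k3]].
have ul u' : u' < n_var * n_copy -> 3 * u' + 0 < n_light by rewrite /n_light; lia.
have [Xn Cm] := copy_lt un; have uE := copyE u.
case: k k3 => [|[|[|//]]] _; rewrite /light_red lightE //= => _.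
  (* The two blue chords met by a chain red are opposite literals of one variable, in the same or in
     consecutive clauses, so one of them is chosen. *)
  have [u' un' /andP[bu' ad]] : exists2 u', u' < n_var * n_copy &
      b u' && if last_copy u then (u' == u.-1) || (u' == u) else (u' == u) || (u' == u.+1).
    case: (boolP (last_copy u)) => [lu|nl].
      have lu0 := last_copy_gt0 lu.
      have s1 : sign_of u.
        have : odd (u %% n_copy).+1 = false by rewrite (eqP lu) /n_copy mul2n odd_double.
        by move/negbFE.
      have bu := bE (var_of u) (clause_of u) true Cm; have bp := bE (var_of u) (clause_of u) false Cm.
      rewrite s1 in uE; rewrite -uE in bu.
      have ep : var_of u * n_copy + (2 * clause_of u + false) = u.-1 by rewrite [in RHS]uE /=; lia.
      rewrite ep in bp; case zX: (z (var_of u)); [exists u.-1 | exists u] => //.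
      + exact: leq_ltn_trans (leq_pred u) un.
      + by rewrite bp zX eqxx.
      + by rewrite bu zX eqxx orbT.
    have nu := next_copy un nl.
    have [bu|nbu] := boolP (b u); first by exists u; rewrite ?bu ?eqxx.
    exists u.+1; rewrite ?eqxx ?orbT ?andbT //.
    move: nbu; rewrite uE bE //; case s1: (sign_of u).
      have Cm' : (clause_of u).+1 < n_clause.
        move: nl; rewrite /last_copy /clause_of /n_copy; have := ltn_pmod u c0.
        move: s1; rewrite /sign_of /n_copy; lia.
      have -> : (var_of u * n_copy + (2 * clause_of u + true)).+1 =
        var_of u * n_copy + (2 * (clause_of u).+1 + false) by rewrite /=; lia.
      by rewrite bE // addbF addbT negbK.
    have -> : (var_of u * n_copy + (2 * clause_of u + false)).+1 =
        var_of u * n_copy + (2 * clause_of u + true) by rewrite /=; lia.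
    by rewrite bE // addbF addbT.
  by exists (3 * u' + 0); rewrite ?ul // TE bu' chain_adj.
have [X [s [X'n lit bX]]] : exists X (s : bool),
    [/\ X < n_var, literal (clause_of u) X s & z X (+) s].
  case: (ltnP (clause_of u) N) => CN.
    have vC := vD _ CN; exists (clause_of u * D + val (clause_of u)), false.
    by split; [exact: (pair_index_lt CN vC) | rewrite /literal CN divmod_pair ?eqxx | rewrite /z !divmod_pair // eqxx].
  rewrite /literal ltnNge CN /=.
  set w := clause_of u - N.
  have wn : w < n_var * n_var * n_var by move: Cm; rewrite /w /n_clause; lia.
  set X1 := w %/ _; set X2 := w %/ _ %% _; set X3 := w %% _.
  have nn0 : 0 < n_var * n_var by nia.
  have h1 : X1 < n_var by rewrite /X1 ltn_divLR // mulnA.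
  have h2 : X2 < n_var by rewrite ltn_mod.
  have h3 : X3 < n_var by rewrite ltn_mod.
  case: (boolP (forb X1 X2 X3)) => f; last by exists 0, (~~ z 0); split=> //; case: (z 0).
  have [z1|nz] := boolP (z X1); last by exists X1, true; rewrite eqxx (negbTE nz).
  have [z2|nz] := boolP (z X2); last by exists X2, true; rewrite eqxx orbT (negbTE nz).
  have [z3|nz] := boolP (z X3); last by exists X3, true; rewrite eqxx orbT (negbTE nz).
  have [e1 i1] := val_of _ h1 z1; have [e2 i2] := val_of _ h2 z2.
  by have [e3 i3] := val_of _ h3 z3; have := vF _ _ _ i1 i2 i3; rewrite -e1 -e2 -e3 f.
exists (3 * (X * n_copy + (2 * clause_of u + s)) + 0); first by apply/ul/idx.
rewrite TE bE // bX clause_adj ?idx //.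
by have [-> -> ->] := copy_index X s Cm; rewrite eqxx.
Qed.

End Constraints.

(** * From Turing machines to constraint satisfaction *)

Definition table1 b (F : nat -> nat) i : nat := if i < b then F i else 0.
Definition table2 a b (F : nat -> nat -> nat) i j : nat :=
  if (i < a) && (j < b) then F i j else 0.

Definition fin_code (T : finType) (x : T) : nat := enum_rank x.
Definition fin_decode (T : finType) (d : T) (a : nat) : T := nth d (enum T) a.

Lemma fin_codeK (T : finType) (d x : T) : fin_decode d (fin_code x) = x.
Proof. exact: nth_enum_rank. Qed.

Lemma fin_code_lt (T : finType) (x : T) : fin_code x < #|T|.
Proof. exact: ltn_ord. Qed.

Lemma fin_decodeK (T : finType) (d : T) a : a < #|T| -> fin_code (fin_decode d a) = a.
Proof.
move=> aT; rewrite /fin_code /fin_decode.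
by rewrite -[a]/(nat_of_ord (Ordinal aT)) -(enum_val_nth (A := T)) enum_valK.
Qed.

Lemma fin_code_inj (T : finType) (x y : T) : fin_code x = fin_code y -> x = y.
Proof. by move=> e; rewrite -(fin_codeK x x) e fin_codeK. Qed.

Section Tableau.

Variable M : tm.

Notation k := (tm_work M).+3.
Notation cellM := (option (bool + tm_sym M)).
Notation record := (tm_state M * {ffun 'I_k -> cellM})%type.
Notation blank := (None : cellM).

Definition cell_code (c : cellM) : nat := fin_code c.
Definition cell_decode (a : nat) : cellM := fin_decode blank a.
Definition record_decode (a : nat) : record :=
  fin_decode (tm_start M, [ffun=> blank]) a.

(** A halted machine rewrites what it scans and stays, so rows after the halt obey the same
    constraints. *)
Definition transition (r : record) : tm_state M * {ffun 'I_k -> cellM * move} :=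
  if tm_halt r.1 then (r.1, [ffun i => (r.2 i, MoveN)]) else tm_delta r.1 r.2.

(** Relative to the head, the cell at offset [o] after move [m] was at offset [o + move_code m - 1]
    before. *)
Definition move_code (m : move) : nat :=
  match m with MoveL => 0 | MoveN => 1 | MoveR => 2 end.

Definition n_record := #|{: record}|.
Definition n_cell := #|{: cellM}|.
Definition n_value := n_record + n_cell.

Definition state_table := table1 n_record (fun a => fin_code (record_decode a).1).
Definition next_table := table1 n_record (fun a => fin_code (transition (record_decode a)).1).
Definition halt_table := table1 n_record (fun a => tm_halt (record_decode a).1).
Definition scan_table := table2 n_record k
  (fun a tau => cell_code ((record_decode a).2 (inord tau))).
Definition write_table := table2 n_record k
  (fun a tau => cell_code ((transition (record_decode a)).2 (inord tau)).1).
Definition move_table := table2 n_record k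
  (fun a tau => move_code ((transition (record_decode a)).2 (inord tau)).2).

Definition is_bit (a : nat) : bool :=
  (a == cell_code (Some (inl false))) || (a == cell_code (Some (inl true))).

Section FixInput.

Variables (x : seq bool) (T q : nat).

(* A row of the tableau describes a configuration.  The contents of a tape are
   given relative to its head, which is at the offset [center]; the garbage that
   enters at the borders of the window moves too slowly to do any harm.  The last
   entry [tau = k] of a row stands for the state and the scanned symbols. *)
Definition center := T.+2.
Definition window := center + center + q + size x + 2.

Definition n_row_cell := T.+1 * k.+1 * window.
Definition cell_index (t tau o : nat) := (t * k.+1 + tau) * window + o.

Definition init_code (tau o : nat) : nat :=
  if [&& tau == 0, center <= o & o - center < size x]
  then if nth false x (o - center) then cell_code (Some (inl true))
       else cell_code (Some (inl false))
  else cell_code blank.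

Definition is_record (tau o : nat) : bool := (tau == k) && (o == 0).

Definition bad_value (tau o a : nat) : bool :=
  is_record tau o && (n_record <= a) || (tau < k) && (n_cell <= a).

Definition bad_init (t tau o a : nat) : bool :=
  (t == 0) &&
  (is_record tau o && (state_table a != fin_code (tm_start M))
  || (tau < k) && (if tau == 1 then
       if (center <= o) && (o < center + q) then ~~ ((a == cell_code blank) || is_bit a)
       else a != cell_code blank
     else a != init_code tau o)).

(** [bad_init] leaves bits and blanks open in the certificate area of tape 1; without gaps they form
    a word of length at most [q]. *)
Definition bad_gap (t1 tau1 o1 a1 t2 tau2 o2 a2 : nat) : bool :=
  [&& t1 == 0, tau1 == 1, center <= o1, a1 == cell_code blank &
      [&& t2 == 0, tau2 == 1, o2 == o1.+1 & a2 != cell_code blank]].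

Definition bad_scan (t1 tau1 o1 a1 t2 tau2 o2 a2 : nat) : bool :=
  [&& is_record tau1 o1, t2 == t1, tau2 < k, o2 == center & a2 != scan_table a1 tau2].

(** The only constraint on three cells: a record, a cell of its row, and the cell of the next row
    that arises from it. A border cell whose source is outside the window remains free. *)
Definition bad_write (t1 tau1 o1 a1 t2 tau2 o2 a2 t3 tau3 o3 a3 : nat) : bool :=
  [&& is_record tau1 o1, t2 == t1, t3 == t1.+1, tau2 < k &
      [&& tau3 == tau2, o2.+1 == o3 + move_table a1 tau2 &
          a3 != (if o2 == center then write_table a1 tau2 else a2)]].

Definition bad_next (t1 tau1 o1 a1 t2 tau2 o2 a2 : nat) : bool :=
  [&& is_record tau1 o1, is_record tau2 o2, t2 == t1.+1 & state_table a2 != next_table a1].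

(** Tape [k.-1] is the output tape. Its word is [[:: true]] when a true bit is scanned and the next
    cell is no bit. *)
Definition bad_final (t tau o a : nat) : bool :=
  (t == T) && (is_record tau o && (halt_table a == 0)
    || (tau == k.-1) && ((o == center) && (a != cell_code (Some (inl true)))
                         || (o == center.+1) && is_bit a)).

Definition bad (t1 tau1 o1 a1 t2 tau2 o2 a2 t3 tau3 o3 a3 : nat) : bool :=
  bad_value tau1 o1 a1 || bad_init t1 tau1 o1 a1
  || bad_gap t1 tau1 o1 a1 t2 tau2 o2 a2 || bad_scan t1 tau1 o1 a1 t2 tau2 o2 a2
  || bad_write t1 tau1 o1 a1 t2 tau2 o2 a2 t3 tau3 o3 a3
  || bad_next t1 tau1 o1 a1 t2 tau2 o2 a2 || bad_final t1 tau1 o1 a1.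

Definition time_of X := X %/ n_value %/ window %/ k.+1.
Definition tape_of X := X %/ n_value %/ window %% k.+1.
Definition offset_of X := X %/ n_value %% window.
Definition value_of X := X %% n_value.

Definition forbidden X1 X2 X3 : bool :=
  bad (time_of X1) (tape_of X1) (offset_of X1) (value_of X1)
      (time_of X2) (tape_of X2) (offset_of X2) (value_of X2)
      (time_of X3) (tape_of X3) (offset_of X3) (value_of X3).

(** * Tapes seen from their heads *)

Definition symbol_at (t : tape M) (o : nat) : cellM :=
  if o < center then nth blank (tleft t) (center - o.+1) else nth blank (tright t) (o - center).

Lemma symbol_at_scan t : symbol_at t center = scan t.
Proof. by rewrite /symbol_at ltnn subnn nth0. Qed.

Lemma symbol_at_move m (c : cellM) t o o' : o'.+1 = o + move_code m ->
  symbol_at (tape_move m (tape_write c t)) o = if o' == center then c else symbol_at t o'.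
Proof.
have nz n (s : seq cellM) : nth blank (c :: s) n.+1 = nth blank s n by [].
rewrite /symbol_at; case: m => /= e.
- case: (ltngtP o' center) => h.
  + case: (ltngtP o center) => h'; try lia.
      by rewrite nth_behead; congr nth; lia.
    have -> : o - center = 0 by lia.
    have -> : center - o'.+1 = 0 by lia.
    by rewrite /= nth0.
  + have -> : o < center = false by lia.
    have -> : o - center = (o' - center.+1).+2 by lia.
    have -> : o' - center = (o' - center.+1).+1 by lia.
    by rewrite /= nth_behead.
  + have -> : o < center = false by lia.
    by have -> : o - center = 1 by lia.
- have -> : o' = o by lia.
  case: (ltngtP o center) => h //.
    have -> : o - center = (o - center.+1).+1 by lia.
    by rewrite /= nth_behead.
  by rewrite h subnn.
- case: (ltngtP o' center) => h.
  + have -> : o < center by lia.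
    by have -> : center - o.+1 = (center - o'.+1).+1 by lia.
  + have -> : o < center = false by lia.
    by rewrite nth_behead; congr nth; lia.
  + have -> : o < center by lia.
    by have -> : center - o.+1 = 0 by lia.
Qed.

Definition run (y : seq bool) (t : nat) : config M := iter t (@step M) (init M x y).

Definition record_of (c : config M) : record := (cstate c, [ffun i => scan (ctapes c i)]).

Lemma cstate_step c : cstate (step c) = (transition (record_of c)).1.
Proof. by rewrite /step /transition /=; case: ifP => // _; case: (tm_delta _ _). Qed.

Lemma symbol_at_step c i o o' :
  o'.+1 = o + move_code ((transition (record_of c)).2 i).2 ->
  symbol_at (ctapes (step c) i) o =
  if o' == center then ((transition (record_of c)).2 i).1 else symbol_at (ctapes c i) o'.
Proof.
rewrite /step /transition /=; case: ifP => _.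
  rewrite !ffunE /= => e; have -> : o = o' by lia.
  by case: eqP => [->|//]; rewrite symbol_at_scan.
by case: (tm_delta _ _) => p act /= e; rewrite ffunE; exact: symbol_at_move.
Qed.

Lemma symbol_at_init y i o : symbol_at (ctapes (init M x y) i) o =
  if center <= o then
    nth blank (map (@bit M) (match val i with 0 => x | 1 => y | _ => [::] end)) (o - center)
  else blank.
Proof.
rewrite /symbol_at /= ffunE /=; case: ltnP => // _; exact: nth_nil.
Qed.

Lemma nth_map_bit (s : seq bool) j : nth blank (map (@bit M) s) j =
  if j < size s then Some (inl (nth false s j)) else blank.
Proof.
case: ltnP => js; first by rewrite (nth_map false).
by rewrite nth_default // size_map.
Qed.

Definition accepting (c : config M) : Prop := tm_halt (cstate c) /\ output c = [:: true].

Lemma output_true (c : config M) : output c = [:: true] <->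
  symbol_at (ctapes c ord_max) center = Some (inl true) /\
  ~~ is_bit (cell_code (symbol_at (ctapes c ord_max) center.+1)).
Proof.
rewrite /output /symbol_at ltnn ltnNge leqnSn /= subnn subSnn.
have bitE (a : cellM) : is_bit (cell_code a) = if a is Some (inl _) then true else false.
  apply/orP/idP => [[/eqP/fin_code_inj ->|/eqP/fin_code_inj ->] //|].
  by case: a => [[[]|]|] //= _; [right | left].
rewrite bitE; case: (tright _) => [|[[[]|c0]|] [|[[b|c1]|] s]] //=; split=> // -[] //.
Qed.

Lemma cell_index_lt t tau o : t <= T -> tau <= k -> o < window ->
  cell_index t tau o < n_row_cell.
Proof. by move=> tT tk ow; do 2 apply: pair_index_lt => //. Qed.

Lemma index_of t tau o a : tau <= k -> o < window -> a < n_value ->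
  let X := cell_index t tau o * n_value + a in
  [/\ time_of X = t, tape_of X = tau, offset_of X = o & value_of X = a].
Proof.
move=> tk ow aD X; rewrite /time_of /tape_of /offset_of /value_of /X /cell_index.
by rewrite !(divmod_pair _ aD) !(divmod_pair _ ow) !(divmod_pair (k := k.+1) _ tk).
Qed.

Lemma index_split i : i < n_row_cell ->
  exists t tau o, [/\ i = cell_index t tau o, t <= T, tau <= k & o < window].
Proof.
move=> iN; exists (i %/ window %/ k.+1), (i %/ window %% k.+1), (i %% window).
have w0 : 0 < window by rewrite /window; lia.
rewrite /cell_index -!divn_eq; split=> //; last by rewrite ltn_mod.
  by rewrite -ltnS !ltn_divLR.
by rewrite -ltnS ltn_mod.
Qed.

Lemma tables_code (r : record) : let a := fin_code r in
  [/\ state_table a = fin_code r.1, next_table a = fin_code (transition r).1 &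
      halt_table a = tm_halt r.1].
Proof.
rewrite /state_table /next_table /halt_table /table1 /n_record fin_code_lt.
by rewrite /record_decode fin_codeK.
Qed.

Lemma tape_tables_code (r : record) (i : 'I_k) : let a := fin_code r in
  [/\ scan_table a i = cell_code (r.2 i), write_table a i = cell_code ((transition r).2 i).1 &
      move_table a i = move_code ((transition r).2 i).2].
Proof.
rewrite /scan_table /write_table /move_table /table2 /n_record fin_code_lt ltn_ord.
by rewrite /record_decode fin_codeK inord_val.
Qed.

Lemma tables_decode a : a < n_record -> let r := record_decode a in
  [/\ state_table a = fin_code r.1, next_table a = fin_code (transition r).1 &
      halt_table a = tm_halt r.1].
Proof. by move=> an; rewrite /state_table /next_table /halt_table /table1 an. Qed.

Lemma tape_tables_decode a (i : 'I_k) : a < n_record -> let r := record_decode a in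
  [/\ scan_table a i = cell_code (r.2 i), write_table a i = cell_code ((transition r).2 i).1 &
      move_table a i = move_code ((transition r).2 i).2].
Proof.
move=> an; rewrite /scan_table /write_table /move_table /table2 an ltn_ord.
by rewrite inord_val.
Qed.

Lemma cell_code_eq (a b : cellM) : (cell_code a == cell_code b) = (a == b).
Proof. by apply/eqP/eqP => [/fin_code_inj|->]. Qed.

Lemma is_bitE (a : cellM) : is_bit (cell_code a) = if a is Some (inl _) then true else false.
Proof. by rewrite /is_bit !cell_code_eq; case: a => [[[]|]|]. Qed.

(** * Accepting runs and satisfying assignments *)

Lemma record_lt (r : record) : fin_code r < n_value.
Proof. by apply: leq_trans (fin_code_lt r) _; rewrite leq_addr. Qed.

Lemma cell_lt (c : cellM) : cell_code c < n_value.
Proof. by apply: leq_trans (fin_code_lt c) _; rewrite leq_addl. Qed.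

(** The cells are read off the actual tapes, which continue beyond the window, so the borders need
    no special treatment. *)
Lemma run_satisfiable y : size y <= q -> accepting (run y T) ->
  satisfiable n_row_cell n_value forbidden.
Proof.
move=> yq acc; pose V t tau o := if tau == k then fin_code (record_of (run y t))
  else cell_code (symbol_at (ctapes (run y t) (inord tau)) o).
pose val i := V (i %/ window %/ k.+1) (i %/ window %% k.+1) (i %% window).
have Vlt t tau o : V t tau o < n_value.
  by rewrite /V; case: ifP => _; [exact: record_lt | exact: cell_lt].
have valE t tau o : tau <= k -> o < window -> val (cell_index t tau o) = V t tau o.
  by move=> tk ow; rewrite /val /cell_index !(divmod_pair _ ow) !(divmod_pair (k := k.+1) _ tk).
have Vrec t o : V t k o = fin_code (record_of (run y t)) by rewrite /V eqxx.
have Vtape t (i : 'I_k) o : V t i o = cell_code (symbol_at (ctapes (run y t) i) o).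
  by rewrite /V ltn_eqF // inord_val.
exists val; split=> [i iN|i1 i2 i3]; first exact: Vlt.
case/index_split=> t1 [tau1 [o1 [-> _ k1 w1]]].
case/index_split=> t2 [tau2 [o2 [-> _ k2 w2]]].
case/index_split=> t3 [tau3 [o3 [-> _ k3 w3]]].
rewrite !valE // /forbidden.
have [-> -> -> ->] := index_of t1 k1 w1 (Vlt t1 tau1 o1).
have [-> -> -> ->] := index_of t2 k2 w2 (Vlt t2 tau2 o2).
have [-> -> -> ->] := index_of t3 k3 w3 (Vlt t3 tau3 o3).
apply/negP => /orP[/orP[/orP[/orP[/orP[/orP[]|]|]|]|]|].
- move=> /orP[/andP[/andP[/eqP -> _]]|/andP[tk]].
    by rewrite Vrec leqNgt fin_code_lt.
  by have := Vtape t1 (Ordinal tk) o1; rewrite /= => ->; rewrite leqNgt fin_code_lt.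
- move=> /andP[/eqP -> /orP[/andP[/andP[/eqP -> _]]|/andP[tk]]].
    by rewrite Vrec; have [-> _ _] := tables_code (record_of (run y 0)); rewrite eqxx.
  have := Vtape 0 (Ordinal tk) o1; rewrite /= => ->; rewrite symbol_at_init /=.
  case: tau1 {k1} tk => [|[|tau]] tk /=.
  + move/eqP; apply; rewrite nth_map_bit /init_code /=.
    by case: (leqP center o1) => //= _; case: ltnP => // _; case: nth.
  + rewrite nth_map_bit; case: (leqP center o1) => [co|_] /=; last by rewrite eqxx.
    case: (ltnP o1 (center + q)) => h1; last by rewrite ltnNge (_ : size y <= o1 - center) ?eqxx //; lia.
    by rewrite is_bitE cell_code_eq; case: ltnP.
  + by move/eqP; apply; rewrite nth_nil /init_code /=; case: ifP.
- move=> /and5P[/eqP -> /eqP -> co /eqP e1 /and4P[/eqP -> /eqP -> /eqP e2]].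
  have h1 : 1 < k by []; move: e1; rewrite (Vtape 0 (Ordinal h1)) (Vtape 0 (Ordinal h1)) !symbol_at_init /=.
  rewrite e2 co (leqW co) !nth_map_bit => /fin_code_inj; case: ltnP => // h _.
  by rewrite ltnNge (_ : size y <= _) ?eqxx //; lia.
- move=> /and5P[/andP[/eqP -> _] /eqP -> tk /eqP ->].
  rewrite Vrec (Vtape t1 (Ordinal tk)) symbol_at_scan.
  have [-> _ _] := tape_tables_code (record_of (run y t1)) (Ordinal tk).
  by rewrite /= ffunE eqxx.
- move=> /and5P[/andP[/eqP -> _] /eqP -> /eqP -> tk /and3P[/eqP -> /eqP]].
  rewrite Vrec !(Vtape _ (Ordinal tk)) /=.
  have [_ -> ->] := tape_tables_code (record_of (run y t1)) (Ordinal tk) => e.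
  by rewrite (symbol_at_step e) (fun_if (@cell_code)) eqxx.
- move=> /and4P[/andP[/eqP -> _] /andP[/eqP -> _] /eqP ->]; rewrite !Vrec.
  have [-> _ _] := tables_code (record_of (run y t1.+1)).
  have [_ -> _] := tables_code (record_of (run y t1)).
  by rewrite /= cstate_step eqxx.
- case: acc => hT /output_true [o1T o2T].
  move=> /andP[/eqP -> /orP[/andP[/andP[/eqP -> _]]|/andP[/eqP ->]]].
    by rewrite Vrec; have [_ _ ->] := tables_code (record_of (run y T)); rewrite /= hT.
  rewrite (Vtape T ord_max) => /orP[/andP[/eqP ->]|/andP[/eqP ->]].
    by rewrite o1T eqxx.
  by rewrite (negbTE o2T).
Qed.

(** Used to turn the guessed cells of tape 1 into a certificate: without gaps, only blanks follow
    the leading bits. *)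
Lemma leading_bits_prefix (s : seq cellM) :
  (forall j, j < size s -> nth blank s j == blank \/ is_bit (cell_code (nth blank s j))) ->
  (forall j, nth blank s j = blank -> nth blank s j.+1 = blank) ->
  forall j, nth blank (map (@bit M) (leading_bits (M := M) s)) j = nth blank s j.
Proof.
elim: s => [|a s IH] h1 h2 j; first by rewrite !nth_nil.
have {}IH := IH (fun j => h1 j.+1) (fun j => h2 j.+1).
have a0 := h1 0 isT; move: a0 h2; rewrite is_bitE /=.
case: a h1 => [[b|c]|] h1 [] //= a0 h2; first by case: j => [|j] //=.
elim: j => [|j IHj]; first by [].
by rewrite /= (h2 j) // -IHj nth_nil.
Qed.

Lemma size_leading_bits (s : seq cellM) : size (leading_bits (M := M) s) <= size s.
Proof. by elim: s => [|[[b|]|] s IH] //=. Qed.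

Lemma satisfiable_run : satisfiable n_row_cell n_value forbidden ->
  exists y, size y <= q /\ accepting (run y T).
Proof.
case=> v [vD vF]; pose V t tau o := v (cell_index t tau o).
have w0 : 0 < window by rewrite /window; lia.
have wc o : o <= center.+1 -> o < window by rewrite /window; lia.
have ok t1 tau1 o1 t2 tau2 o2 t3 tau3 o3 :
    t1 <= T -> tau1 <= k -> o1 < window -> t2 <= T -> tau2 <= k -> o2 < window ->
    t3 <= T -> tau3 <= k -> o3 < window ->
    ~~ bad t1 tau1 o1 (V t1 tau1 o1) t2 tau2 o2 (V t2 tau2 o2) t3 tau3 o3 (V t3 tau3 o3).
  move=> T1 k1 w1 T2 k2 w2 T3 k3 w3.
  have l1 := cell_index_lt T1 k1 w1; have l2 := cell_index_lt T2 k2 w2.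
  have l3 := cell_index_lt T3 k3 w3; have := vF _ _ _ l1 l2 l3; rewrite /forbidden.
  have [-> -> -> ->] := index_of t1 k1 w1 (vD _ l1).
  have [-> -> -> ->] := index_of t2 k2 w2 (vD _ l2).
  by have [-> -> -> ->] := index_of t3 k3 w3 (vD _ l3).
have ok1 t tau o : t <= T -> tau <= k -> o < window ->
    [&& ~~ bad_value tau o (V t tau o), ~~ bad_init t tau o (V t tau o) &
        ~~ bad_final t tau o (V t tau o)].
  move=> h1 h2 h3; have nb := ok _ _ _ _ _ _ _ _ _ h1 h2 h3 h1 h2 h3 h1 h2 h3.
  by apply/and3P; split; apply: contra nb; rewrite /bad => ->; rewrite ?orbT.
have rec_lt t : t <= T -> V t k 0 < n_record.
  move=> tT; have /and3P[h _ _] := ok1 t k 0 tT (leqnn _) w0; apply: contraR h.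
  by rewrite -leqNgt /bad_value /is_record !eqxx => ->.
pose R t := record_decode (V t k 0); pose S t tau o := cell_decode (V t tau o).
have S_code t tau o c : V t tau o = cell_code c -> S t tau o = c.
  by rewrite /S => ->; exact: fin_codeK.
pose s := [seq S 0 1 (center + j) | j <- iota 0 q].
have k1 : 1 <= k by []. have k1' : 1 < k by [].
have init1 o : o < window -> if (center <= o) && (o < center + q)
    then (V 0 1 o == cell_code blank) || is_bit (V 0 1 o) else V 0 1 o == cell_code blank.
  move=> ow; have /and3P[_ h _] := ok1 0 1 o (leq0n _) k1 ow.
  by apply: contraR h => nb; apply/orP; right; move: nb; case: ifP.
have sz : size s = q by rewrite size_map size_iota.
have s_nth j : j < q -> nth blank s j = S 0 1 (center + j).
  by move=> jq; rewrite (nth_map 0) ?size_iota // nth_iota.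
have cw j : j < q -> center + j < window by rewrite /window; lia.
have is_bit_code a : is_bit a -> exists b, a = cell_code (Some (inl b)).
  by case/orP=> /eqP ->; [exists false | exists true].
have prefix := @leading_bits_prefix s.
have {}prefix : forall j, nth blank (map (@bit M) (leading_bits (M := M) s)) j = nth blank s j.
  apply: prefix => j.
    rewrite sz => jq; rewrite s_nth //; have := init1 _ (cw _ jq).
    rewrite leq_addr ltn_add2l jq /= => /orP[/eqP/S_code ->|/is_bit_code [b /S_code ->]]; first by left.
    by right; rewrite is_bitE.
  case: (ltnP j.+1 q) => jq; last by move=> _; rewrite nth_default // sz.
  rewrite (s_nth _ jq) (s_nth _ (ltnW jq)) => e0; have := init1 _ (cw _ (ltnW jq)).
  rewrite leq_addr ltn_add2l (ltnW jq) /= => /orP[/eqP e1|/is_bit_code [b /S_code]]; last by rewrite e0.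
  have := ok 0 1 (center + j) 0 1 (center + j.+1) 0 1 0 isT k1 (cw _ (ltnW jq)) isT k1 (cw _ jq) isT k1 w0.
  move/negP=> nb; apply/S_code/eqP/negPn/negP => ne; apply: nb.
  rewrite /bad; do 4 (apply/orP; left); apply/orP; right.
  by rewrite /bad_gap e1 !eqxx leq_addr ne [center + j.+1]addnS eqxx.
pose y := leading_bits (M := M) s; exists y.
split; first by rewrite -sz; exact: size_leading_bits.
have init_symbols tau o : tau < k -> o < window ->
    S 0 tau o = symbol_at (ctapes (init M x y) (inord tau)) o.
  move=> tk ow; have vi : val (inord tau : 'I_k) = tau by exact: inordK.
  rewrite symbol_at_init vi.
  case: (eqVneq tau 1) => [->|tau1].
    have := init1 o ow; case: (leqP center o) => [co|_] /=; last by move/eqP/S_code.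
    rewrite prefix; case: ltnP => oq; last first.
      by move/eqP/S_code ->; rewrite nth_default // sz; lia.
    by rewrite s_nth ?subnKC //; lia.
  have /and3P[_ h _] := ok1 0 tau o (leq0n _) (ltnW tk) ow.
  move: h; rewrite /bad_init /= negb_or tk (negbTE tau1) /= negbK => /andP[_ /eqP e].
  apply: S_code; rewrite e /init_code; case: tau tau1 {tk e vi} => [|[|tau]] //= _.
    by rewrite nth_map_bit; case: (leqP center o) => //= _; case: ltnP => // _; case: nth.
  by rewrite nth_nil; case: ifP.
(* Garbage enters by at most one cell per step at either border, so at time [t] the offsets from [t]
   to [window - t], the latter excluded, are reliable. *)
have main t : t <= T -> (R t).1 = cstate (run y t) /\
    forall tau o, tau < k -> t <= o -> o + t < window ->
      S t tau o = symbol_at (ctapes (run y t) (inord tau)) o.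
  elim: t => [_|t IH tT].
    split; last by move=> tau o tk _; rewrite addn0; exact: init_symbols.
    have /and3P[_ h _] := ok1 0 k 0 (leq0n _) (leqnn _) w0.
    move: h; rewrite /bad_init /is_record !eqxx /= negb_or negbK => /andP[/eqP h _].
    have [e _ _] := tables_decode (rec_lt 0 (leq0n _)).
    by apply: fin_code_inj; rewrite -e.
  have [IH1 IH2] := IH (ltnW tT).
  have lt_c : center + t < window by rewrite /window /center; lia.
  have Rt : R t = record_of (run y t).
    rewrite [R t]surjective_pairing IH1; congr pair; apply/ffunP=> i; rewrite ffunE.
    have := ok t k 0 t i center t k 0 (ltnW tT) (leqnn _) w0 (ltnW tT) (ltnW (ltn_ord i)) (wc _ (leqnSn _)) (ltnW tT) (leqnn _) w0.
    have [e _ _] := tape_tables_decode i (rec_lt t (ltnW tT)).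
    move/negP=> nb; have ei : V t i center = scan_table (V t k 0) i.
      apply/eqP/negPn/negP => ne; apply: nb.
      rewrite /bad; do 3 (apply/orP; left); apply/orP; right.
      by rewrite /bad_scan /is_record !eqxx ltn_ord ne.
    have le : t <= center by rewrite /center; lia.
    by rewrite -symbol_at_scan -[i]inord_val -IH2 // (S_code _ _ _ _ (etrans ei e)) inord_val.
  split.
    have := ok t k 0 t.+1 k 0 t k 0 (ltnW tT) (leqnn _) w0 tT (leqnn _) w0 (ltnW tT) (leqnn _) w0.
    have [_ e1 _] := tables_decode (rec_lt t (ltnW tT)).
    have [e2 _ _] := tables_decode (rec_lt t.+1 tT).
    move/negP=> nb; have ei : state_table (V t.+1 k 0) = next_table (V t k 0).
      apply/eqP/negPn/negP => ne; apply: nb.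
      rewrite /bad; apply/orP; left; apply/orP; right.
      by rewrite /bad_next /is_record !eqxx ne.
    rewrite /= cstate_step -Rt; apply: fin_code_inj; rewrite -e2 -e1; exact: ei.
  move=> tau o tk to ow; pose i := Ordinal tk.
  have [_ ew em] := tape_tables_decode i (rec_lt t (ltnW tT)).
  pose m := move_code ((transition (R t)).2 i).2.
  have m2 : m <= 2 by rewrite /m; case: (_.2).
  (* The source of the cell in the preceding row; the predecessor is exact as [t < o]. *)
  pose o' := (o + m).-1.
  have eo : o'.+1 = o + m by rewrite /o'; lia.
  have ow' : o' < window by lia.
  have ow2 : o < window by lia.
  have := ok t k 0 t tau o' t.+1 tau o (ltnW tT) (leqnn _) w0 (ltnW tT) (ltnW tk) ow' tT (ltnW tk) ow2.
  move/negP=> nb; have ei : V t.+1 tau o = if o' == center then write_table (V t k 0) tau else V t tau o'.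
    apply/eqP/negPn/negP => ne; apply: nb.
    rewrite /bad; do 2 (apply/orP; left); apply/orP; right.
    by rewrite /bad_write /is_record !eqxx tk [move_table _ _]em eo eqxx ne.
  have ii : inord tau = i by apply: val_inj; exact: inordK.
  rewrite ii (symbol_at_step (o' := o')) -?Rt //.
  move: ei; case: eqP => _ ei; first by apply: S_code; rewrite ei; exact: ew.
  by rewrite -ii -IH2 //; [rewrite /S ei | lia | lia].
have [hR hS] := main T (leqnn _).
have fin tau o (tk : tau <= k) (ow : o < window) := ok1 T tau o (leqnn _) tk ow.
split.
  have /and3P[_ _ h] := fin k 0 (leqnn _) w0; have [_ _ e] := tables_decode (rec_lt T (leqnn _)).
  move: h; rewrite /bad_final /is_record !eqxx /= negb_or e => /andP[h _].
  by rewrite -hR; move: h; rewrite /R; case: tm_halt.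
have kl : k.-1 < k by [].
have om : inord k.-1 = ord_max :> 'I_k by apply: val_inj; exact: inordK.
have c1 : T <= center by rewrite /center; lia.
have c2 : center.+1 + T < window by rewrite /window /center; lia.
apply/output_true; rewrite -om -!hS //; try lia.
have /and3P[_ _ h1] := fin k.-1 center (ltnW kl) (wc _ (leqnSn _)).
have /and3P[_ _ h2] := fin k.-1 center.+1 (ltnW kl) (wc _ (leqnn _)).
split.
  by apply/S_code/eqP; apply: contraR h1 => ne; rewrite /bad_final !eqxx /= ne orbT.
have /and3P[hv _ _] := ok1 T k.-1 center.+1 (leqnn _) (ltnW kl) (wc _ (leqnn _)).
have lt : V T k.-1 center.+1 < n_cell.
  by apply: contraR hv; rewrite -leqNgt /bad_value kl => ->; rewrite orbT.
rewrite /S /cell_code /cell_decode fin_decodeK //.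
by apply: contra h2 => ib; rewrite /bad_final !eqxx /= ib !orbT.
Qed.

End FixInput.

End Tableau.

(** * The encoding of instances *)

Lemma bits_of_nat_double (b : bool) h : 0 < b + h.*2 ->
  bits_of_nat (b + h.*2) = b :: bits_of_nat h.
Proof.
rewrite /bits_of_nat; case: b => h0.
  rewrite [true + _]add1n; have -> : N.of_nat h.*2.+1 = N.succ_double (N.of_nat h) by lia.
  by case: (N.of_nat h).
rewrite [false + _]add0n in h0 *; have -> : N.of_nat h.*2 = N.double (N.of_nat h) by lia.
have : N.of_nat h <> N0 by lia.
by case: (N.of_nat h).
Qed.

(** The side condition excludes the step from 0 to 0, where [bits_of_nat] adds no letter. *)
Lemma binary_ind (P : nat -> Prop) : P 0 ->
  (forall (b : bool) h, 0 < b + h.*2 -> P h -> P (b + h.*2)) -> forall r, P r.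
Proof.
move=> P0 PS r; have [m] := ubnP r; elim: m r => // m IH r rm.
case: (posnP r) => [-> //|r0]; rewrite -(odd_double_half r).
by apply: PS; [lia | apply: IH; lia].
Qed.

Lemma half_bit (b : bool) h : (b + h.*2) %/ 2 = h.
Proof. by case: b => /=; lia. Qed.

Lemma nth_bits_of_nat r i : nth false (bits_of_nat r) i = odd (r %/ 2 ^ i).
Proof.
elim/binary_ind: r i => [|b h h0 IH] i; first by rewrite div0n nth_nil.
rewrite bits_of_nat_double //; case: i => [|i] /=.
  by rewrite divn1 oddD odd_double addbF; case: b h0.
by rewrite IH expnS divnMA half_bit.
Qed.

Lemma size_bits_of_nat r i : (i < size (bits_of_nat r)) = (2 ^ i <= r).
Proof.
elim/binary_ind: r i => [|b h h0 IH] i; first by rewrite [RHS]leqNgt expn_gt0.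
rewrite bits_of_nat_double //; case: i => [|i] //=.
by rewrite ltnS IH expnS; case: b h0 => /= ?; lia.
Qed.

Definition bits_value (s : seq bool) : nat := \sum_(0 <= i < size s) nth false s i * 2 ^ i.

Lemma bits_value_cons b s : bits_value (b :: s) = b + (bits_value s).*2.
Proof.
rewrite /bits_value /= big_nat_recl //= muln1; congr (_ + _).
rewrite -mul2n big_distrr /=; apply: eq_bigr => i _; rewrite expnS; lia.
Qed.

Lemma bits_of_nat_value r : bits_value (bits_of_nat r) = r.
Proof.
elim/binary_ind: r => [|b h h0 IH]; first by rewrite /bits_value big_geq.
by rewrite bits_of_nat_double // bits_value_cons IH.
Qed.

Lemma bits_value_gt0 s : last false s -> 0 < bits_value s.
Proof.
elim: s => // b [|c s] IH /=; rewrite bits_value_cons; first by case: b.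
by move=> /IH; lia.
Qed.

(** The canonical words are those ending in a one, and by the default [true] also the empty one. *)
Lemma bits_of_nat_of_bits s : last true s -> bits_of_nat (bits_value s) = s.
Proof.
elim: s => [|b s IH] /=; first by rewrite /bits_value big_geq.
case: s IH => [|c s] IH ls.
  by rewrite /= in ls; rewrite ls bits_value_cons /bits_value big_geq.
have v0 : 0 < bits_value (c :: s) by apply: bits_value_gt0; exact: ls.
by rewrite bits_value_cons bits_of_nat_double ?IH //; lia.
Qed.

Lemma last_bits_of_nat r : 0 < r -> last false (bits_of_nat r).
Proof.
elim/binary_ind: r => // b h h0 IH _; rewrite bits_of_nat_double //.
case: (posnP h) => [e|/IH].
  by move: h0; rewrite e /=; case: b.
by case: (bits_of_nat h).
Qed.

(* The comparison of a unary number with a binary one needs no large powers. *)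
Lemma leq_bits_value c s : (c <= bits_value s) =
  (c <= \sum_(0 <= i < size s) nth false s i * pow2_trunc i c).
Proof.
rewrite /bits_value; elim: (size s) => [|m IH]; first by rewrite !big_geq.
rewrite !big_nat_recr //=; set S := \sum_(0 <= i < m) _ in IH *; set S' := \sum_(0 <= i < m) _ in IH *.
case: (nth false s m); last by rewrite !mul0n !addn0.
(* Either this digit alone exceeds [c], and both sides hold, or this power and all the smaller ones
   are not truncated. *)
rewrite !mul1n /pow2_trunc; case: (ltnP c (2 ^ m)) => h.
  rewrite leq_addl; apply: leq_trans (leq_addl _ _); exact: ltnW.
have -> : S' = S.
  apply: eq_big_nat => i /andP[_ im]; rewrite /pow2_trunc (minn_idPl _) //.
  by apply: leq_trans h; rewrite leq_exp2l // ltnW.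
by [].
Qed.

Lemma nth_allpairs (S1 S2 R : Type) (f : S1 -> S2 -> R) (s : seq S1) (t : seq S2) d x0 y0 a b :
  a < size s -> b < size t ->
  nth d [seq f x y | x <- s, y <- t] (a * size t + b) = f (nth x0 s a) (nth y0 t b).
Proof.
elim: s a => //= x s IH [|a] sa tb; rewrite nth_cat size_map.
  by rewrite mul0n add0n tb (nth_map y0).
have -> : (a.+1 * size t + b < size t) = false by rewrite mulSn; lia.
have -> : a.+1 * size t + b - size t = a * size t + b by rewrite mulSn; lia.
exact: IH.
Qed.

Section Encoding.

Variables (n : nat) (G : sgraph n) (r : nat).

Definition adj_bits := [seq G i j | i <- enum 'I_n, j <- enum 'I_n].

Lemma size_adj_bits : size adj_bits = n * n.
Proof. by rewrite size_allpairs size_enum_ord. Qed.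

Lemma nth_adj_bits (i j : 'I_n) : nth false adj_bits (i * n + j) = G i j.
Proof.
have := @nth_allpairs _ _ _ (adj G) (enum 'I_n) (enum 'I_n) false i i i j.
by rewrite size_enum_ord !nth_ord_enum => ->.
Qed.

Lemma size_encode : size (encode G r) = (n.+1 + n * n) + size (bits_of_nat r).
Proof. by rewrite /encode size_cat /= size_cat size_nseq -/adj_bits size_adj_bits; lia. Qed.

Lemma nth_encode_ones i : i < n -> nth false (encode G r) i.
Proof. by move=> ltn; rewrite /encode nth_cat size_nseq ltn nth_nseq ltn. Qed.

Lemma nth_encode_sep : nth false (encode G r) n = false.
Proof. by rewrite /encode nth_cat size_nseq ltnn subnn. Qed.

Lemma nth_encode_adj (i j : 'I_n) : nth false (encode G r) (n.+1 + (i * n + j)) = G i j.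
Proof.
have ij : i * n + j < n * n by exact: pair_index_lt.
rewrite /encode nth_cat size_nseq; have -> : (n.+1 + (i * n + j) < n) = false by lia.
have -> : n.+1 + (i * n + j) - n = (i * n + j).+1 by lia.
by rewrite /= nth_cat -/adj_bits size_adj_bits ij nth_adj_bits.
Qed.

Lemma nth_encode_bound i :
  nth false (encode G r) ((n.+1 + n * n) + i) = nth false (bits_of_nat r) i.
Proof.
rewrite /encode nth_cat size_nseq; have -> : (n.+1 + n * n + i < n) = false by lia.
have -> : n.+1 + n * n + i - n = (n * n + i).+1 by lia.
rewrite /= nth_cat -/adj_bits size_adj_bits; have -> : (n * n + i < n * n) = false by lia.
by have -> : n * n + i - n * n = i by lia.
Qed.

End Encoding.

(** Cutting the power off at [r.+1] is harmless, because dividing [r] by anything larger than [r]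
    gives 0. *)
Definition encode_bit n (g : nat -> nat -> bool) r i : bool :=
  if i < n then true
  else if i == n then false
  else if i < n.+1 + n * n then g ((i - n.+1) %/ n) ((i - n.+1) %% n)
  else odd (r %/ pow2_trunc (i - (n.+1 + n * n)) r.+1).

(** The sum is the binary length of [r]: it counts the exponents with [2 ^ i <= r], all of which are
    below [r]. *)
Definition encode_size n r : nat :=
  n.+1 + n * n + \sum_(0 <= i < r) (pow2_trunc i r.+1 <= r).

Lemma encode_mkseq n (G : sgraph n) (g : nat -> nat -> bool) r :
  (forall i j : 'I_n, G i j = g i j) ->
  encode G r = mkseq (encode_bit n g r) (encode_size n r).
Proof.
move=> GE; have sz : size (encode G r) = encode_size n r.
  rewrite size_encode /encode_size; congr (_ + _).
  rewrite (eq_bigr (fun i => nat_of_bool (i < size (bits_of_nat r)))) => [|i _].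
    rewrite big_mkord sum_ltn; symmetry; apply/minn_idPr; rewrite leqNgt size_bits_of_nat -ltnNge.
    exact: ltn_expl.
  by rewrite size_bits_of_nat /pow2_trunc geq_min ltnn orbF.
apply: (@eq_from_nth _ false) => [|i]; first by rewrite size_mkseq.
rewrite sz => isz; rewrite nth_mkseq // /encode_bit.
case: (ltngtP i n) => h; first by rewrite nth_encode_ones.
  case: (ltnP i (n.+1 + n * n)) => h'.
    have n0 : 0 < n by case: (n) h h' => //= h h'; lia.
    have dn : (i - n.+1) %/ n < n by rewrite ltn_divLR //; lia.
    have mn : (i - n.+1) %% n < n by rewrite ltn_mod.
    have := nth_encode_adj G r (Ordinal dn) (Ordinal mn); rewrite GE /= => <-.
    by rewrite -divn_eq subnKC.
  rewrite -{1}(subnKC h') nth_encode_bound nth_bits_of_nat /pow2_trunc.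
  case: (leqP (2 ^ (i - (n.+1 + n * n))) r.+1) => // le.
  by rewrite !divn_small //; lia.
by rewrite h nth_encode_sep.
Qed.

(** * Membership in NP *)

Definition word_adj (w : seq bool) n i j : bool := nth false w (n.+1 + (i * n + j)).

(* A certificate lists the members of the alliance and, in unary, the positions of
   the ends of the chords. *)
Definition cert_pos (y : seq bool) n u (b : bool) : nat :=
  \sum_(0 <= k < n + n) nth false y (n + ((2 * u + b) * (n + n) + k)).

(** As positions are numbers of ones, every word yields some, and only their distinctness has to be
    tested. *)
Definition verify_graph (w y : seq bool) n i j : bool :=
  [&& ~~ (word_adj w n i j (+) word_adj w n j i), (i == j) ==> ~~ word_adj w n i j &
    (i != j) ==> [&& ~~ (word_adj w n i j (+)
      crossing (cert_pos y n i false) (cert_pos y n i true)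
               (cert_pos y n j false) (cert_pos y n j true)),
      cert_pos y n i false != cert_pos y n j false & cert_pos y n i true != cert_pos y n j true]]
  && (cert_pos y n i false != cert_pos y n j true).

Definition verify_bound (w y : seq bool) n : bool :=
  \sum_(0 <= u < n) nth false y u <=
  \sum_(0 <= i < size w - (n.+1 + n * n)) nth false w ((n.+1 + n * n) + i) *
     pow2_trunc i (\sum_(0 <= u < n) nth false y u).

Definition verify_vertex (w y : seq bool) n v : bool :=
  ~~ nth false y v && has (fun u => nth false y u && word_adj w n v u) (iota 0 n) ==>
  (\sum_(0 <= u < n) (~~ nth false y u && word_adj w n v u) <
   \sum_(0 <= u < n) (nth false y u && word_adj w n v u)).

(** The word must continue after the matrix and end in a one: then the bound is positive and in
    canonical notation, so that the word is an encoding. *)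
Definition verify_at (w y : seq bool) n : bool :=
  [&& n.+1 + n * n < size w, nth false w (size w).-1,
      all (fun i => all (fun j => verify_graph w y n i j) (iota 0 n)) (iota 0 n),
      has (fun u => nth false y u) (iota 0 n) &
      verify_bound w y n && all (fun v => verify_vertex w y n v) (iota 0 n)].

Definition verify (w y : seq bool) : bool := verify_at w y (find negb w).

Lemma find_ones n s : find negb (nseq n true ++ false :: s) = n.
Proof. by elim: n => //= n ->. Qed.

Lemma all_iota n (P : pred nat) : reflect (forall i, i < n -> P i) (all P (iota 0 n)).
Proof.
by apply: (iffP allP) => h i; [move=> i_n | rewrite mem_iota => /andP[_ i_n]];
   apply: h; rewrite ?mem_iota.
Qed.

Lemma has_iota n (P : pred nat) : reflect (exists2 i, i < n & P i) (has P (iota 0 n)).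
Proof.
apply: (iffP hasP) => [[i]|[i i_n Pi]]; last by exists i; rewrite ?mem_iota.
by rewrite mem_iota => /andP[_ i_n] Pi; exists i.
Qed.

Lemma verify_encode n (G : sgraph n) r : circle_graph G -> 1 <= r ->
  (exists S : {set 'I_n}, offensive_alliance G S /\ 1 <= #|S| <= r) ->
  exists y, size y <= (size (encode G r) + 2) ^ 3 /\ verify (encode G r) y.
Proof.
move=> /positions_of_circle_graph [pos [pos_lt pos_inj posE]] r1 [S [oS /andP[_ Sr]]].
have [s SE] := set_pred S.
pose y := mkseq (fun i => if i < n then s i else
  (i - n) %% (n + n) < pos ((i - n) %/ (n + n) %/ 2) (odd ((i - n) %/ (n + n))))
  (n + (2 * n) * (n + n)).
have ys u : u < n -> nth false y u = s u by move=> un; rewrite nth_mkseq ?un //; lia.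
have yp u (b : bool) : u < n -> cert_pos y n u b = pos u b.
  move=> un; rewrite /cert_pos (eq_big_nat _ _ (F2 := fun k => nat_of_bool (k < pos u b))).
    by rewrite big_mkord sum_ltn; apply/minn_idPr/ltnW/pos_lt.
  move=> k /andP[_ kn]; have h : (2 * u + b) * (n + n) + k < (2 * n) * (n + n).
    by apply: pair_index_lt => //; case: b => /=; lia.
  rewrite nth_mkseq ?ltn_add2l // ltnNge leq_addr /= addKn !divmod_pair //.
  have -> : (2 * u + b) %/ 2 = u by case: b {h} => /=; lia.
  by rewrite oddD mul2n odd_double; case: b {h}.
have wa (i j : 'I_n) : word_adj (encode G r) n i j = G i j by exact: nth_encode_adj.
have wa' i j (i_n : i < n) (jn : j < n) :
   word_adj (encode G r) n i j = G (Ordinal i_n) (Ordinal jn) by exact: (wa (Ordinal i_n) (Ordinal jn)).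
have sb : 0 < size (bits_of_nat r) by rewrite size_bits_of_nat.
exists y; split.
  rewrite size_mkseq size_encode; have := leq_addr (n * n + size (bits_of_nat r) + 1) n.
  set m := (X in (X + 2) ^ 3) => _; have le : n <= m by rewrite /m; lia.
  apply: (@leq_trans ((n + 2) ^ 3)); last by rewrite leq_exp2r // leq_add2r.
  by rewrite !expnS expn0; nia.
rewrite /verify {2}/encode find_ones; apply/and5P; split.
- by rewrite size_encode; lia.
- rewrite size_encode; have -> : (n.+1 + n * n + size (bits_of_nat r)).-1 =
     n.+1 + n * n + (size (bits_of_nat r)).-1 by lia.
  by rewrite nth_encode_bound nth_last last_bits_of_nat.
- apply/all_iota => i i_n; apply/all_iota => j jn; rewrite /verify_graph !wa' !yp //.
  rewrite [G (Ordinal jn) _]adj_sym addbb /=.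
  have ne b b' : pos i b = pos j b' -> i = j /\ b = b' by exact: pos_inj.
  have -> : pos i false != pos j true by apply/eqP => /ne [].
  case: (eqVneq i j) => [e|ij] /=.
    have -> : Ordinal i_n = Ordinal jn by apply: val_inj.
    by rewrite adj_irrefl.
  rewrite posE // addbb /= !andbT; apply/andP; split; apply/eqP => /ne [e _]; by rewrite e eqxx in ij.
- case: oS => /set0Pn [x]; rewrite SE inE => sx _.
  by apply/has_iota; exists x; rewrite ?ys.
apply/andP; split.
  have ry c : c = \sum_(0 <= u < n) s u -> \sum_(0 <= u < n) nth false y u = c.
    by move=> ->; apply: eq_big_nat => u /andP[_ un]; rewrite ys.
  rewrite /verify_bound (ry _ erefl) -(card_pred n) -SE size_encode addKn.
  rewrite (eq_bigr (fun i => nth false (bits_of_nat r) i * pow2_trunc i #|S|)) => [|i _].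
    by rewrite -leq_bits_value bits_of_nat_value.
  by rewrite nth_encode_bound.
rewrite SE in oS; have GE (i j : 'I_n) : G i j = word_adj (encode G r) n i j by rewrite wa.
have [_ h] := (offensive_alliance_nat s GE).1 oS.
apply/all_iota => v vn; apply/implyP => /andP[nv /has_iota [u un /andP[yu vu]]].
have := h v vn; rewrite -(ys v) // => /(_ nv) lt.
set p := fun u => nat_of_bool (~~ s u && word_adj (encode G r) n v u) in lt.
rewrite (eq_big_nat _ _ (F2 := p)) => [|u' /andP[_ un']]; last by rewrite /p ys.
rewrite [X in _ < X](eq_big_nat _ _ (F2 := fun u => nat_of_bool (s u && word_adj (encode G r) n v u))).
  by apply: lt; exists u; rewrite // -ys // yu.
by move=> u' /andP[_ un']; rewrite ys.
Qed.

Lemma find_negb_nth (w : seq bool) i : i < find negb w -> nth false w i.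
Proof. by move/(before_find false)/negbFE. Qed.

Lemma encode_verify (w y : seq bool) : verify w y -> OffensiveAllianceCircle w.
Proof.
rewrite /verify; set n := find negb w; case/and5P=> ew lw /all_iota hG /has_iota [u0 u0n yu0].
case/andP=> hB /all_iota hV.
have {}hG i j : i < n -> j < n -> verify_graph w y n i j by move=> i_n; exact/all_iota/hG.
pose g (i j : 'I_n) := word_adj w n i j.
have g_sym : symmetric g.
  move=> i j; have /andP[/and3P[h _ _] _] := hG i j (ltn_ord i) (ltn_ord j).
  by apply/eqP; move: h; rewrite /g; case: (word_adj w n i j); case: word_adj.
have g_irr : irreflexive g.
  move=> i; have /andP[/and3P[_ h _] _] := hG i i (ltn_ord i) (ltn_ord i).
  by apply/negbTE; move: h; rewrite eqxx.
pose G := SGraph g_sym g_irr; pose s := drop (n.+1 + n * n) w; pose r := bits_value s.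
have ss : size s = size w - (n.+1 + n * n) by rewrite size_drop.
have ls b : last b s.
  rewrite (last_nth false); case es : (size s) => [|m]; first by lia.
  rewrite /= nth_drop; move: lw; congr (is_true (nth _ _ _)); lia.
have bs : bits_of_nat r = s by exact: bits_of_nat_of_bits.
have wE : w = encode G r.
  apply: (@eq_from_nth _ false) => [|i iw]; first by rewrite size_encode bs ss; lia.
  have hn : ~~ nth false w n.
    by apply: (nth_find false); rewrite has_find -/n; lia.
  case: (ltngtP i n) => h.
  - by rewrite nth_encode_ones // find_negb_nth.
  - case: (ltnP i (n.+1 + n * n)) => h'.
      have n0 : 0 < n by lia.
      have dn : (i - n.+1) %/ n < n by rewrite ltn_divLR //; lia.
      have mn : (i - n.+1) %% n < n by rewrite ltn_mod.
      have := nth_encode_adj G r (Ordinal dn) (Ordinal mn).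
      by rewrite /= /g /word_adj /= -divn_eq subnKC.
    by rewrite -{2}(subnKC h') nth_encode_bound bs nth_drop subnKC.
  - by rewrite h nth_encode_sep (negbTE hn).
exists n, G, r; split=> //.
- apply: (@circle_graph_of_positions _ _ (cert_pos y n)) => [u u' b b' un un' e|u v uv].
    have /andP[/and3P[_ _ h1] h2] := hG u u' un un'.
    have /andP[_ h3] := hG u' u un' un.
    case: (eqVneq u u') h1 => [uu _|_ /and3P[_ h4 h5]].
      by split=> //; case: b b' e => [] [] // e; [move: h3; rewrite e eqxx | move: h2; rewrite e eqxx].
    by exfalso; case: b b' e => [] [] // e; [move: h5 | move: h3 | move: h2 | move: h4]; rewrite e eqxx.
  have /andP[/and3P[_ _ h1] _] := hG u v (ltn_ord u) (ltn_ord v).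
  have uv' : u != v :> nat by [].
  move: h1; rewrite uv' => /and3P[h1 _ _]; rewrite /= /g.
  by move: h1; case: word_adj; case: crossing.
- exact/bits_value_gt0/ls.
have GE (i j : 'I_n) : G i j = word_adj w n i j by [].
exists [set i : 'I_n | nth false y i]; split.
  apply/(offensive_alliance_nat (nth false y) GE); split; first by exists u0.
  move=> v vn nv [u un h]; have := hV v vn; rewrite /verify_vertex nv => /implyP; apply.
  by apply/has_iota; exists u.
rewrite (card_pred n (nth false y)); apply/andP; split.
  by apply/sum_bool_gt0; exists u0.
rewrite /r leq_bits_value ss; apply: leq_trans hB _.
by apply/eq_leq/eq_bigr => i _; rewrite nth_drop.
Qed.

(** Replaces the search by bounded sums and quantifiers, under which [pt] is closed. *)
Lemma find_negb_sum (w : seq bool) :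
  find negb w = \sum_(0 <= i < size w) all (fun j => nth false w j) (iota 0 i.+1).
Proof.
rewrite (eq_big_nat _ _ (F2 := fun i => nat_of_bool (i < find negb w))) => [|i /andP[_ iw]].
  by rewrite big_mkord sum_ltn; apply/esym/minn_idPr; exact: find_size.
congr nat_of_bool; apply/all_iota/idP => [h|h j ji]; last first.
  by apply: find_negb_nth; apply: leq_trans h.
rewrite ltnNge; apply/negP => fi; have fw : has negb w.
  by rewrite has_find; apply: leq_ltn_trans iw.
by have := nth_find false fw; rewrite h.
Qed.

(** * Polynomial-time evaluation of the verifier *)

Section Terms.

Variable m : nat.
Implicit Types n a b d e i j r u v : ctx m -> nat.

Lemma pt_crossing a b d e : pt a -> pt b -> pt d -> pt e ->
  pt (fun c => crossing (a c) (b c) (d c) (e c)).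
Proof. by move=> *; rewrite /crossing; pt_tac. Qed.

Lemma pt_word_adj n i j : pt n -> pt i -> pt j ->
  pt (fun c => word_adj (inputs c).1 (n c) (i c) (j c)).
Proof. by move=> *; rewrite /word_adj; pt_tac. Qed.

Lemma pt_cert_pos n u (s : bool) : pt n -> pt u ->
  pt (fun c => cert_pos (inputs c).2 (n c) (u c) s).
Proof. by move=> *; rewrite /cert_pos; pt_tac. Qed.

Lemma pt_find_negb : pt (fun c : ctx m => find negb (inputs c).1).
Proof.
apply: (@PtExt m (fun c => \sum_(0 <= z < size (inputs c).1)
  all (fun k => nth false (inputs c).1 k) (iota 0 z.+1))) => [c|].
  by rewrite -find_negb_sum.
by pt_tac.
Qed.

End Terms.

Ltac pt_extra2 := first [pt_extra1 | apply: pt_crossing | apply: pt_word_adj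
  | apply: pt_cert_pos | apply: pt_find_negb].
Ltac pt_extra ::= pt_extra2.

Section Verifier.

Variable m : nat.
Implicit Types n i j v : ctx m -> nat.

Lemma pt_verify_graph n i j : pt n -> pt i -> pt j ->
  pt (fun c => verify_graph (inputs c).1 (inputs c).2 (n c) (i c) (j c)).
Proof. by move=> *; rewrite /verify_graph; pt_tac. Qed.

Lemma pt_verify_bound n : pt n ->
  pt (fun c => verify_bound (inputs c).1 (inputs c).2 (n c)).
Proof. by move=> *; rewrite /verify_bound; pt_tac. Qed.

Lemma pt_verify_vertex n v : pt n -> pt v ->
  pt (fun c => verify_vertex (inputs c).1 (inputs c).2 (n c) (v c)).
Proof. by move=> *; rewrite /verify_vertex; pt_tac. Qed.

End Verifier.

Ltac pt_extra3 := first [pt_extra2 | apply: pt_verify_graph | apply: pt_verify_bound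
  | apply: pt_verify_vertex].
Ltac pt_extra ::= pt_extra3.

Lemma pt_verify m : pt (fun c : ctx m => verify (inputs c).1 (inputs c).2).
Proof. by rewrite /verify /verify_at; pt_tac. Qed.

Theorem offensive_alliance_in_NP : in_NP OffensiveAllianceCircle.
Proof.
exists verify, (('X + 2%:P) ^+ 3)%R; split.
  have [M [p hM]] := pt_computable (pt_const 0 1) (pt_verify 1).
  by exists M, p => x y; have := hM x y; rewrite /mkseq /=; case: verify.
move=> w; split=> [[n [G [r [-> cG r1 hS]]]]|[y [_ /encode_verify]]] //.
have [y [sy vy]] := verify_encode cG r1 hS.
by exists y; rewrite horner_exp_add2.
Qed.

(** * The reduction is computable in polynomial time *)

(** Uniform in the context, so that such a term can be used below any number of bound variables. *)
Definition ptx (f : seq bool -> nat) : Prop :=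
  forall m, pt (fun c : ctx m => f (inputs c).1).

Definition ptx1 (f : seq bool -> nat -> nat) : Prop :=
  forall m (a : ctx m -> nat), pt a -> pt (fun c => f (inputs c).1 (a c)).

Definition ptx2 (f : seq bool -> nat -> nat -> bool) : Prop :=
  forall m (a b : ctx m -> nat), pt a -> pt b -> pt (fun c => f (inputs c).1 (a c) (b c)).

Definition ptx3 (f : seq bool -> nat -> nat -> nat -> bool) : Prop :=
  forall m (a b d : ctx m -> nat), pt a -> pt b -> pt d ->
    pt (fun c => f (inputs c).1 (a c) (b c) (d c)).

Ltac pt_extra4 := first
  [ pt_extra3
  | match goal with
    | H : ptx _ |- _ => exact: (H _)
    | H : ptx1 _ |- _ => apply: (H _ _)
    | H : ptx2 _ |- _ => apply: (H _ _ _)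
    | H : ptx3 _ |- _ => apply: (H _ _ _ _)
    end ].
Ltac pt_extra ::= pt_extra4.

Section ChordTerms.

Variables (l L r : seq bool -> nat) (al be : seq bool -> nat -> nat) (red : nat -> bool).
Hypotheses (pt_l : ptx l) (pt_L : ptx L) (pt_r : ptx r) (pt_al : ptx1 al) (pt_be : ptx1 be).
Hypothesis pt_red : ptx1 (fun _ v => red v).

Lemma pt_budget : ptx (fun x => budget (l x) (L x) (r x)).
Proof. by move=> m; rewrite /budget; pt_tac. Qed.

Lemma pt_order : ptx (fun x => order (l x) (L x) (r x)).
Proof.
by move=> m; rewrite /order /base3 /base2 /base1 /n_abs /n_poi /budget; pt_tac.
Qed.

Lemma pt_n_cross : ptx1 (fun x v => n_cross (l x) (al x) (be x) red v).
Proof.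
move=> m a pa; have pr := pt_red pa; rewrite /n_cross /light_deg /light_adj.
by pt_tac; apply: pt_crossing; pt_tac.
Qed.

Lemma pt_chord_end (e : bool) :
  ptx1 (fun x v => chord_end (l x) (L x) (r x) (al x) (be x) red v e).
Proof.
move=> m a pa; have pn := pt_n_cross pa.
rewrite /chord_end /block /offset /width /base_off /base3 /base2 /base1 /n_abs /n_poi /budget.
by case: e; pt_tac.
Qed.

Lemma pt_chord_adj : ptx2 (fun x => chord_adj (l x) (L x) (r x) (al x) (be x) red).
Proof.
move=> m a b pa pb; rewrite /chord_adj; have h e := pt_chord_end e.
by apply: pt_and; [pt_tac | apply: pt_crossing; apply: (h _ m)].
Qed.

End ChordTerms.

Section ClauseTerms.

Variables (N : seq bool -> nat) (D : nat) (forb : seq bool -> nat -> nat -> nat -> bool).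
Hypotheses (pt_N : ptx N) (pt_forb : ptx3 forb).

Lemma pt_n_light : ptx (fun x => n_light (N x) D).
Proof. by move=> m; rewrite /n_light /n_copy /n_clause /n_var; pt_tac. Qed.

Lemma pt_n_slot : ptx (fun x => n_slot (N x) D).
Proof. by move=> m; rewrite /n_slot /n_copy /n_clause /n_var; pt_tac. Qed.

Lemma pt_n_hit : ptx (fun x => n_hit (N x) D).
Proof. by move=> m; rewrite /n_hit /n_clause /n_var; pt_tac. Qed.

Lemma pt_light_al : ptx1 (fun x => light_al (N x) D).
Proof.
move=> m a pa; rewrite /light_al /last_copy /clause_of /var_of /sign_of.
rewrite /right_slot /left_slot /n_copy /n_clause /n_var; cbv zeta.
by pt_tac.
Qed.

Lemma pt_light_be : ptx1 (fun x => light_be (N x) D (forb x)).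
Proof.
move=> m a pa; rewrite /light_be /literal /last_copy /clause_of /var_of /sign_of.
rewrite /right_slot /left_slot /n_copy /n_clause /n_var; cbv zeta.
by pt_tac.
Qed.

Lemma pt_light_red : ptx1 (fun _ v => light_red v).
Proof. by move=> m a pa; rewrite /light_red; pt_tac. Qed.

End ClauseTerms.

Lemma pt_apply_table1 m b F (f : ctx m -> nat) : pt f -> pt (fun c => table1 b F (f c)).
Proof. exact: pt_table. Qed.

Lemma pt_apply_table2 m a b F (f g : ctx m -> nat) : pt f -> pt g ->
  pt (fun c => table2 a b F (f c) (g c)).
Proof. exact: pt_table2. Qed.

Ltac pt_extra5 := lazymatch goal with
  | |- pt (fun c => table1 _ _ _) => apply: pt_apply_table1
  | |- pt (fun c => table2 _ _ _ _ _) => apply: pt_apply_table2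
  | _ => pt_extra4
  end.
Ltac pt_extra ::= pt_extra5.

Section TableauTerms.

Variables (M : tm) (T q : seq bool -> nat).
Hypotheses (pt_T : ptx T) (pt_q : ptx q).

Lemma pt_n_row_cell : ptx (fun x => n_row_cell M x (T x) (q x)).
Proof. by move=> m; rewrite /n_row_cell /window /center; pt_tac. Qed.

Section Fixed.

Variable m : nat.
Implicit Types a t : ctx m -> nat.

Lemma pt_bad_value tau o a : pt tau -> pt o -> pt a ->
  pt (fun c : ctx m => bad_value M (tau c) (o c) (a c)).
Proof. by move=> *; rewrite /bad_value /is_record; pt_tac. Qed.

Lemma pt_bad_init t tau o a : pt t -> pt tau -> pt o -> pt a ->
  pt (fun c : ctx m => bad_init M (inputs c).1 (T (inputs c).1) (q (inputs c).1)
                         (t c) (tau c) (o c) (a c)).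
Proof.
move=> *; rewrite /bad_init /is_record /is_bit /init_code /state_table /center.
by pt_tac.
Qed.

Lemma pt_bad_gap t1 tau1 o1 a1 t2 tau2 o2 a2 :
  pt t1 -> pt tau1 -> pt o1 -> pt a1 -> pt t2 -> pt tau2 -> pt o2 -> pt a2 ->
  pt (fun c : ctx m => bad_gap M (T (inputs c).1) (t1 c) (tau1 c) (o1 c) (a1 c)
                         (t2 c) (tau2 c) (o2 c) (a2 c)).
Proof. by move=> *; rewrite /bad_gap /center; pt_tac. Qed.

Lemma pt_bad_scan t1 tau1 o1 a1 t2 tau2 o2 a2 :
  pt t1 -> pt tau1 -> pt o1 -> pt a1 -> pt t2 -> pt tau2 -> pt o2 -> pt a2 ->
  pt (fun c : ctx m => bad_scan M (T (inputs c).1) (t1 c) (tau1 c) (o1 c) (a1 c)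
                         (t2 c) (tau2 c) (o2 c) (a2 c)).
Proof.
move=> *; rewrite /bad_scan /is_record /scan_table /center.
by pt_tac.
Qed.

Lemma pt_bad_write t1 tau1 o1 a1 t2 tau2 o2 a2 t3 tau3 o3 a3 :
  pt t1 -> pt tau1 -> pt o1 -> pt a1 -> pt t2 -> pt tau2 -> pt o2 -> pt a2 ->
  pt t3 -> pt tau3 -> pt o3 -> pt a3 ->
  pt (fun c : ctx m => bad_write M (T (inputs c).1) (t1 c) (tau1 c) (o1 c) (a1 c)
                         (t2 c) (tau2 c) (o2 c) (a2 c) (t3 c) (tau3 c) (o3 c) (a3 c)).
Proof.
move=> *; rewrite /bad_write /is_record /write_table /move_table /center.
by pt_tac.
Qed.

Lemma pt_bad_next t1 tau1 o1 a1 t2 tau2 o2 a2 :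
  pt t1 -> pt tau1 -> pt o1 -> pt a1 -> pt t2 -> pt tau2 -> pt o2 -> pt a2 ->
  pt (fun c : ctx m => bad_next M (t1 c) (tau1 c) (o1 c) (a1 c) (t2 c) (tau2 c) (o2 c) (a2 c)).
Proof.
move=> *; rewrite /bad_next /is_record /state_table /next_table.
by pt_tac.
Qed.

Lemma pt_bad_final t tau o a : pt t -> pt tau -> pt o -> pt a ->
  pt (fun c : ctx m => bad_final M (T (inputs c).1) (t c) (tau c) (o c) (a c)).
Proof.
move=> *; rewrite /bad_final /is_record /is_bit /halt_table /center.
by pt_tac.
Qed.

End Fixed.

Lemma pt_forbidden : ptx3 (fun x => forbidden M x (T x) (q x)).
Proof.
move=> m a b d pa pb pd; rewrite /forbidden /bad.
have pX e : @pt m e -> [/\ pt (fun c => time_of M (inputs c).1 (T (inputs c).1) (q (inputs c).1) (e c)),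
    pt (fun c => tape_of M (inputs c).1 (T (inputs c).1) (q (inputs c).1) (e c)),
    pt (fun c => offset_of M (inputs c).1 (T (inputs c).1) (q (inputs c).1) (e c)) &
    pt (fun c => value_of M (e c))].
  by move=> pe; rewrite /time_of /tape_of /offset_of /value_of /window /center; split; pt_tac.
have [ta1 ta2 ta3 ta4] := pX _ pa; have [tb1 tb2 tb3 tb4] := pX _ pb.
have [td1 td2 td3 td4] := pX _ pd.
apply: pt_or; last exact: pt_bad_final.
apply: pt_or; last exact: pt_bad_next.
apply: pt_or; last exact: pt_bad_write.
apply: pt_or; last exact: pt_bad_scan.
apply: pt_or; last exact: pt_bad_gap.
by apply: pt_or; [exact: pt_bad_value | exact: pt_bad_init].
Qed.

End TableauTerms.

Lemma pt_encode_bit n r (g : seq bool -> nat -> nat -> bool) :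
  ptx n -> ptx r -> ptx2 g -> ptx1 (fun x i => encode_bit (n x) (g x) (r x) i).
Proof. by move=> pn pr pg m a pa; rewrite /encode_bit; pt_tac. Qed.

Lemma pt_encode_size n r : ptx n -> ptx r -> ptx (fun x => encode_size (n x) (r x)).
Proof. by move=> pn pr m; rewrite /encode_size; pt_tac. Qed.

(** * NP-hardness *)

Lemma horner_leq (p : {poly nat}) a b : a <= b -> ((p.[a])%R <= (p.[b])%R).
Proof.
move=> ab; rewrite /horner; elim: (polyseq p) => //= c s IH.
by rewrite leq_add2r leq_mul.
Qed.

(** Membership in the language only asks for some instance with the given code, so the converse
    direction of the reduction has to recover the instance from the word. *)
Lemma encode_inj n n' (G : sgraph n) (G' : sgraph n') r r' :
  encode G r = encode G' r' -> exists e : n = n',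
    r = r' /\ forall i j, G i j = G' (cast_ord e i) (cast_ord e j).
Proof.
move=> h; have e : n = n'.
  by have := congr1 (find negb) h; rewrite /encode !find_ones.
move: G' h; rewrite -e => G' h; exists erefl; split=> [|i j].
  rewrite -[r]bits_of_nat_value -[r']bits_of_nat_value; congr bits_value.
  have := congr1 size h; rewrite !size_encode => /addnI sz.
  apply: (@eq_from_nth _ false) => // i _.
  by rewrite -(nth_encode_bound G r) -(nth_encode_bound G' r') h.
by rewrite -(nth_encode_adj G r) h nth_encode_adj !cast_ord_id.
Qed.

Section Hardness.

Variables (M : tm) (p pM : {poly nat}).

Definition cert_len (x : seq bool) : nat := (p.[size x])%R.
(** One bound for all admissible certificates; shorter runs are covered because halted
    configurations do not change. *)
Definition time_bound (x : seq bool) : nat := (pM.[(size x + cert_len x)%N])%R.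

Definition csp_cells x := n_row_cell M x (time_bound x) (cert_len x).
Definition csp_forbidden x := forbidden M x (time_bound x) (cert_len x).

Definition red_l x := n_light (csp_cells x) (n_value M).
Definition red_L x := n_slot (csp_cells x) (n_value M).
Definition red_r x := n_hit (csp_cells x) (n_value M).
Definition red_al x := light_al (csp_cells x) (n_value M).
Definition red_be x := light_be (csp_cells x) (n_value M) (csp_forbidden x).

Definition red_order x := order (red_l x) (red_L x) (red_r x).
Definition red_budget x := budget (red_l x) (red_L x) (red_r x).
Definition red_adj x := chord_adj (red_l x) (red_L x) (red_r x) (red_al x) (red_be x) light_red.

Definition reduction (x : seq bool) : seq bool :=
  mkseq (encode_bit (red_order x) (red_adj x) (red_budget x))
        (encode_size (red_order x) (red_budget x)).

Lemma reduction_polytime : polytime_function reduction.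
Proof.
have pc : ptx cert_len by move=> m; rewrite /cert_len; pt_tac.
have pT : ptx time_bound by move=> m; rewrite /time_bound; pt_tac.
have pN : ptx csp_cells by exact: pt_n_row_cell.
have pF : ptx3 csp_forbidden by exact: pt_forbidden.
have pl : ptx red_l by exact: pt_n_light.
have pL : ptx red_L by exact: pt_n_slot.
have pr : ptx red_r by exact: pt_n_hit.
have pal : ptx1 red_al by exact: pt_light_al.
have pbe : ptx1 red_be by exact: pt_light_be.
have po : ptx red_order by exact: pt_order.
have pb : ptx red_budget by exact: pt_budget.
have pa : ptx2 red_adj by apply: pt_chord_adj => //; exact: pt_light_red.
have psz := pt_encode_size po pb; have pbit := pt_encode_bit po pb pa.
have [M' [p' h]] := pt_computable (psz 0) (pbit 1 (fun c => c.2) (@PtVar 0)).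
exists M', p' => x; have := h x [::]; rewrite /= addn0; congr computes_within.
by apply: eq_mkseq => i; case: encode_bit.
Qed.

Lemma n_value_gt0 : 0 < n_value M.
Proof. exact: leq_ltn_trans (record_lt (tm_start M, [ffun=> None])). Qed.

Lemma csp_cells_gt0 x : 0 < csp_cells x.
Proof. by rewrite /csp_cells /n_row_cell /window muln_gt0; lia. Qed.

Definition red_graph x : sgraph (red_order x) :=
  let N0 := csp_cells_gt0 x in let D0 := n_value_gt0 in
  chord_graph (red_r x) light_red (n_light_gt0 N0 D0) (n_slot_gt1 N0 D0)
    (light_al_inj N0 D0) (light_be_inj (forb := csp_forbidden x) N0 D0)
    (light_al_neq_be (forb := csp_forbidden x) N0 D0).

Lemma reduction_encode x : reduction x = encode (red_graph x) (red_budget x).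
Proof. by symmetry; exact: encode_mkseq. Qed.

Lemma red_graph_alliance x :
  (exists S, offensive_alliance (red_graph x) S /\ 1 <= #|S| <= red_budget x) <->
  exists y, size y <= cert_len x /\ accepting (run M x y (time_bound x)).
Proof.
have N0 := csp_cells_gt0 x; have D0 := n_value_gt0.
apply: iff_trans (offensive_alliance_hitting (red_r x) light_red (n_light_gt0 N0 D0)
  (n_slot_gt1 N0 D0) (light_al_be (csp_forbidden x) N0 D0)
  (light_be_bound (csp_forbidden x) N0 D0) (light_al_inj N0 D0)
  (light_be_inj (forb := csp_forbidden x) N0 D0)
  (light_al_neq_be (forb := csp_forbidden x) N0 D0)) _.
apply: iff_trans (hitting_satisfiable (csp_forbidden x) N0 D0) _.
split=> [|[y [yq acc]]]; first exact: satisfiable_run.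
exact: run_satisfiable yq acc.
Qed.

Lemma reduction_correct x : OffensiveAllianceCircle (reduction x) <->
  exists y, size y <= cert_len x /\ accepting (run M x y (time_bound x)).
Proof.
apply: iff_trans (red_graph_alliance x); rewrite reduction_encode.
split=> [[n [G [r [h _ _ [S [oS cS]]]]]]|hS].
  have [e [er GE]] := encode_inj h; move: G S h oS cS GE; rewrite -er.
  case: n / e => G S _ oS cS GE; exists S; split=> //.
  have [s SE] := set_pred S; rewrite SE in oS *.
  have g1 (i j : 'I_(red_order x)) : red_graph x i j = red_adj x i j by [].
  have g2 (i j : 'I_(red_order x)) : G i j = red_adj x i j by rewrite -g1 GE !cast_ord_id.
  by apply/(offensive_alliance_nat s g1)/(offensive_alliance_nat s g2).
exists (red_order x), (red_graph x), (red_budget x); split=> //.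
  exact: chord_graph_circle.
have [S [_ /andP[S1 S2]]] := hS; exact: leq_trans S2.
Qed.

End Hardness.

Theorem offensive_alliance_NP_hard : NP_hard OffensiveAllianceCircle.
Proof.
move=> L' [V [p [[M [pM hM]] hL]]]; exists (reduction M p pM).
split; first exact: reduction_polytime.
move=> x; apply: iff_trans (hL x) _; apply: iff_trans _ (iff_sym (reduction_correct M p pM x)).
have acc y : size y <= (p.[size x])%R ->
    accepting (run M x y (time_bound p pM x)) <-> V x y.
  move=> sy; have : computes_within M (time_bound p pM x) x y [:: V x y].
    apply: computes_within_le (hM x y); apply: horner_leq.
    by rewrite leq_add2l.
  rewrite /computes_within /accepting -/(run M x y _) => -[hh ho]; rewrite ho.
  by split=> [[_ [->]]|->].
by split=> -[y [sy h]]; exists y; split=> //; apply/acc.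
Qed.

Theorem theorem11 : NP_complete OffensiveAllianceCircle.
Proof. exact: (conj offensive_alliance_in_NP offensive_alliance_NP_hard). Qed.
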